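(* Let $z_0,z_1\in\mathrm{Spin}_{n+1}$. The map $\mathrm{sing}:\mathcal L_n(z_0;z_1)\to\mathcal H([0,1])$, $\Gamma\mapsto\mathrm{sing}(\Gamma)$, is continuous.
   Context: Fix an integer $n\ge 2$. $\Pi:\mathrm{Spin}_{n+1}\to\mathrm{SO}_{n+1}$ is the universal (double) cover; Lie algebras are identified via $\Pi$. For $1\le j\le n$ let $\mathfrak a_j=e_{j+1}e_j^\top-e_je_{j+1}^\top\in\mathfrak{so}_{n+1}$. A map $\Gamma:J\to\mathrm{Spin}_{n+1}$ on an interval $J$ is locally convex if it is absolutely continuous and, for almost every $t$, $\Gamma(t)^{-1}\Gamma'(t)=\sum_{j=1}^n\kappa_j(t)\mathfrak a_j$ with positive functions $\kappa_j:J\to(0,+\infty)$. Spaces of curves: $\mathcal L_n(z_0;z_1)$ is the space of locally convex curves $\Gamma:[0,1]\to\mathrm{Spin}_{n+1}$ with $\Gamma(0)=z_0$, $\Gamma(1)=z_1$, in any of the following versions. (a) $\mathcal L_n^{[C^r]}(z_0;z_1)$, $r\ge1$: curves of class $C^r$ (with all $\kappa_j>0$ everywhere), with the $C^r$ topology. (b) $\mathcal L_n^{[H^r]}(z_0;z_1)$, $r\ge 2$: curves of Sobolev class $H^r=W^{r,2}$ (with all $\kappa_j>0$ everywhere), with the $H^r$ topology. (c) $\mathcal L_n^{[H^1]}(z_0;z_1)$: curves for which the functions $\xi_j=\kappa_j-1/\kappa_j$ are in $L^2([0,1])$, topologized by $(\xi_1,\dots,\xi_n)\in L^2([0,1];\mathbb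 R)^n$ (for fixed $z_0$, the curve is determined by the $\xi_j$). Singular set: let $\eta\in S_{n+1}$, $i\mapsto n+2-i$, with permutation matrix $P_\eta$. Let $\mathrm{Bru}_\eta\subset\mathrm{Spin}_{n+1}$ be the open dense set of $z$ such that $\Pi(z)=U_0P_\eta U_1$ for some invertible upper triangular $U_0,U_1$. Let $\mathrm{Sing}_{n+1}=\mathrm{Spin}_{n+1}\smallsetminus\mathrm{Bru}_\eta$. For a locally convex $\Gamma:[t_0,t_1]\to\mathrm{Spin}_{n+1}$, $\mathrm{sing}(\Gamma)=\Gamma^{-1}[\mathrm{Sing}_{n+1}]\smallsetminus\{t_0,t_1\}$; this set is known to be finite. $\mathcal H([0,1])$ is the set of compact subsets of $[0,1]$ (including $\emptyset$) with the Hausdorff distance $d_{\mathcal H}(X,Y)=\max\{\sup_{x\in X}\inf_{y\in Y}|x-y|,\ \sup_{y\in Y}\inf_{x\in X}|x-y|\}$ for nonempty $X,Y$, with $d_{\mathcal H}(\emptyset,X)=1$ for $X\neq\emptyset$ and $d_{\mathcal H}(\emptyset,\emptyset)=0$. *)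

(* Defs.v *)
From HB Require Import structures.
From mathcomp Require Import all_boot all_order all_algebra perm.
From mathcomp Require Import all_classical all_reals all_analysis.

Set Implicit Arguments.
Unset Strict Implicit.
Unset Printing Implicit Defensive.

Import Order.TTheory GRing.Theory Num.Theory.
Import numFieldNormedType.Exports.

Local Open Scope classical_set_scope.
Local Open Scope ring_scope.

(* The group Spin_m is realized inside the real Clifford algebra Cl_m of the
   Euclidean space R^m (v * v = - |v|^2), and Cl_m itself as an algebra of
   real matrices of size 2^m: Cl_0 = R, and the representation of Cl_m.+1 is
   the one induced from the representation of Cl_m, so that, inductively, it
   is the left regular representation of Cl_m, which is faithful. *)

Fixpoint cl_dim (m : nat) : nat :=
  if m is m'.+1 then (cl_dim m' + cl_dim m')%N else 1%N.

(* The matrices of the canonical basis e_0, ..., e_(m-1) of R^m. *)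
Fixpoint cl_gen (R : realType) (m : nat) : 'I_m -> 'M[R]_(cl_dim m) :=
  match m with
  | 0 => fun=> 0
  | m'.+1 => fun i =>
      if unlift ord_max i is Some j
      then block_mx (cl_gen R j) 0 0 (- cl_gen R j)
      else block_mx 0 (- 1%:M) 1%:M 0
  end.
Arguments cl_gen R {m} i.

Definition cl_vec (R : realType) (m : nat) (v : 'cV[R]_m) : 'M[R]_(cl_dim m) :=
  \sum_(i < m) v i 0 *: cl_gen R i.

(* Spin_m consists of the products of an even number of unit vectors; with
   spin_cover below it is the double cover of SO_m, universal for m >= 3. *)
Definition Spin (R : realType) (m : nat) : set 'M[R]_(cl_dim m) :=
  [set z | exists s : seq 'cV[R]_m,
     [/\ ~~ odd (size s),
         forall v, v \in s -> \sum_(i < m) v i 0 ^+ 2 = 1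
       & z = foldr (fun v w => cl_vec v *m w) 1%:M s]].
Arguments Spin : clear implicits.

(* The coordinate along e_i of an element of Cl_m that is a vector: the
   matrices e_i are orthogonal for the trace form, and e_i * e_i = - 1. *)
Definition cl_coord (R : realType) (m : nat) (x : 'M[R]_(cl_dim m)) (i : 'I_m)
  : R := - \tr (cl_gen R i *m x) / (cl_dim m)%:R.

(* The covering map Pi : Spin_m -> SO_m, Pi(z) v = z v z^-1. *)
Definition spin_cover (R : realType) (m : nat) (z : 'M[R]_(cl_dim m))
  : 'M[R]_m :=
  \matrix_(i, j) cl_coord (z *m cl_gen R j *m invmx z) i.

(* The derivative of Pi at 1, x |-> (v |-> x v - v x), which identifies the
   Lie algebra of Spin_m (a space of elements of Cl_m) with so_m. *)
Definition spin_lie (R : realType) (m : nat) (x : 'M[R]_(cl_dim m))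
  : 'M[R]_m :=
  \matrix_(i, j) cl_coord (x *m cl_gen R j - cl_gen R j *m x) i.

(* With indices from 0: e_(j+1) e_j^T - e_j e_(j+1)^T. *)
Definition frak_a (R : realType) (n : nat) (j : 'I_n) : 'M[R]_n.+1 :=
  delta_mx (lift ord0 j) (widen_ord (leqnSn n) j) -
  delta_mx (widen_ord (leqnSn n) j) (lift ord0 j).

Lemma cl_gen_anticomm (R : realType) (m : nat) (i j : 'I_m) :
  cl_gen R i *m cl_gen R j + cl_gen R j *m cl_gen R i =
  (- (i == j)%:R *+ 2)%:M.
Proof.
elim: m i j => [|m IH] i j; first by case: i.
rewrite /=; case: unliftP => [i' ->|->]; case: unliftP => [j' ->|->];
  rewrite !mulmx_block !(mulmx0, mul0mx, addr0, add0r, mulmxN, mulNmx, opprK,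
    mulmx1, mul1mx, oppr0) add_block_mx !(addr0, subrr, addNr).
- by rewrite IH (inj_eq (@lift_inj _ _)) [RHS](@scalar_mx_block _ (cl_dim m) (cl_dim m)).
- rewrite [_ == _]eq_sym (negbTE (neq_lift _ _)) oppr0 mul0rn.
  by rewrite [RHS](@scalar_mx_block _ (cl_dim m) (cl_dim m)) raddf0.
- rewrite (negbTE (neq_lift _ _)) oppr0 mul0rn.
  by rewrite [RHS](@scalar_mx_block _ (cl_dim m) (cl_dim m)) raddf0.
- by rewrite eqxx [RHS](@scalar_mx_block _ (cl_dim m) (cl_dim m)) mulr2n raddfD /= raddfN.
Qed.
Lemma cl_dim_gt0 m : (0 < cl_dim m)%N.
Proof. by elim: m => //= m IH; rewrite addn_gt0 IH. Qed.

Lemma cl_genM_tr (R : realType) (m : nat) (i j : 'I_m) :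
  \tr (cl_gen R i *m cl_gen R j) = - (i == j)%:R *+ cl_dim m.
Proof.
have := congr1 mxtrace (cl_gen_anticomm R i j).
rewrite mxtraceD [\tr (_ *m cl_gen R i)]mxtrace_mulC mxtrace_scalar -mulr2n.
rewrite mulrnAC => /eqP; rewrite eqr_pMn2r // => /eqP. done.
Qed.

Lemma cl_coord_vec (R : realType) (m : nat) (v : 'cV[R]_m) (i : 'I_m) :
  cl_coord (cl_vec v) i = v i 0.
Proof.
rewrite /cl_coord /cl_vec mulmx_sumr [\tr _]raddf_sum /= (bigD1 i) //= big1 => [|j ji].
  rewrite addr0 -scalemxAr mxtraceZ cl_genM_tr eqxx -[(-1) *+ _]mulr_natr.
  rewrite mulN1r mulrN opprK mulfK // pnatr_eq0 -lt0n; exact: cl_dim_gt0.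
by rewrite -scalemxAr mxtraceZ cl_genM_tr eq_sym (negbTE ji) oppr0 mul0rn mulr0.
Qed.

Lemma cl_vecM (R : realType) m (u v : 'cV[R]_m) :
  cl_vec u *m cl_vec v + cl_vec v *m cl_vec u =
  (- (\sum_i u i 0 * v i 0) *+ 2)%:M.
Proof.
rewrite /cl_vec !mulmx_suml.
under eq_bigr do rewrite mulmx_sumr.
under [X in _ + X]eq_bigr do rewrite mulmx_sumr.
rewrite [X in _ + X]exchange_big -big_split /= -sumrN -sumrMnl raddf_sum /=.
apply: eq_bigr => i _; rewrite -big_split /= (bigD1 i) //= big1 => [|j ji].
  rewrite addr0 -!scalemxAl -!scalemxAr !scalerA [v i 0 * _]mulrC -scalerDr.
  by rewrite cl_gen_anticomm eqxx scale_scalar_mx mulrnAr mulrN1.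
rewrite -!scalemxAl -!scalemxAr !scalerA [v j 0 * _]mulrC -scalerDr.
by rewrite cl_gen_anticomm eq_sym (negbTE ji) oppr0 mul0rn raddf0 scaler0.
Qed.


Lemma cl_vec_sqr (R : realType) m (u : 'cV[R]_m) :
  \sum_i u i 0 ^+ 2 = 1 -> cl_vec u *m cl_vec u = (-1)%:M.
Proof.
move=> u1; have := cl_vecM u u.
have -> : \sum_i u i 0 * u i 0 = 1 by rewrite -u1; apply: eq_bigr => i _; rewrite expr2.
rewrite -mulr2n raddfMn /= => u2.
have h (A : 'M[R]_(cl_dim m)) : A = 2^-1 *: (A *+ 2).
  by rewrite -[A *+ 2]scaler_nat scalerA mulVf ?scale1r // pnatr_eq0.
by rewrite [LHS]h u2 -h.
Qed.

Lemma cl_vec_delta (R : realType) m (j : 'I_m) :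
  cl_vec (delta_mx j 0 : 'cV[R]_m) = cl_gen R j.
Proof.
rewrite /cl_vec (bigD1 j) //= big1 ?addr0 => [|i ij].
  by rewrite mxE !eqxx scale1r.
by rewrite mxE (negbTE ij) scale0r.
Qed.

Lemma cl_vec_unitmx (R : realType) m (u : 'cV[R]_m) :
  \sum_i u i 0 ^+ 2 = 1 -> cl_vec u \in unitmx /\ invmx (cl_vec u) = - cl_vec u.
Proof.
move=> /cl_vec_sqr u2.
have u3 : cl_vec u *m (- cl_vec u) = 1%:M by rewrite mulmxN u2 raddfN /= opprK.
have [uu _] := mulmx1_unit u3; split=> //.
by rewrite -[RHS](mulKmx uu) u3 mulmx1.
Qed.

Lemma cl_vec_conj (R : realType) m (s : seq 'cV[R]_m) (v : 'cV[R]_m) :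
  (forall u, u \in s -> \sum_(i < m) u i 0 ^+ 2 = 1) ->
  let z := foldr (fun u w => cl_vec u *m w) 1%:M s in
  z \in unitmx /\ exists w, z *m cl_vec v *m invmx z = cl_vec w.
Proof.
elim: s => [|u s IH] us /=.
  split; first exact: unitmx1.
  by exists v; rewrite invmx1 mulmx1 mul1mx.
have [zu [w zw]] := IH (fun x xs => us x (@mem_behead _ (u :: s) _ xs)).
have u1 := us u (mem_head _ _).
have [uu ui] := cl_vec_unitmx u1.
rewrite unitmx_mul uu zu; split=> //.
set z := foldr _ _ _ in zu zw *.
have -> : invmx (cl_vec u *m z) = invmx z *m invmx (cl_vec u).
  have uz : cl_vec u *m z \in unitmx by rewrite unitmx_mul uu.
  rewrite -[RHS](mulKmx uz) -mulmxA (mulmxA z) mulmxV // mul1mx mulmxV //.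
  by rewrite mulmx1.
rewrite -!mulmxA (mulmxA (cl_vec v)) (mulmxA z) (mulmxA z) zw ui.
exists (- w + (2 * \sum_i u i 0 * w i 0) *: u).

rewrite mulmxA -[cl_vec u *m cl_vec w](addrK (cl_vec w *m cl_vec u)) cl_vecM.
rewrite mulmxBl mulmxN mulmxN -mulmxA cl_vec_sqr // mul_scalar_mx mul_mx_scalar.
rewrite scaleN1r /cl_vec.
rewrite opprK; move: (\sum_i u i 0 * w i 0) => a.
rewrite scaler_sumr -!sumrN -big_split /=; apply: eq_bigr => i _.
rewrite !mxE scalerA -!scaleNr -scalerDl; congr (_ *: _).
by rewrite mulNrn opprK addrC mulr_natl.
Qed.

Lemma spin_unitmx (R : realType) m (z : 'M[R]_(cl_dim m)) :
  Spin R m z -> z \in unitmx.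
Proof. by move=> [s [_ us ->]]; have [] := cl_vec_conj 0 us. Qed.

Lemma spin_coverP (R : realType) m (z : 'M[R]_(cl_dim m)) (v : 'cV[R]_m) :
  Spin R m z -> z *m cl_vec v *m invmx z = cl_vec (spin_cover z *m v).
Proof.
move=> [s [_ us zE]].
have ze j : z *m cl_gen R j *m invmx z = \sum_i spin_cover z i j *: cl_gen R i.
  have [_ [w]] := cl_vec_conj (delta_mx j 0) us.
  rewrite /= -zE cl_vec_delta => zw; rewrite zw; apply: eq_bigr => i _.
  by rewrite mxE zw cl_coord_vec.
rewrite {1}/cl_vec mulmx_sumr mulmx_suml.
under eq_bigr do rewrite -scalemxAr -scalemxAl ze scaler_sumr.
rewrite exchange_big /cl_vec; apply: eq_bigr => i _.
rewrite mxE scaler_suml; apply: eq_bigr => j _.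
by rewrite scalerA mulrC.
Qed.

Lemma spin_lie_gen (R : realType) n (j : 'I_n) :
  spin_lie (2^-1 *: (cl_gen R (widen_ord (leqnSn n) j) *m
                     cl_gen R (lift ord0 j))) = frak_a R j.
Proof.
set p := widen_ord _ _; set q := lift _ _.
have pq : p != q by apply/eqP => /(congr1 val) /= /eqP; rewrite /bump add1n ltn_eqF.
have C (i k : 'I_n.+1) : cl_gen R i *m cl_gen R k =
   - (cl_gen R k *m cl_gen R i) + (- (i == k)%:R *+ 2)%:M.
  by rewrite -cl_gen_anticomm addrC addrK.
apply/matrixP=> i k; rewrite !mxE.
have -> : (2^-1 *: (cl_gen R p *m cl_gen R q)) *m cl_gen R k -
   cl_gen R k *m (2^-1 *: (cl_gen R p *m cl_gen R q)) =
   (k == p)%:R *: cl_gen R q - (k == q)%:R *: cl_gen R p.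
  have -> : 2^-1 *: (cl_gen R p *m cl_gen R q) *m cl_gen R k -
     cl_gen R k *m (2^-1 *: (cl_gen R p *m cl_gen R q)) =
     2^-1 *: (cl_gen R p *m cl_gen R q *m cl_gen R k -
              cl_gen R k *m (cl_gen R p *m cl_gen R q)).
    by rewrite -scalemxAl -scalemxAr -scalerBr.
  rewrite -[cl_gen R p *m cl_gen R q *m _]mulmxA (C q k) mulmxDr mulmxN.
  rewrite [cl_gen R p *m (cl_gen R k *m _)]mulmxA (C p k) mulmxDl mulNmx.
  rewrite -[cl_gen R k *m _ *m _]mulmxA mul_mx_scalar mul_scalar_mx.
  set x := cl_gen R k *m _; rewrite opprD opprK addrAC [x - _]addrC addrK.
  rewrite [q == k]eq_sym [p == k]eq_sym.
  have h (y : R) : 2^-1 * (y *+ 2) = y.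
    by rewrite -[y *+ 2]mulr_natl mulrA mulVf ?mul1r // pnatr_eq0.
  rewrite -scaleNr -mulNrn opprK scalerDr !scalerA !h scaleNr.
  by [].
have -> : (k == p)%:R *: cl_gen R q - (k == q)%:R *: cl_gen R p =
  cl_vec ((k == p)%:R *: delta_mx q 0 - (k == q)%:R *: delta_mx p 0).
  rewrite -!cl_vec_delta /cl_vec !scaler_sumr -sumrB; apply: eq_bigr => l _.
  by rewrite !mxE !scalerA -scalerBl.
by rewrite cl_coord_vec !mxE eqxx !andbT -!natrM !mulnb [(k == p) && _]andbC [(k == q) && _]andbC.
Qed.

Section Curves.
Context {R : realType}.
Local Notation mu := (@lebesgue_measure R).

(* Derivative relative to [0, 1]: one-sided at the two end points. *)
Definition quot01 (V : normedModType R) (F : R -> V) (t : R) : R -> V :=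
  fun s => (s - t)^-1 *: (F s - F t).

Definition derivable01 (V : normedModType R) (F : R -> V) (t : R) : Prop :=
  cvg (quot01 F t @ within `[0, 1] t^').

Definition deriv01 (V : normedModType R) (F : R -> V) (t : R) : V :=
  lim (quot01 F t @ within `[0, 1] t^').

Definition deriv01n (V : normedModType R) (k : nat) (F : R -> V) : R -> V :=
  iter k (@deriv01 V) F.

Definition Cr01 (V : normedModType R) (r : nat) (F : R -> V) : Prop :=
  (forall k, (k < r)%N -> forall t, 0 <= t <= 1 ->
     derivable01 (deriv01n k F) t) /\
  (forall k, (k <= r)%N -> {within `[0, 1], continuous (deriv01n k F)}).

Definition abs_continuous01 (V : normedModType R) (F : R -> V) : Prop :=
  forall e : R, 0 < e -> exists2 d : R, 0 < d &
    forall (k : nat) (a b : 'I_k -> R),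
      (forall i, 0 <= a i /\ a i <= b i /\ b i <= 1) ->
      trivIset setT (fun i => `]a i, b i[%classic) ->
      \sum_(i < k) (b i - a i) < d ->
      \sum_(i < k) `|F (b i) - F (a i)| < e.

Definition L2norm01 (f : R -> R) : \bar R :=
  Lnorm mu 2%:E (EFin \o (f \_ `[0, 1])).

Definition L2_01 (f : R -> R) : Prop :=
  measurable_fun (`[0, 1] : set R) f /\ (L2norm01 f < +oo)%E.

(* The Sobolev class H^r = W^{r,2} on [0, 1], r >= 1: F is C^(r-1), its
   derivative of order r-1 is absolutely continuous, and its derivative of
   order r, which is then defined almost everywhere and is the weak one, is
   in L^2. *)
Definition Hr01 (m p r : nat) (F : R -> 'M[R]_(m, p)) : Prop :=
  [/\ Cr01 r.-1 F, abs_continuous01 (deriv01n r.-1 F) &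
      forall i j, L2_01 (fun t => deriv01n r F t i j)].

Definition dist_Cr (V : normedModType R) (r : nat) (F G : R -> V) : \bar R :=
  (\sum_(k < r.+1)
     ereal_sup [set `|deriv01n k F t - deriv01n k G t|%:E | t in `[0%R, 1%R]])%E.

Definition dist_Hr (V : normedModType R) (r : nat) (F G : R -> V) : \bar R :=
  (\sum_(k < r.+1)
     L2norm01 (fun t => `|deriv01n k F t - deriv01n k G t|%R))%E.

(* Curves in Spin_(n+1) are functions on R of which only the
   restriction to [0, 1] matters. *)
Section SpinCurves.
Context {n : nat}.
Implicit Types (G : R -> 'M[R]_(cl_dim n.+1)) (z : 'M[R]_(cl_dim n.+1)).

(* G^-1 G' as an element of so_(n+1). *)
Definition log_deriv G (t : R) : 'M[R]_n.+1 :=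
  spin_lie (invmx (G t) *m deriv01 G t).

Definition convex_at G (t : R) : Prop :=
  derivable01 G t /\
  exists2 kappa : 'I_n -> R, (forall j, 0 < kappa j) &
    log_deriv G t = \sum_(j < n) kappa j *: frak_a R j.

Definition locally_convex_curve G : Prop :=
  [/\ forall t, 0 <= t <= 1 -> Spin R n.+1 (G t),
      abs_continuous01 G &
      {ae mu, forall t, 0 <= t <= 1 -> convex_at G t}].

(* kappa_j is the entry (j+1, j) of \sum_j kappa_j a_j. *)
Definition kappa G (j : 'I_n) (t : R) : R :=
  log_deriv G t (lift ord0 j) (widen_ord (leqnSn n) j).

Definition xi G (j : 'I_n) (t : R) : R := kappa G j t - (kappa G j t)^-1.

Definition dist_H1 G1 G2 : \bar R :=
  (\sum_(j < n) L2norm01 (fun t => xi G1 j t - xi G2 j t)%R)%E.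

Definition convex_curves z0 z1 : set (R -> 'M[R]_(cl_dim n.+1)) :=
  [set G | [/\ locally_convex_curve G, G 0 = z0 & G 1 = z1]].

Definition LCr (r : nat) z0 z1 : set (R -> 'M[R]_(cl_dim n.+1)) :=
  [set G | [/\ convex_curves z0 z1 G, Cr01 r G &
               forall t, 0 <= t <= 1 -> convex_at G t]].

Definition LHr (r : nat) z0 z1 : set (R -> 'M[R]_(cl_dim n.+1)) :=
  [set G | [/\ convex_curves z0 z1 G, Hr01 r G &
               forall t, 0 <= t <= 1 -> convex_at G t]].

Definition LH1 z0 z1 : set (R -> 'M[R]_(cl_dim n.+1)) :=
  [set G | convex_curves z0 z1 G /\ forall j, L2_01 (xi G j)].

Definition eta : 'S_n.+1 := perm (@rev_ord_inj n.+1).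

(* is_trig_mx means lower triangular. *)
Definition Bru_eta : set 'M[R]_(cl_dim n.+1) :=
  [set z | Spin R n.+1 z /\
     exists U0 U1 : 'M[R]_n.+1,
       [/\ U0 \in unitmx /\ is_trig_mx U0^T, U1 \in unitmx /\ is_trig_mx U1^T
         & spin_cover z = U0 *m perm_mx eta *m U1]].

Definition Sing : set 'M[R]_(cl_dim n.+1) := Spin R n.+1 `\` Bru_eta.

Definition sing G : set R :=
  [set t | 0 <= t <= 1 /\ Sing (G t)] `\` [set 0; 1].

End SpinCurves.

Definition H01 : set (set R) := [set X : set R | X `<=` `[0, 1] /\ compact X].

Definition dist_H (X Y : set R) : R :=
  if `[< X = set0 >] then (if `[< Y = set0 >] then 0 else 1)
  else if `[< Y = set0 >] then 1
  else Num.max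
    (sup [set inf [set `|x - y| | y in Y] | x in X])
    (sup [set inf [set `|x - y| | x in X] | y in Y]).

End Curves.

(* f is a continuous map from the space A to the space B, whose topologies are
   given by the distances dA and dB. *)
Definition continuous_map (R : realType) (S T : Type)
    (A : set S) (dA : S -> S -> \bar R) (B : set T) (dB : T -> T -> R)
    (f : S -> T) : Prop :=
  (forall x, A x -> B (f x)) /\
  (forall x, A x -> forall e : R, 0 < e -> exists2 d : R, 0 < d &
     forall y, A y -> (dA x y < d%:E)%E -> dB (f x) (f y) < e).

(* Main.v *)
(* Let X(t) be the matrix Pi(G t) with its rows in reverse order. Then G t is
   singular iff some leading principal minor of X(t) vanishes, and X' = X Lambda
   a.e. with Lambda skew-symmetric, tridiagonal and positive below the diagonal.
   On an interval where the leading minors of X are positive, X V = L with V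
   upper triangular and L lower unitriangular, and L^-1 L' is concentrated and
   positive on the subdiagonal; so all the minors of L(a)^-1 L(t) are nonnegative
   and nondecreasing in t, and those that do not vanish identically are positive
   for t > a.
   Two consequences. First, factoring the first k rows of X(a) through an echelon
   form, a short arc issuing from X(a) is regular except possibly at a, with a
   length that depends only on X(a); likewise backwards. So singular times are
   isolated, and curves near G with the same end points have none near 0 and 1.
   Second, if X is regular on all of [a, b], then L(t) is trapped entrywise
   between L(a) and L(b), which, X being orthogonal, bounds the leading minors on
   [a, b] from below in terms of their values at a and b; so a singular time
   cannot disappear under a small perturbation. (No sign change is available for
   this: all the minors may vanish to even order.)
   Finally, each of the three topologies controls the uniform distance of X. *)
From HB Require Import structures.
Require Import Defs.
From mathcomp Require Import all_boot all_order all_algebra perm.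
From mathcomp Require Import all_classical all_reals all_analysis.
From mathcomp Require Import measurable_realfun.
From mathcomp Require Import ring lra zify.

Set Implicit Arguments.
Unset Strict Implicit.
Unset Printing Implicit Defensive.

Import Order.TTheory GRing.Theory Num.Theory.
Import numFieldNormedType.Exports.

Local Open Scope classical_set_scope.
Local Open Scope ring_scope.

(** Two facts shape the estimates. Derivatives exist only almost everywhere, and in class H^1 the
    coefficients kappa_j have no pointwise bounds, so neither a mean value theorem nor control by
    elapsed time is at hand. Monotonicity is therefore proved for absolutely continuous functions,
    and the constants of [lu_regular_after] and [sandwich] depend only on matrices at given times
    and on uniform distances, never on the speed. This is what lets both apply to the perturbed
    curve, of which only its end points and its uniform distance to the original are known.
    Orthogonality enters the lower bound as follows: a bound on L is also one on V = X^T L, and the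
    diagonal entries of V are quotients of consecutive leading minors, so these cannot decay faster
    than geometrically from the empty minor 1. In class H^1 the curves are compared through Q_H
    Q_G^T, with Q the image under Pi: its derivative Q_H (Lambda_H - Lambda_G) Q_G^T involves only
    the difference of the logarithmic derivatives, so no Gronwall argument is needed. *)

Section RealAnalysis.
Context {R : realType}.
Local Notation mu := (@lebesgue_measure R).
Implicit Types (a b c t : R) (f g h : R -> R).

(** Compactness of [a, b] in the form used throughout: a property that glues along adjacent
    intervals and holds on all short intervals containing a given point is global. The supremum of
    the reachable points is reached and cannot be less than b. *)
Lemma cousin (P : R -> R -> Prop) a b : a <= b ->
  (forall x y z, a <= x -> x <= y -> y <= z -> z <= b ->
     P x y -> P y z -> P x z) ->
  (forall c, a <= c <= b -> exists2 r, 0 < r &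
     forall x y, a <= x -> x <= c -> c <= y -> y <= b ->
       c - x < r -> y - c < r -> P x y) ->
  P a b.
Proof.
move=> ab tr loc.
pose T := [set t | a <= t <= b /\ P a t].
have Ta : T a.
  split; first by rewrite lexx.
  have [|r r0] := loc a; first by rewrite lexx.
  by apply; rewrite ?subrr.
have supT : has_sup T.
  by split; [exists a|exists b => t [/andP[]]].
have abs_cont : a <= sup T by apply: ub_le_sup => //; case: supT.
have cb : sup T <= b by apply: ge_sup; [exists a|move=> t [/andP[]]].
have [|r r0 Pr] := loc (sup T); first by rewrite abs_cont.
have [t [/andP[aT tb] Pt] tc] := sup_adherent r0 supT.
have tsup : t <= sup T by apply: ub_le_sup; [case: supT|split; [apply/andP|]].
pose y := Num.min b (sup T + r / 2).
have cy : sup T <= y by rewrite le_min cb; lra.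
have yb : y <= b by rewrite ge_min lexx.
have Pty : P t y.
  apply: Pr => //; first by lra.
  have : y <= sup T + r / 2 by rewrite ge_min lexx orbT.
  by lra.
have Pay : P a y by apply: (tr a t y) => //; lra.
have : y <= sup T by apply: ub_le_sup; [case: supT|split; [apply/andP; split=> //; lra|]].
rewrite ge_min => /orP[bs|]; last by lra.
by have <- : y = b by apply/eqP; rewrite eq_le yb; lra.
Qed.

(** * Absolutely continuous real functions on an interval *)

Definition abs_cont a b f : Prop :=
  forall e : R, 0 < e -> exists2 d : R, 0 < d &
    forall (k : nat) (u v : 'I_k -> R),
      (forall i, a <= u i /\ u i <= v i /\ v i <= b) ->
      trivIset setT (fun i => `]u i, v i[%classic) ->
      \sum_(i < k) (v i - u i) < d ->
      \sum_(i < k) `|f (v i) - f (u i)| < e.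

Lemma abs_cont_sub a b a' b' f : a <= a' -> b' <= b -> abs_cont a b f -> abs_cont a' b' f.
Proof.
move=> aa bb acf e /acf[d d0 H]; exists d => // k u v uv; apply: H => i.
by have [? [? ?]] := uv i; split; [|split]; lra.
Qed.

Lemma abs_cont_cst a b c : abs_cont a b (cst c).
Proof.
move=> e e0; exists 1 => // k u v _ _ _.
by rewrite big1 // => i _; rewrite subrr normr0.
Qed.

(* All the closure properties of absolute continuity follow from this
   Lipschitz domination. *)
Lemma abs_cont_dom a b f g h (C : R) : abs_cont a b f -> abs_cont a b g ->
  (forall x y, a <= x -> x <= y -> y <= b ->
     `|h y - h x| <= C * (`|f y - f x| + `|g y - g x|)) ->
  abs_cont a b h.
Proof.
move=> acf acg H e e0.
pose D := Num.max C 1.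
have D0 : 0 < D by rewrite lt_max ltr01 orbT.
have CD : C <= D by rewrite le_max lexx.
have e0' : 0 < e / (2 * D) by rewrite divr_gt0 // mulr_gt0.
have [d1 d10 H1] := acf _ e0'.
have [d2 d20 H2] := acg _ e0'.
exists (Num.min d1 d2); first by rewrite lt_min d10.
move=> k u v uv tr; rewrite lt_min => /andP[s1 s2].
have {}H1 := H1 _ _ _ uv tr s1.
have {}H2 := H2 _ _ _ uv tr s2.
apply: (@le_lt_trans _ _ (\sum_(i < k)
   D * (`|f (v i) - f (u i)| + `|g (v i) - g (u i)|))).
  apply: ler_sum => i _; have [? [? ?]] := uv i.
  by apply: (le_trans (H _ _ _ _ _)) => //; rewrite ler_wpM2r // addr_ge0.
rewrite -mulr_sumr big_split /=.
have -> : e = D * (e / (2 * D) + e / (2 * D)) by field; rewrite gt_eqF.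
by rewrite ltr_pM2l // ltrD.
Qed.

Lemma abs_cont_eq a b f g : (forall x, a <= x <= b -> f x = g x) ->
  abs_cont a b f -> abs_cont a b g.
Proof.
move=> fg acf; apply: (abs_cont_dom (C := 1) acf acf) => x y ax xy yb.
by rewrite -!fg ?mul1r ?lerDl //; apply/andP; split=> //; lra.
Qed.

Lemma abs_contD a b f g : abs_cont a b f -> abs_cont a b g -> abs_cont a b (fun t => f t + g t).
Proof.
move=> acf acg; apply: (abs_cont_dom (C := 1) acf acg) => x y _ _ _.
by rewrite mul1r opprD addrACA ler_normD.
Qed.

Lemma abs_cont_continuous a b f t e : abs_cont a b f -> a <= t <= b -> 0 < e ->
  exists2 d, 0 < d & forall s, a <= s <= b -> `|s - t| < d -> `|f s - f t| < e.
Proof.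
move=> acf /andP[at_ tb] /acf[d d0 H]; exists d => // s /andP[as_ sb] std.
have H1 u v : a <= u -> u <= v -> v <= b -> v - u < d -> `|f v - f u| < e.
  move=> au uv vb vud.
  have := H 1%N (fun=> u) (fun=> v); rewrite !big_ord_recl !big_ord0 !addr0.
  by apply=> // i j _ _ _; rewrite (ord1 i) (ord1 j).
case: (lerP t s) => ts.
  by apply: H1 => //; rewrite -(ger0_norm (_ : 0 <= s - t)) // subr_ge0.
rewrite distrC; apply: H1 => //; first exact: ltW.
by rewrite -(ger0_norm (_ : 0 <= t - s)) ?subr_ge0 1?ltW // 1?distrC ?std.
Qed.

Lemma abs_cont_bounded a b f : abs_cont a b f -> a <= b ->
  exists2 C, 0 < C & forall t, a <= t <= b -> `|f t| <= C.
Proof.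
move=> acf ab.
apply: (@cousin (fun x y => exists2 C, 0 < C &
   forall t, x <= t <= y -> `|f t| <= C)) => //.
  move=> x y z _ _ _ _ [C1 C10 H1] [C2 C20 H2].
  exists (Num.max C1 C2); first by rewrite lt_max C10.
  move=> t /andP[xt tz]; rewrite le_max.
  case: (lerP t y) => ty; first by rewrite H1 ?xt.
  by rewrite H2 ?orbT // tz ltW.
move=> c cab; have [r r0 H] := abs_cont_continuous acf cab ltr01; exists r => // x y ax xc cy yb xr yr.
exists (`|f c| + 1); first by rewrite ltr_wpDl.
move=> t /andP[xt ty].
have ftc : `|f t - f c| < 1.
  by apply: H; [apply/andP; split; lra|rewrite ltr_norml; apply/andP; split; lra].
rewrite -[f t](subrK (f c)) addrC; apply: le_trans (ler_normD _ _) _.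
by rewrite lerD2l ltW.
Qed.

Lemma abs_contM a b f g : a <= b -> abs_cont a b f -> abs_cont a b g ->
  abs_cont a b (fun t => f t * g t).
Proof.
move=> ab acf acg.
have [C1 C10 H1] := abs_cont_bounded acf ab.
have [C2 C20 H2] := abs_cont_bounded acg ab.
apply: (abs_cont_dom (C := Num.max C1 C2) acf acg) => x y ax xy yb.
have -> : f y * g y - f x * g x = f y * (g y - g x) + (f y - f x) * g x by ring.
apply: le_trans (ler_normD _ _) _; rewrite !normrM mulrDr addrC mulrC.
apply: lerD; apply: ler_wpM2r => //; rewrite le_max ?H1 ?H2 ?orbT //;
  by apply/andP; split; lra.
Qed.

Lemma abs_cont_lbound a b f : abs_cont a b f -> a <= b ->
  (forall t, a <= t <= b -> f t != 0) ->
  exists2 c, 0 < c & forall t, a <= t <= b -> c <= `|f t|.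
Proof.
move=> acf ab fn0.
apply: (@cousin (fun x y => exists2 C, 0 < C &
   forall t, x <= t <= y -> C <= `|f t|)) => //.
  move=> x y z _ _ _ _ [C1 C10 H1] [C2 C20 H2].
  exists (Num.min C1 C2); first by rewrite lt_min C10.
  move=> t /andP[xt tz]; rewrite ge_min.
  case: (lerP t y) => ty; first by rewrite H1 ?xt.
  by rewrite H2 ?orbT // tz ltW.
move=> c cab.
have e0 : 0 < `|f c| / 2 by rewrite divr_gt0 // normr_gt0 fn0.
have [r r0 H] := abs_cont_continuous acf cab e0; exists r => // x y ax xc cy yb xr yr.
exists (`|f c| / 2) => // t /andP[xt ty].
have ftc : `|f t - f c| < `|f c| / 2.
  by apply: H; [apply/andP; split; lra|rewrite ltr_norml; apply/andP; split; lra].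
have := ler_normD (f t) (f c - f t); rewrite addrC subrK (distrC (f c)); lra.
Qed.

Lemma abs_contV a b f : a <= b -> abs_cont a b f ->
  (forall t, a <= t <= b -> f t != 0) -> abs_cont a b (fun t => (f t)^-1).
Proof.
move=> ab acf fn0; have [c c0 H] := abs_cont_lbound acf ab fn0.
apply: (abs_cont_dom (C := (c ^+ 2)^-1) acf acf) => x y ax xy yb.
have xab : a <= x <= b by apply/andP; split; lra.
have yab : a <= y <= b by apply/andP; split; lra.
have -> : (f y)^-1 - (f x)^-1 = - (f y - f x) / (f y * f x).
  by field; rewrite !fn0.
rewrite normrM normrN normfV mulrC.
apply: (@le_trans _ _ ((c ^+ 2)^-1 * `|f y - f x|)).
  apply: ler_wpM2r => //; rewrite lef_pV2 ?posrE ?exprn_gt0 //.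
    by rewrite normrM expr2 ler_pM // ?H // ltW.
  by rewrite normr_gt0 mulf_neq0 // fn0.
by apply: ler_wpM2l; [rewrite invr_ge0 exprn_ge0 // ltW|rewrite lerDl].
Qed.

Lemma abs_cont_sum a b (I : Type) (r : seq I) (P : pred I) (F : I -> R -> R) :
  (forall i, P i -> abs_cont a b (F i)) -> abs_cont a b (fun t => \sum_(i <- r | P i) F i t).
Proof.
move=> H; elim: r => [|i r IH].
  by apply: abs_cont_eq (abs_cont_cst a b 0) => x _; rewrite big_nil.
case Pi : (P i); last by apply: abs_cont_eq IH => x _; rewrite big_cons Pi.
by apply: abs_cont_eq (abs_contD (H i Pi) IH) => x _; rewrite big_cons Pi.
Qed.

Lemma abs_cont_prod a b (I : Type) (r : seq I) (P : pred I) (F : I -> R -> R) :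
  a <= b ->
  (forall i, P i -> abs_cont a b (F i)) -> abs_cont a b (fun t => \prod_(i <- r | P i) F i t).
Proof.
move=> ab H; elim: r => [|i r IH].
  by apply: abs_cont_eq (abs_cont_cst a b 1) => x _; rewrite big_nil.
case Pi : (P i); last by apply: abs_cont_eq IH => x _; rewrite big_cons Pi.
by apply: abs_cont_eq (abs_contM ab (H i Pi) IH) => x _; rewrite big_cons Pi.
Qed.

(** Near c the values of f differ from f c by less than its absolute value, hence share its sign;
    the transfer of positivity from x to y glues by [cousin]. *)
Lemma abs_cont_keeps_pos a b f : abs_cont a b f -> a <= b -> 0 < f a ->
  (forall t, a <= t <= b -> f t != 0) -> forall t, a <= t <= b -> 0 < f t.
Proof.
move=> acf ab fa fn0 t /andP[at_ tb].
suff /(_ fa) : 0 < f a -> 0 < f t by [].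
apply: (@cousin (fun x y => 0 < f x -> 0 < f y) a t) => //.
  by move=> x y z _ _ _ _ H1 H2 /H1/H2.
move=> c /andP[ac_ ct]; have cab : a <= c <= b by rewrite ac_ (le_trans ct).
have e0 : 0 < `|f c| by rewrite normr_gt0 fn0.
have [r r0 H] := abs_cont_continuous acf cab e0; exists r => // x y ax xc cy yt xr yr.
have : `|f x - f c| < `|f c|.
  by apply: H; [apply/andP; split; lra|rewrite ltr_norml; apply/andP; split; lra].
have : `|f y - f c| < `|f c|.
  by apply: H; [apply/andP; split; lra|rewrite ltr_norml; apply/andP; split; lra].
rewrite !ltr_norml => /andP[+ +] /andP[+ +].
by case: (ler0P (f c)) => fc; lra.
Qed.


(** * Monotonicity and integral bounds from almost everywhere derivatives *)

Lemma is_derive_eps f t (l : R) : is_derive t 1 f l <->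
  forall e : R, 0 < e -> exists2 r : R, 0 < r & forall s : R, `|s - t| < r ->
    `|f s - f t - l * (s - t)| <= e * `|s - t|.
Proof.
split=> [[df <-] e e0|H].
  have /cvgrPdist_lt /(_ _ e0)[r /= r0 Hr] := df.
  exists r => // s st; have [->|sNt] := eqVneq s t.
    by rewrite !subrr mulr0 subrr normr0 mulr0.
  have d0 : s - t != 0 by rewrite subr_eq0.
  have := Hr (s - t); rewrite /= sub0r normrN => /(_ st d0) /=.
  rewrite -/('D_1 f t) [_%:A]mulr1 subrK /GRing.scale /= => H.
  have -> : f s - f t - 'D_1 f t * (s - t) =
     - ('D_1 f t - (s - t)^-1 * (f s - f t)) * (s - t) by field.
  by rewrite normrM normrN ler_wpM2r // ltW.
have H' : (fun x : R => x^-1 *: ((f \o shift t) (x *: 1) - f t)) @ 0^' --> l.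
  apply/cvgrPdist_le => e e0; have [r r0 Hr] := H e e0.
  exists r => // s; rewrite /= ?sub0r ?normrN => sr s0.
  have := Hr (s + t); rewrite addrK => /(_ sr).
  rewrite [_%:A]mulr1 /GRing.scale /= => {}Hr.
  have -> : l - s^-1 * (f (s + t) - f t) = - (f (s + t) - f t - l * s) / s.
    by field.
  by rewrite normrM normrN normfV ler_pdivrMr // normr_gt0.
by apply: DeriveDef; [apply/cvg_ex; exists l|apply: cvg_lim].
Qed.

Lemma negligible_cover (E : set R) (d : R) : mu.-negligible E -> 0 < d ->
  exists U : set R, [/\ open U, E `<=` U & (mu U < d%:E)%E].
Proof.
move=> [A [mA A0 EA]] d0.
have Afin : (mu A < +oo)%E by rewrite [mu A]A0.
have [U [oU AU UA]] := lebesgue_regularity_outer mA Afin d0.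
exists U; split=> //; first exact: subset_trans AU.
have mU : measurable U by exact: measurable_realfun.open_measurable.
rewrite -(setDUK AU); apply: le_lt_trans (measureU2 _ _ _) _ => //.
  exact: measurableD.
by rewrite [X in (X + _)%E](_ : _ = 0%E) // add0e.
Qed.

(** Induction from the left: the first interval is split off, and the remaining ones lie in the part
    of U to the right of it. *)
Lemma chain_measure (U : set R) (s : seq (R * R)) : measurable U ->
  pairwise (fun p q : R * R => p.2 <= q.1) s ->
  (forall p, p \in s -> p.1 <= p.2 /\ `]p.1, p.2[ `<=` U) ->
  ((\sum_(p <- s) (p.2 - p.1))%:E <= mu U)%E.
Proof.
elim: s U => [|p s IH] U mU /=; first by rewrite big_nil measure_ge0.
move=> /andP[/allP ps pw] H; rewrite big_cons EFinD.
have [p12 pU] := H p (mem_head _ _).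
have mp : measurable `]p.1, p.2[ by exact: measurable_itv.
have mup : mu `]p.1, p.2[ = (p.2 - p.1)%:E.
  rewrite lebesgue_measure_itv /= lte_fin EFinB; case: ltP => // p21.
  by rewrite -EFinB; congr (_%:E); lra.
have mU' : measurable (U `&` `[p.2, +oo[) by apply: measurableI.
have dis : `]p.1, p.2[ `&` (U `&` `[p.2, +oo[) = set0.
  by apply/seteqP; split=> // x [/=]; rewrite !in_itv /= andbT => ? [_]; lra.
apply: (@le_trans _ _ (mu (`]p.1, p.2[ `|` (U `&` `[p.2, +oo[)))).
  rewrite measureU //; apply: leeD.
    by rewrite -mup.
  apply: IH => // q qs; have [q12 qU] := H q (@mem_behead _ (p :: s) _ qs).
  split=> // x qx; split; first exact: qU.
  by move: qx (ps q qs); rewrite /= !in_itv /= andbT; lra.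
apply: le_measure; rewrite ?inE //; first exact: measurableU.
by rewrite subUset; split=> // x [].
Qed.

(** Ordered lists replace indexed families because they can be concatenated, as gluing by [cousin]
    requires. *)
Lemma abs_cont_chain a b f e : abs_cont a b f -> 0 < e -> exists2 d, 0 < d &
  forall s : seq (R * R), pairwise (fun p q : R * R => p.2 <= q.1) s ->
    (forall p, p \in s -> [/\ a <= p.1, p.1 <= p.2 & p.2 <= b]) ->
    \sum_(p <- s) (p.2 - p.1) < d -> \sum_(p <- s) `|f p.2 - f p.1| < e.
Proof.
move=> acf /acf[d d0 H]; exists d => // s pw sab.
rewrite !(big_nth (0, 0)) !big_mkord => sd.
apply: (H _ (fun i => (nth (0, 0) s i).1) (fun i => (nth (0, 0) s i).2)) => //.
  by move=> i; have [] := sab (nth (0, 0) s i); first exact: mem_nth.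
move=> i j _ _ [x [/=]]; rewrite !in_itv /= => xi xj; apply/val_inj/eqP.
have /(pairwiseP (0, 0)) {}pw := pw.
by case: ltngtP => // ij; have := pw _ _ _ _ ij; rewrite !inE !ltn_ord => /(_ isT isT); lra.
Qed.

(** The exceptional null set lies in an open set U of measure less than d. A short interval around
    an exceptional point is put in a list of intervals inside U, over which absolute continuity
    makes the total variation small; around any other point the nonnegative derivative yields a loss
    of at most [e'] times the length. [cousin] glues these estimates. *)
Theorem abs_cont_nondecreasing a b f : a <= b -> abs_cont a b f ->
  {ae mu, forall t, a < t < b -> exists2 l, 0 <= l & is_derive t 1 f l} ->
  f a <= f b.
Proof.
move=> ab acf aef; rewrite -subr_ge0; apply/ler_addgt0Pr => e e0.
(* The losses add up to [e' * (b - a)] at the ordinary points and to [e'] on the listed intervals,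
   which is at most e. *)
pose e' := e / (b - a + 2).
have e'0 : 0 < e' by rewrite divr_gt0 //; lra.
have [d d0 Hd] := abs_cont_chain acf e'0.
(* The end points count as exceptional, the derivative being given only inside. *)
pose E := ~` [set t | a < t < b -> exists2 l, 0 <= l & is_derive t 1 f l]
   `|` ([set a] `|` [set b]).
have negE : mu.-negligible E.
  apply: negligibleU; first by [].
  by apply: negligibleU; apply/negligibleP => //; apply: lebesgue_measure_set1.
have [U [oU EU Ud]] := negligible_cover negE d0.
suff [s [pw sab sU fs]] : exists s : seq (R * R),
   [/\ pairwise (fun p q : R * R => p.2 <= q.1) s,
       forall p, p \in s -> [/\ a <= p.1, p.1 <= p.2 & p.2 <= b],
       forall p, p \in s -> `]p.1, p.2[ `<=` U &
       - (e' * (b - a)) - \sum_(p <- s) `|f p.2 - f p.1| <= f b - f a].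
  have : ((\sum_(p <- s) (p.2 - p.1))%:E <= mu U)%E.
    apply: chain_measure => //; first exact: measurable_realfun.open_measurable.
    by move=> p ps; split; [have [] := sab p ps|exact: sU].
  move=> /le_lt_trans/(_ Ud); rewrite lte_fin => /(Hd _ pw sab).
  have : e' * (b - a) + e' <= e.
    have -> : e = e' * (b - a) + e' * 2 by rewrite /e'; field; lra.
    lra.
  lra.
apply: (cousin (P := fun x y => exists s : seq (R * R),
   [/\ pairwise (fun p q : R * R => p.2 <= q.1) s,
       forall p, p \in s -> [/\ x <= p.1, p.1 <= p.2 & p.2 <= y],
       forall p, p \in s -> `]p.1, p.2[ `<=` U &
       - (e' * (y - x)) - \sum_(p <- s) `|f p.2 - f p.1| <= f y - f x])) => //.
  move=> x y z ax xy yz zb [s1 [pw1 xy1 U1 f1]] [s2 [pw2 xy2 U2 f2]].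
  exists (s1 ++ s2); split.
  - rewrite pairwise_cat pw1 pw2 !andbT; apply/allrelP => p q ps qs.
    by have [_ _ ?] := xy1 p ps; have [? _ _] := xy2 q qs; lra.
  - by move=> p; rewrite mem_cat => /orP[/xy1|/xy2] [? ? ?]; split; lra.
  - by move=> p; rewrite mem_cat => /orP[/U1|/U2].
  - rewrite big_cat /=; lra.
move=> c /andP[ac_ cb]; have [cE|cE] := pselect (E c).
  have /EU Uc := cE.
  have [r /= r0 rU] := (nbhs_ballP _ _).1 (open_nbhs_nbhs (conj oU Uc)).
  exists r => // x y ax xc cy yb xr yr; exists [:: (x, y)]; split=> //.
  - by move=> p; rewrite inE => /eqP -> /=; split=> //; lra.
  - move=> p; rewrite inE => /eqP -> /= t /=; rewrite in_itv /= => /andP[xt ty].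
    by apply: rU; rewrite /ball /= ltr_norml; apply/andP; split; lra.
  - rewrite big_seq1 /=.
    have : 0 <= e' * (y - x) by apply: mulr_ge0; [exact: ltW|lra].
    have := ler_norm (- (f y - f x)); rewrite normrN; lra.
have [l l0 dl] : exists2 l, 0 <= l & is_derive c 1 f l.
  apply: contrapT => H; have ca : a != c by apply/eqP => ca'; apply: cE; right; left.
  have cb' : c != b by apply/eqP => ca'; apply: cE; right; right.
  by apply: cE; left => /= H'; apply/H/H'; rewrite !lt_neqAle ac_ cb ca cb'.
have [r r0 Hr] := (is_derive_eps f c l).1 dl _ e'0.
exists r => // x y ax xc cy yb xr yr; exists [::]; split=> //.
rewrite big_nil subr0.
have := Hr x; rewrite (ler0_norm (_ : x - c <= 0)); last by lra.
rewrite opprB => /(_ xr); have := Hr y.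
rewrite (ger0_norm (_ : 0 <= y - c)); last by lra.
move=> /(_ yr); rewrite !ler_norml => /andP[h1 _] /andP[_ h2].
have : 0 <= l * (y - c) by rewrite mulr_ge0 //; lra.
have : 0 <= l * (c - x) by rewrite mulr_ge0 //; lra.
lra.
Qed.


Lemma aeS (P Q : R -> Prop) : (forall t, P t -> Q t) ->
  {ae mu, forall t, P t} -> {ae mu, forall t, Q t}.
Proof. by move=> PQ; apply: negligibleS => t nQ /PQ. Qed.

Lemma aeI (P Q : R -> Prop) : {ae mu, forall t, P t} ->
  {ae mu, forall t, Q t} -> {ae mu, forall t, P t /\ Q t}.
Proof.
move=> aP aQ; apply: negligibleS (negligibleU aP aQ) => t /= nPQ.
by have [p|] := pselect (P t); [right => q; exact: nPQ|left].
Qed.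

Lemma ae_itv_inhabited a b (P : R -> Prop) : a < b ->
  {ae mu, forall t, P t} -> exists2 t, a < t < b & P t.
Proof.
move=> ab aeP; apply: contrapT => H.
have neg : mu.-negligible `]a, b[.
  apply: negligibleS aeP => t; rewrite /= in_itv /= => atb Pt.
  by apply: H; exists t.
have : mu `]a, b[ = 0%E by apply/negligibleP => //; exact: measurable_itv.
rewrite lebesgue_measure_itv /= lte_fin ab => /eqP.
by rewrite -EFinB eqe subr_eq0 gt_eqF.
Qed.

(** If f a = f b, the nondecreasing f is constant, against the positive derivative at any one point
    where it exists. *)
Lemma abs_cont_increasing a b f : a < b -> abs_cont a b f ->
  {ae mu, forall t, a < t < b -> exists2 l, 0 < l & is_derive t 1 f l} ->
  f a < f b.
Proof.
move=> ab acf aef.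
have mono x y : a <= x -> x <= y -> y <= b -> f x <= f y.
  move=> ax xy yb; apply: abs_cont_nondecreasing => //; first exact: abs_cont_sub acf.
  apply: aeS aef => t H /andP[xt ty].
  have [|l l0 ?] := H; first by apply/andP; split; lra.
  by exists l => //; exact: ltW.
rewrite lt_neqAle (mono a b (lexx a) (ltW ab) (lexx b)) andbT; apply/eqP => fab.
have [t /andP[at_ tb] H] := ae_itv_inhabited ab aef.
have [|l l0 /is_derive_eps dl] := H; first by rewrite at_ tb.
have l20 : 0 < l / 2 by rewrite divr_gt0.
have [r r0 Hr] := dl _ l20.
pose s := Num.min b (t + r / 2).
have ts : t < s by rewrite lt_min tb; lra.
have sb : s <= b by rewrite ge_min lexx.
have sr : s - t < r.
  have : s <= t + r / 2 by rewrite ge_min lexx orbT.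
  lra.
have := Hr s; rewrite (ger0_norm (_ : 0 <= s - t)); last lra.
move=> /(_ sr).
have -> : f s = f t.
  apply/eqP; rewrite eq_le.
  have h1 := mono a t; have h2 := mono t s; have h3 := mono s b.
  by apply/andP; split; lra.
rewrite subrr sub0r normrN ger0_norm; last by rewrite mulr_ge0 //; lra.
by rewrite ler_pM2r; lra.
Qed.

(** With F a primitive of H, both F - f and F + f are nondecreasing: F is absolutely continuous
    since H has small integral over small sets, and F' = H almost everywhere by Lebesgue
    differentiation. *)
Lemma integral_majorant a b f (H : R -> R) : a <= b -> abs_cont a b f ->
  mu.-integrable setT (EFin \o H) -> (forall t, 0 <= H t) ->
  {ae mu, forall t, a < t < b -> exists2 l, is_derive t 1 f l & `|l| <= H t} ->
  `|f b - f a| <= \int[mu]_t H t.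
Proof.
move=> ab acf intH H0 aef.
have intS (A : set R) : measurable A -> mu.-integrable A (EFin \o H).
  by move=> mA; apply: (integrableS measurableT).
pose F x := \int[mu]_(t in `]-oo, x]) H t.
have FB x y : x <= y -> F y - F x = \int[mu]_(t in `]x, y[) H t.
  move=> xy; rewrite /F Rintegral_itvB //.
    by rewrite -Rintegral_itv_bndo_bndc //; exact: intS.
  exact: intS.
have leS (A B : set R) : measurable A -> measurable B -> A `<=` B ->
   \int[mu]_(t in A) H t <= \int[mu]_(t in B) H t.
  move=> mA mB AB; rewrite /Rintegral fine_le //.
  - by apply: integrable_fin_num => //; exact: intS.
  - by apply: integrable_fin_num => //; exact: intS.
  - apply: ge0_subset_integral => //; first by case/integrableP: (intS _ mB).
    by move=> t _; rewrite lee_fin.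
have acF : abs_cont a b F.
  move=> e e0; have [d [d0 Hd]] := integral_normr_continuous intH e0.
  exists d => // k u v uv tr sd.
  have mi (i : 'I_k) : measurable (`]u i, v i[%classic : set R).
    exact: measurable_itv.
  have mD : measurable (\big[setU/set0]_(i < k) (`]u i, v i[%classic : set R)).
    exact: bigsetU_measurable.
  have muD : mu (\big[setU/set0]_(i < k) (`]u i, v i[%classic : set R)) =
      (\sum_(i < k) (v i - u i))%:E.
    transitivity (\sum_(i < k) mu `]u i, v i[)%E.
      exact: (measure_bigsetU_ord mu xpredT mi tr).
    rewrite -sumEFin; apply: eq_bigr => i _.
    have [_ [uvi _]] := uv i.
    rewrite lebesgue_measure_itv /= lte_fin EFinB; case: ltP => // vu.
    by rewrite -EFinB; congr (_%:E); lra.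
  have Dd : (mu (\big[setU/set0]_(i < k) (`]u i, v i[%classic : set R)) < d%:E)%E.
    by rewrite muD lte_fin.
  apply: le_lt_trans (Hd _ mD Dd).
  under eq_Rintegral do rewrite ger0_norm //.
  rewrite /Rintegral ge0_integral_bigsetU ?index_enum_uniq //.
  - rewrite -sum_fine; last first.
      by move=> i _; apply: integrable_fin_num => //; exact: intS.
    apply: ler_sum => i _; have [_ [uvi _]] := uv i.
    rewrite FB // ger0_norm //.
    by rewrite Rintegral_ge0.
  - exact: sub_trivIset tr.
  - by have /integrableP[] := intS _ mD.
  - by move=> x _; rewrite lee_fin.
have locH : locally_integrable setT H.
  by apply: open_integrable_locally => //; exact: openT.
have intHy (y : R) : mu.-integrable `]-oo, y] (EFin \o H) by apply: intS.
have aeF := FTC1Ny intHy locH.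
have Fab : F b - F a <= \int[mu]_t H t by rewrite FB //; apply: leS.
have key (s : R) : `|s| = 1 -> s * (f b - f a) <= F b - F a.
  move=> s1; suff : F a - s * f a <= F b - s * f b by lra.
  apply: (abs_cont_nondecreasing (f := fun t => F t - s * f t)) => //.
    have -> : (fun t => F t - s * f t) = (fun t => F t + (- s) * f t).
      by apply/funext => t; rewrite mulNr.
    by apply: abs_contD => //; apply: abs_contM => //; exact: abs_cont_cst.
  apply: aeS (aeI aeF aef) => t [[dF Ft] H1] /H1[l dl lH].
  exists (H t - s * l).
    by rewrite subr_ge0 (le_trans _ lH) // (le_trans (ler_norm _)) // normrM s1 mul1r.
  have dF' : is_derive t 1 F (H t).
    by apply: DeriveDef => //; rewrite -derive1E.
  have -> : (fun t => F t - s * f t) = F - s *: f by [].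
  exact: is_deriveB.
have := key 1; have := key (-1); rewrite normrN normr1 ler_norml => /(_ erefl) k1 /(_ erefl) k2.
by apply/andP; split; lra.
Qed.

Lemma L2norm01_ge0 (h : R -> R) : (0 <= L2norm01 h)%E.
Proof. exact: Lnorm_ge0. Qed.

(** Hölder's inequality against the indicator of [0, 1], whose L^2 norm is 1. *)
Lemma L1_le_L2norm01 (h : R -> R) : measurable_fun (`[0, 1] : set R) h ->
  (\int[mu]_t (`|(h \_ `[0, 1]) t|%:E) <= L2norm01 h)%E.
Proof.
move=> mh; pose I : R -> R := \1_`[0, 1].
have m01 : measurable (`[0, 1] : set R) by exact: measurable_itv.
have mh' : measurable_fun setT (h \_ `[0, 1]) by exact: (measurable_restrictT _ _).1.
have mI : measurable_fun setT I by apply: measurable_indic.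
have NI : ('N[mu]_2%:E[EFin \o I] = 1)%E.
  rewrite unlock /=.
  have -> : (\int[mu]_x (`|(I x)%:E| `^ 2)%E = \int[mu]_x (I x)%:E)%E.
    apply: eq_integral => x _; rewrite /= /I indicE.
    case: (x \in _); rewrite ?normr1 ?normr0 ?powR1 ?powR0 //.
  rewrite integral_indic // setIT.
  have mu01 : mu `[0, 1] = 1%E.
    by rewrite lebesgue_measure_itv /= lte_fin ltr01 oppr0 adde0.
  by rewrite -[X in (X `^ _)%E]/(mu `[0, 1]) mu01 poweR1r.
have two : (2^-1 + 2^-1 = 1 :> R)%R by lra.
have := hoelder mu mh' mI (ltr0n _ 2) (ltr0n _ 2) two.
rewrite NI mule1; apply: le_trans; rewrite Lnorm1.
apply: ge0_le_integral => //.
- by apply/measurable_EFinP; exact: measurableT_comp.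
- apply/measurable_EFinP; apply: measurableT_comp => //.
  exact: measurable_funM.
- move=> x _; rewrite /= lee_fin normrM /I patchE indicE.
  by case: (x \in _); rewrite ?normr1 ?mulr1 ?normr0 ?mul0r.
Qed.

(** Turns L^2 control of a derivative into uniform control of the function. An infinite norm makes
    the bound trivial; otherwise every [h j] is integrable on [0, 1]. *)
Theorem L2_majorant f k (h : 'I_k -> R -> R) : abs_cont 0 1 f ->
  (forall j, measurable_fun (`[0, 1] : set R) (h j)) ->
  {ae mu, forall t, 0 < t < 1 ->
     exists2 l, is_derive t 1 f l & `|l| <= \sum_j `|h j t|} ->
  forall t, 0 <= t <= 1 -> (`|f t - f 0|%:E <= \sum_j L2norm01 (h j))%E.
Proof.
move=> acf mh aef t /andP[t0 t1].
have [/existsP[j /eqP hj]|] := boolP [exists j, L2norm01 (h j) == +oo%E].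
  rewrite (bigD1 j) //= hj addye ?leey // gt_eqF // (lt_le_trans (ltNyr 0)) //.
  by apply: sume_ge0 => i _; exact: L2norm01_ge0.
rewrite negb_exists => /forallP hfin.
pose H j t := `|(h j \_ `[0, 1]) t|.
have intH j : mu.-integrable setT (EFin \o H j).
  apply/integrableP; split.
    apply/measurable_EFinP; apply: measurableT_comp => //.
    by apply: (measurable_restrictT _ _).1 => //; exact: mh.
  under eq_integral do rewrite /= /H normr_id.
  by apply: le_lt_trans (L1_le_L2norm01 (mh j)) _; rewrite ltey.
have := @integral_majorant 0 t f (fun s => \sum_j H j s) t0 (abs_cont_sub (lexx 0) t1 acf).
have -> : EFin \o (fun s => \sum_j H j s) = (fun s => \sum_j (EFin \o H j) s)%E.
  by apply/funext => s /=; rewrite sumEFin.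
have intS : mu.-integrable setT (fun s => \sum_j (EFin \o H j) s)%E.
  by apply: integrable_sum.
move=> /(_ intS); have H0 s : 0 <= \sum_j H j s by apply: sumr_ge0 => j _; exact: normr_ge0.
move=> /(_ H0) => K; apply: (@le_trans _ _ (\int[mu]_s (\sum_j H j s))%:E).
  rewrite lee_fin; apply: K; apply: aeS aef => s Hs /andP[s0 st].
  have s01 : 0 < s < 1 by rewrite s0; lra.
  have [l dl ll] := Hs s01; exists l => //; apply: le_trans ll _.
  apply: ler_sum => j _; rewrite /H patchE mem_set //= in_itv /=.
  by apply/andP; split; lra.
rewrite /Rintegral fineK; last first.
  apply: integrable_fin_num => //; move: intS; congr (integrable _ _ _).
  by apply/funext => s /=; rewrite sumEFin.
under eq_integral do rewrite -sumEFin.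
rewrite ge0_integral_sum //.
- by apply: lee_sum => j _; exact: L1_le_L2norm01.
- by move=> j; case/integrableP: (intH j).
- by move=> j s _; rewrite lee_fin normr_ge0.
Qed.

End RealAnalysis.

(** * Entrywise derivatives and absolute continuity of matrix curves *)

Section MatrixDerivative.
Context {R : realType}.
Implicit Types (t : R) (f g : R -> R).

Lemma der_eq f t l l' : is_derive t 1 f l -> l = l' -> is_derive t 1 f l'.
Proof. by move=> ? <-. Qed.

Lemma derM f g t df dg : is_derive t 1 f df -> is_derive t 1 g dg ->
  is_derive t 1 (fun s => f s * g s) (df * g t + f t * dg).
Proof.
move=> Hf Hg; have := is_deriveM Hf Hg.
by rewrite addrC /GRing.scale /= [g t * _]mulrC.
Qed.

Lemma der_sum (I : Type) (r : seq I) (P : pred I) (F : I -> R -> R) (F' : I -> R) t :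
  (forall i, P i -> is_derive t 1 (F i) (F' i)) ->
  is_derive t 1 (fun s => \sum_(i <- r | P i) F i s) (\sum_(i <- r | P i) F' i).
Proof.
move=> H; elim: r => [|i r IH].
  rewrite big_nil (_ : (fun _ => _) = cst 0); last by apply/funext => s; rewrite big_nil.
  exact: is_derive_cst.
rewrite big_cons; case: ifP => Pi; last first.
  by rewrite (_ : (fun _ => _) = (fun s => \sum_(i <- r | P i) F i s)) //;
    apply/funext => s; rewrite big_cons Pi.
rewrite (_ : (fun _ => _) = F i + (fun s => \sum_(i <- r | P i) F i s)).
  exact: (is_deriveD (H i Pi) IH).
by apply/funext => s; rewrite big_cons Pi.
Qed.

Lemma der_cst (c t : R) : is_derive t 1 (fun=> c) 0.
Proof. exact: is_derive_cst. Qed.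

Lemma der_prod k (F : 'I_k -> R -> R) (F' : 'I_k -> R) t :
  (forall i, is_derive t 1 (F i) (F' i)) ->
  is_derive t 1 (fun s => \prod_i F i s)
    (\sum_c \prod_i (if i == c then F' i else F i t)).
Proof.
elim: k F F' => [|k IH] F F' H.
  rewrite big_ord0 (_ : (fun _ => _) = cst 1); last by apply/funext => s; rewrite big_ord0.
  exact: is_derive_cst.
rewrite (_ : (fun _ => _) =
   (fun s => F ord0 s * \prod_i F (lift ord0 i) s)); last first.
  by apply/funext => s; rewrite big_ord_recl.
have D := derM (H ord0) (IH _ _ (fun i => H (lift ord0 i))).
apply: (der_eq D); rewrite big_ord_recl; congr (_ + _).
  by rewrite big_ord_recl eqxx; congr (_ * _); apply: eq_bigr.
rewrite mulr_sumr; apply: eq_bigr => c _; rewrite big_ord_recl.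
by congr (_ * _).
Qed.

Definition is_mx_derive (m p : nat) (X : R -> 'M[R]_(m, p)) t (X' : 'M[R]_(m, p)) :=
  forall i j, is_derive t 1 (fun s => X s i j) (X' i j).

Lemma is_mx_derive_cst m p (A : 'M[R]_(m, p)) t : is_mx_derive (fun=> A) t 0.
Proof. by move=> i j; rewrite mxE; exact: is_derive_cst. Qed.

Lemma is_mx_derive_mul m p q (X : R -> 'M[R]_(m, p)) (Y : R -> 'M[R]_(p, q)) t X' Y' :
  is_mx_derive X t X' -> is_mx_derive Y t Y' ->
  is_mx_derive (fun s => X s *m Y s) t (X' *m Y t + X t *m Y').
Proof.
move=> HX HY i j.
rewrite (_ : (fun s => _) = fun s => \sum_k X s i k * Y s k j); last first.
  by apply/funext => s; rewrite mxE.
have D := der_sum (index_enum 'I_p) (P := xpredT) (fun k _ => derM (HX i k) (HY k j)).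
by apply: (der_eq D); rewrite !mxE -big_split.
Qed.

Lemma is_mx_derive_mull m p q (A : 'M[R]_(m, p)) (Y : R -> 'M[R]_(p, q)) t Y' :
  is_mx_derive Y t Y' -> is_mx_derive (fun s => A *m Y s) t (A *m Y').
Proof.
move=> HY; have := is_mx_derive_mul (@is_mx_derive_cst _ _ A t) HY.
by rewrite mul0mx add0r.
Qed.

Lemma is_mx_derive_mulr m p q (A : 'M[R]_(p, q)) (Y : R -> 'M[R]_(m, p)) t Y' :
  is_mx_derive Y t Y' -> is_mx_derive (fun s => Y s *m A) t (Y' *m A).
Proof.
move=> HY; have := is_mx_derive_mul HY (@is_mx_derive_cst _ _ A t).
by rewrite mulmx0 addr0.
Qed.

Lemma is_mx_derive_uniq m p (X : R -> 'M[R]_(m, p)) t X1 X2 :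
  is_mx_derive X t X1 -> is_mx_derive X t X2 -> X1 = X2.
Proof.
by move=> H1 H2; apply/matrixP => i j; have [_ <-] := H1 i j; have [_ <-] := H2 i j.
Qed.

(** Leibniz's formula is taken for the transpose, so that columns get differentiated one at a time;
    this suits equations M' = M N, where N acts on columns. *)
Lemma der_det k (A : R -> 'M[R]_k) t A' : is_mx_derive A t A' ->
  is_derive t 1 (fun s => \det (A s))
    (\sum_c \det (\matrix_(i, j) (if j == c then A' i j else A t i j))).
Proof.
move=> HA.
have D := der_sum (index_enum {perm 'I_k}) (P := xpredT) (fun s _ =>
  derM (der_cst ((-1) ^+ s) t) (der_prod (fun j => HA (s j) j))).
rewrite (_ : (fun s => \sum_(_ <- _ | _) _) = fun s => \det (A s)) in D; last first.
  apply/funext => s; rewrite -det_tr; apply: eq_bigr => u _; congr (_ * _).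
  by apply: eq_bigr => i _; rewrite mxE.
apply: (der_eq D); under eq_bigr do rewrite mul0r add0r mulr_sumr.
rewrite exchange_big; apply: eq_bigr => c _; rewrite -det_tr.
apply: eq_bigr => u _; congr (_ * _); apply: eq_bigr => i _.
by rewrite !mxE.
Qed.

Definition mx_abs_cont (m p : nat) (a b : R) (X : R -> 'M[R]_(m, p)) :=
  forall i j, abs_cont a b (fun s => X s i j).

Lemma mx_abs_cont_mul m p q a b (X : R -> 'M[R]_(m, p)) (Y : R -> 'M[R]_(p, q)) :
  a <= b -> mx_abs_cont a b X -> mx_abs_cont a b Y -> mx_abs_cont a b (fun s => X s *m Y s).
Proof.
move=> ab HX HY i j.
apply: (abs_cont_eq (f := fun s => \sum_k X s i k * Y s k j)) => [s _|]; first by rewrite mxE.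
by apply: abs_cont_sum => k _; apply: abs_contM.
Qed.

Lemma mx_abs_cont_cst m p a b (A : 'M[R]_(m, p)) : mx_abs_cont a b (fun=> A).
Proof. by move=> i j; exact: abs_cont_cst. Qed.

Lemma abs_cont_det k a b (A : R -> 'M[R]_k) : a <= b -> mx_abs_cont a b A ->
  abs_cont a b (fun s => \det (A s)).
Proof.
move=> ab HA; apply: abs_cont_sum => u _; apply: abs_contM => //; first exact: abs_cont_cst.
exact: abs_cont_prod.
Qed.

End MatrixDerivative.

(** * Lower-upper factorization and its logarithmic derivative *)

Section LU.
Context {R : realType} {n : nat}.
Implicit Types (X L V A B : 'M[R]_n.+1).

(** Going through [inord] lets the size k be a plain number; it is the leading block for k <= n + 1.
    For k = 0 the determinant is 1, the start of the chains of leading minors. *)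
Definition lblock k X : 'M[R]_k := \matrix_(i, j) X (inord i) (inord j).

(* By Cramer's rule, column k of V is the last column of the inverse of the
   leading block of size k + 1, so that X V is lower unitriangular. *)
Definition lu_right X : 'M[R]_n.+1 := \matrix_(j, k)
  if (j <= k)%N then (\adj (lblock k.+1 X)) (inord j) ord_max / \det (lblock k.+1 X)
  else 0.

Definition lu_left X := X *m lu_right X.

Definition lu_regular X := forall k, (k <= n.+1)%N -> \det (lblock k X) != 0.

Lemma lblock_mxsub k X :
  lblock k X = mxsub (fun i : 'I_k => inord i) (fun i : 'I_k => inord i) X.
Proof. by apply/matrixP => i j; rewrite !mxE. Qed.

Lemma lu_left_upper X (i k : 'I_n.+1) : lu_regular X -> (i <= k)%N -> lu_left X i k = (i == k)%:R.
Proof.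
move=> nX ik; have dk : \det (lblock k.+1 X) != 0 by apply: nX.
rewrite mxE.
transitivity (\sum_(j < n.+1 | (j <= k)%N)
   X i j * ((\adj (lblock k.+1 X)) (inord j) ord_max / \det (lblock k.+1 X))).
  rewrite [RHS]big_mkcond; apply: eq_bigr => j _; rewrite [lu_right _ _ _]mxE.
  by case: ifP => // _; rewrite mulr0.
rewrite (big_ord_narrow_leq (ltn_ord k : k <= n)%N).
have := mul_mx_adj (lblock k.+1 X) => /matrixP /(_ (inord i) ord_max).
rewrite !mxE => H.
transitivity ((\det (lblock k.+1 X) *+ (inord i == ord_max :> 'I_k.+1)) / \det (lblock k.+1 X)).
  rewrite -H mulr_suml; apply: eq_bigr => j _; rewrite mulrA; congr (_ * _ * _).
    by rewrite !mxE inordK // inord_val; congr (X _ _); apply/val_inj; rewrite /= inordK // (leq_trans (ltn_ord j)).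
  by congr (\adj _ _ _); apply/val_inj; rewrite /= inordK.
rewrite -[X in X / _]mulr_natl mulfK //; congr (_%:R); congr (nat_of_bool _).
by rewrite -!val_eqE /= inordK.
Qed.

Lemma lu_right_lower X (j k : 'I_n.+1) : (k < j)%N -> lu_right X j k = 0.
Proof. by move=> kj; rewrite mxE leqNgt kj. Qed.

(** The last diagonal cofactor of a leading block is the next smaller leading minor. *)
Lemma lu_right_diag X (k : 'I_n.+1) : lu_right X k k = \det (lblock k X) / \det (lblock k.+1 X).
Proof.
rewrite mxE leqnn; congr (_ / _); rewrite mxE /cofactor.
have -> : inord k = ord_max :> 'I_k.+1 by apply/val_inj; rewrite /= inordK.
rewrite addnn -signr_odd odd_double expr0 mul1r; congr (\det _).
by apply/matrixP => i j; rewrite !mxE !lift_max.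
Qed.

Lemma trig_mul A B : is_trig_mx A -> is_trig_mx B -> is_trig_mx (A *m B).
Proof.
move=> /is_trig_mxP tA /is_trig_mxP tB; apply/is_trig_mxP => i j ij.
rewrite mxE big1 // => k _; have [ik|ki] := ltnP i k; first by rewrite tA ?mul0r.
by rewrite (tB k j) ?mulr0 // (leq_ltn_trans ki).
Qed.

Lemma trig_mul_diag A B (i : 'I_n.+1) : is_trig_mx A -> is_trig_mx B ->
  (A *m B) i i = A i i * B i i.
Proof.
move=> /is_trig_mxP tA /is_trig_mxP tB.
rewrite mxE (bigD1 i) //= big1 ?addr0 // => k; rewrite -val_eqE neq_ltn.
by case/orP => ik; [rewrite (tB k i) ?mulr0|rewrite (tA i k) ?mul0r].
Qed.

Lemma trig_unit_diag A (i : 'I_n.+1) : is_trig_mx A -> A \in unitmx -> A i i != 0.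
Proof.
move=> tA; rewrite unitmxE det_trig // unitfE => /prodf_neq0 H; exact: H.
Qed.

(** Forward substitution, by strong induction on the row. *)
Lemma trig_inv A : is_trig_mx A -> A \in unitmx -> is_trig_mx (invmx A).
Proof.
move=> tA uA; have /is_trig_mxP tA' := tA; apply/is_trig_mxP => i j ij.
move: ij; move: {2}(val i) (erefl (val i)) => p; elim/ltn_ind: p i => p IH i ip ij.
have : (A *m invmx A) i j = 0 by rewrite mulmxV // mxE -val_eqE ltn_eqF.
rewrite mxE (bigD1 i) //= big1 => [|k]; last first.
  rewrite -val_eqE neq_ltn => /orP[ki|ik]; last by rewrite tA' ?mul0r.
  by rewrite (IH k) ?mulr0 -?ip // (ltn_trans ki).
by rewrite addr0 => /eqP; rewrite mulf_eq0 (negbTE (trig_unit_diag _ _ _)) //= => /eqP.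
Qed.

Lemma trig_inv_diag A (i : 'I_n.+1) : is_trig_mx A -> A \in unitmx ->
  invmx A i i = (A i i)^-1.
Proof.
move=> tA uA; have Ai := trig_unit_diag i tA uA; apply: (mulfI Ai).
by rewrite mulfV // -trig_mul_diag ?trig_inv // mulmxV // mxE eqxx.
Qed.

Lemma lu_right_trig X : is_trig_mx (lu_right X)^T.
Proof. by apply/is_trig_mxP => i j ij; rewrite mxE lu_right_lower. Qed.

Lemma lu_right_unit X : lu_regular X -> lu_right X \in unitmx.
Proof.
move=> nX; rewrite -unitmx_tr unitmxE (det_trig (lu_right_trig X)) unitfE.
apply/prodf_neq0 => i _; rewrite mxE lu_right_diag mulf_neq0 ?invr_eq0 ?nX //.
exact: ltnW.
Qed.

Lemma lu_left_trig X : lu_regular X -> is_trig_mx (lu_left X).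
Proof.
move=> nX; apply/is_trig_mxP => i j ij; rewrite lu_left_upper ?(ltnW ij) //.
by rewrite -val_eqE ltn_eqF.
Qed.

Lemma det_lu_left X : lu_regular X -> \det (lu_left X) = 1.
Proof.
move=> nX; rewrite det_trig ?lu_left_trig // big1 // => i _.
by rewrite lu_left_upper // eqxx.
Qed.

Lemma lu_left_unit X : lu_regular X -> lu_left X \in unitmx.
Proof. by move=> nX; rewrite unitmxE det_lu_left // unitr1. Qed.

Lemma lu_left_id X : lu_regular X -> is_trig_mx X^T -> lu_left X = 1%:M.
Proof.
move=> nX tX; have tL : is_trig_mx (lu_left X)^T.
  by rewrite trmx_mul; apply: trig_mul => //; exact: lu_right_trig.
apply/matrixP => i j; rewrite [RHS]mxE; have [ij|ji] := leqP i j.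
  exact: lu_left_upper.
move/is_trig_mxP: tL => /(_ _ _ ji); rewrite mxE => ->.
by rewrite -val_eqE gtn_eqF.
Qed.

Definition skew_jacobi (kap : 'I_n -> R) : 'M[R]_n.+1 := \sum_(j < n) kap j *: frak_a R j.

Definition subdiag_mx (be : 'I_n -> R) : 'M[R]_n.+1 :=
  \sum_(j < n) be j *: delta_mx (lift ord0 j) (widen_ord (leqnSn n) j).

Lemma subdiag_mx_val be (i j : 'I_n.+1) : subdiag_mx be i j =
  \sum_(k < n) be k * ((i == k.+1 :> nat) && (j == k :> nat))%:R.
Proof. by rewrite summxE; apply: eq_bigr => k _; rewrite !mxE -!val_eqE. Qed.

Lemma subdiag_mx_sub be (k : 'I_n) : subdiag_mx be (lift ord0 k) (widen_ord (leqnSn n) k) = be k.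
Proof.
rewrite subdiag_mx_val (bigD1 k) //= !eqxx mulr1 big1 ?addr0 // => l lk.
by rewrite [val k == l]eq_sym val_eqE (negbTE lk) andbF mulr0.
Qed.

Lemma subdiag_mx_off be (i j : 'I_n.+1) : (i != j.+1 :> nat) -> subdiag_mx be i j = 0.
Proof.
move=> ij; rewrite subdiag_mx_val big1 // => k _.
by case: eqP => [ik|]; case: eqP => [jk|]; rewrite ?mulr0 //; rewrite ik jk eqxx in ij.
Qed.

Lemma skew_jacobi_lower kap (i j : 'I_n.+1) : (j < i)%N -> skew_jacobi kap i j = subdiag_mx kap i j.
Proof.
move=> ji; rewrite subdiag_mx_val summxE; apply: eq_bigr => k _; rewrite !mxE -!val_eqE /=.
rewrite /bump /= add1n; case: (_ && _) => //; case: (i =P k :> nat) => ik;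
  rewrite ?subr0 ?andFb //; case: eqP => jk; rewrite ?subr0 //;
  by move: ji; rewrite ik jk ltnNge leqnSn.
Qed.

(* Since L is lower unitriangular and V is upper triangular, L^-1 L' =
   V^-1 Lambda V + V^-1 V' is strictly lower triangular, so that only the
   strictly lower part of V^-1 Lambda V matters. *)
Lemma LU_log_deriv L L' V V' X kap : L \in unitmx -> is_trig_mx L ->
  (forall i j : 'I_n.+1, (i <= j)%N -> L' i j = 0) ->
  is_trig_mx V^T -> is_trig_mx V'^T -> (forall i, 0 < V i i) ->
  (forall j, 0 < kap j) ->
  L = X *m V -> L' = X *m skew_jacobi kap *m V + X *m V' ->
  exists2 be : 'I_n -> R, (forall j, 0 < be j) & L' = L *m subdiag_mx be.
Proof.
move=> uL tL sL tV tV' V0 kap0 LE L'E.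
have uV : V \in unitmx.
  by move: uL; rewrite LE unitmx_mul => /andP[].
have tVi : is_trig_mx (invmx V)^T.
  by rewrite trmx_inv trig_inv // unitmx_tr.
pose N := invmx L *m L'.
have NE : N = invmx V *m skew_jacobi kap *m V + invmx V *m V'.
  rewrite /N L'E mulmxDr -!mulmxA; congr (_ + _); rewrite !mulmxA; congr (_ *m _).
    congr (_ *m _); rewrite -[X](mulmxK uV) -LE mulmxA mulVmx // ?mul1mx //.
  by rewrite -[X](mulmxK uV) -LE mulmxA mulVmx // ?mul1mx.
have N0 (i j : 'I_n.+1) : (i <= j)%N -> N i j = 0.
  move=> ij; rewrite mxE big1 // => k _; have [kj|jk] := leqP k j.
    by rewrite sL ?mulr0.
  have /is_trig_mxP -> := trig_inv tL uL; first by rewrite mul0r.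
  exact: leq_ltn_trans jk.
have Vlow (i j : 'I_n.+1) : (j < i)%N -> V i j = 0.
  by move=> ji; move/is_trig_mxP: tV => /(_ _ _ ji); rewrite mxE.
have Vilow (i j : 'I_n.+1) : (j < i)%N -> invmx V i j = 0.
  by move=> ji; move/is_trig_mxP: tVi => /(_ _ _ ji); rewrite mxE.
(* The entry (i, j) of V^-1 Lambda V sums over entries (l, k) of Lambda with l >= i and k <= j. All
   of them except (i, j) itself lie at least two places below the diagonal, where the tridiagonal
   Lambda vanishes. *)
have N1 (i j : 'I_n.+1) : (j < i)%N ->
    N i j = invmx V i i * subdiag_mx kap i j * V j j.
  move=> ji; rewrite NE mxE.
  have -> : (invmx V *m V') i j = 0.
    have /is_trig_mxP /(_ _ _ ji) : is_trig_mx (invmx V *m V')^T.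
      by rewrite trmx_mul trig_mul.
    by rewrite mxE.
  rewrite addr0 mxE (bigD1 j) //= big1 ?addr0 => [|k]; last first.
    rewrite -val_eqE neq_ltn => /orP[kj|jk]; last by rewrite Vlow ?mulr0.
    rewrite mxE big1 ?mul0r // => l _.
    have [li|il] := ltnP l i; first by rewrite Vilow ?mul0r.
    rewrite skew_jacobi_lower ?(ltn_trans kj) ?(leq_trans ji) // subdiag_mx_off ?mulr0 //.
    by rewrite gtn_eqF // (leq_ltn_trans kj) // (leq_trans ji).
  congr (_ * _); rewrite mxE (bigD1 i) //= big1 ?addr0 ?skew_jacobi_lower // => l.
  rewrite -val_eqE neq_ltn => /orP[li|il]; first by rewrite Vilow ?mul0r.
  rewrite skew_jacobi_lower ?(ltn_trans ji) // subdiag_mx_off ?mulr0 //.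
  by rewrite gtn_eqF // (leq_ltn_trans ji).
exists (fun k => invmx V (lift ord0 k) (lift ord0 k) * kap k *
   V (widen_ord (leqnSn n) k) (widen_ord (leqnSn n) k)).
  move=> j; rewrite !mulr_gt0 //.
  have := trig_inv_diag (lift ord0 j) tV; rewrite unitmx_tr => /(_ uV).
  by rewrite -trmx_inv !mxE => ->; rewrite invr_gt0.
have -> : L' = L *m N by rewrite /N mulKVmx.
congr (_ *m _); apply/matrixP => i j.
have [ij|ji] := leqP i j.
  by rewrite N0 // subdiag_mx_off // ltn_eqF.
rewrite N1 //; have [ij|ij] := eqVneq (val i) j.+1; last by rewrite !subdiag_mx_off // mulr0 mul0r.
have jn : (j < n)%N by have := ltn_ord i; rewrite [nat_of_ord i]ij ltnS.
have [k ik jk] : exists2 k : 'I_n, i = lift ord0 k & j = widen_ord (leqnSn n) k.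
  by exists (Ordinal jn); apply/val_inj => //=; rewrite /bump [LHS]ij.
by rewrite ik jk !subdiag_mx_sub.
Qed.

Lemma derivable_det k (A : R -> 'M[R]_k) t :
  (forall i j, derivable (fun s => A s i j) t 1) ->
  derivable (fun s => \det (A s)) t 1.
Proof.
move=> H; have mA : is_mx_derive A t (\matrix_(i, j) 'D_1 (fun s => A s i j) t).
  by move=> i j; rewrite mxE; split.
by have [] := der_det mA.
Qed.

Lemma lblock_abs_cont k a b (X : R -> 'M[R]_n.+1) : a <= b -> mx_abs_cont a b X ->
  abs_cont a b (fun s => \det (lblock k (X s))).
Proof.
move=> ab H; apply: abs_cont_det => // i j.
by apply: (abs_cont_eq (f := fun s => X s (inord i) (inord j))) => // s _; rewrite mxE.
Qed.

Lemma lu_right_mx_abs_cont a b (X : R -> 'M[R]_n.+1) : a <= b -> mx_abs_cont a b X ->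
  (forall s, a <= s <= b -> lu_regular (X s)) -> mx_abs_cont a b (fun s => lu_right (X s)).
Proof.
move=> ab H nX j k; have [jk|kj] := leqP j k; last first.
  by apply: abs_cont_eq (abs_cont_cst _ _ 0) => s _; rewrite lu_right_lower.
apply: (abs_cont_eq (f := fun s => (-1) ^+ (@ord_max k + (inord j : 'I_k.+1))%N *
   \det (row' ord_max (col' (inord j) (lblock k.+1 (X s)))) * (\det (lblock k.+1 (X s)))^-1)).
  by move=> s _; rewrite !mxE jk.
apply: abs_contM => //; first apply: abs_contM => //; first exact: abs_cont_cst.
  apply: abs_cont_det => // i l.
  by apply: (abs_cont_eq (f := fun s => X s (inord (lift ord_max i)) (inord (lift (inord j) l)))) => // s _; rewrite !mxE.
by apply: abs_contV => //; [exact: lblock_abs_cont|move=> s sab; apply: nX].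
Qed.

Lemma lu_right_derivable (X : R -> 'M[R]_n.+1) t : 
  (forall i j, derivable (fun s => X s i j) t 1) -> lu_regular (X t) ->
  forall j k, derivable (fun s => lu_right (X s) j k) t 1.
Proof.
move=> dX nX j k; have [jk|kj] := leqP j k; last first.
  rewrite (_ : (fun _ => _) = cst 0); first exact: derivable_cst.
  by apply/funext => s; rewrite lu_right_lower.
rewrite (_ : (fun _ => _) = (fun s => \adj (lblock k.+1 (X s)) (inord j) ord_max) *
   (fun s => (\det (lblock k.+1 (X s)))^-1)); last first.
  by apply/funext => s; rewrite mxE jk.
apply: derivableM.
  rewrite (_ : (fun _ => _) = ((-1) ^+ (@ord_max k + (inord j : 'I_k.+1))%N) *: (fun s =>
   \det (row' ord_max (col' (inord j) (lblock k.+1 (X s)))))); last first.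
    by apply/funext => s; rewrite mxE.
  apply: derivableZ; apply: derivable_det => i l.
  rewrite (_ : (fun _ => _) = (fun s => X s (inord (lift ord_max i)) (inord (lift (inord j) l)))) //.
  by apply/funext => s; rewrite !mxE.
apply: derivableV; first exact: nX.
apply: derivable_det => i l.
rewrite (_ : (fun _ => _) = (fun s => X s (inord i) (inord l))) //.
by apply/funext => s; rewrite !mxE.
Qed.

Lemma der_near_eq (f g : R -> R) (t r l : R) : 0 < r ->
  (forall s, `|s - t| < r -> f s = g s) -> is_derive t 1 g l -> is_derive t 1 f l.
Proof.
move=> r0 fg /is_derive_eps dg; apply/is_derive_eps => e /dg[r' r'0 H].
exists (Num.min r r'); first by rewrite lt_min r0.
move=> s; rewrite lt_min => /andP[sr sr'].
by rewrite !fg ?subrr ?normr0 //; exact: H.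
Qed.

Lemma LU_der (X : R -> 'M[R]_n.+1) t r kap : 0 < r ->
  (forall s, `|s - t| < r -> lu_regular (X s)) ->
  (forall k, (k <= n.+1)%N -> 0 < \det (lblock k (X t))) ->
  (forall j, 0 < kap j) -> is_mx_derive X t (X t *m skew_jacobi kap) ->
  exists2 be : 'I_n -> R, (forall j, 0 < be j) &
    is_mx_derive (fun s => lu_left (X s)) t (lu_left (X t) *m subdiag_mx be).
Proof.
move=> r0 nX pX kap0 dX.
have nXt : lu_regular (X t) by apply: nX; rewrite subrr normr0.
(* No formula for V' is computed: its existence and its upper triangular shape suffice for
   [LU_log_deriv]. *)
pose V' : 'M[R]_n.+1 := \matrix_(i, j) 'D_1 (fun s => lu_right (X s) i j) t.
have dV : is_mx_derive (fun s => lu_right (X s)) t V'.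
  move=> i j; rewrite mxE; split=> //; apply: lu_right_derivable => // k l.
  by have [] := dX k l.
have dL := is_mx_derive_mul dX dV.
set L' := (X in is_mx_derive _ t X) in dL.
have [] := @LU_log_deriv (lu_left (X t)) L' (lu_right (X t)) V' (X t) kap.
- exact: lu_left_unit.
- exact: lu_left_trig.
- move=> i j ij.
  (* On and above the diagonal the lower unitriangular factor is constant near t. *)
  have d0 : is_derive t 1 (fun s => lu_left (X s) i j) 0.
    apply: (der_near_eq r0 _ (der_cst (i == j)%:R t)) => s sr.
    by rewrite lu_left_upper //; exact: nX.
  by have [_ <-] := dL i j; have [_ <-] := d0.
- exact: lu_right_trig.
- apply/is_trig_mxP => i j ij; rewrite !mxE.
  rewrite (_ : (fun _ => _) = cst 0) ?derive_cst //.
  by apply/funext => s; rewrite lu_right_lower.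
- move=> i; rewrite lu_right_diag divr_gt0 // pX // ltnW //.
- exact: kap0.
- by [].
- by [].
by move=> be be0 L'E; exists be => //; rewrite -L'E.
Qed.

(** One notion for two equations X' = X N: [F] is [skew_jacobi] for the orthogonal curves and
    [subdiag_mx] for their lower factors. Constant left factors preserve it. *)
Definition convex_curve (F : ('I_n -> R) -> 'M[R]_n.+1) a b (X : R -> 'M[R]_n.+1) :=
  mx_abs_cont a b X /\ {ae (@lebesgue_measure R), forall t, a < t < b ->
    exists2 kap : 'I_n -> R, (forall j, 0 < kap j) & is_mx_derive X t (X t *m F kap)}.

Lemma convex_curve_sub F a b a' b' (X : R -> 'M[R]_n.+1) : a <= a' -> b' <= b ->
  convex_curve F a b X -> convex_curve F a' b' X.
Proof.
move=> aa bb [mX aX]; split; first by move=> i j; exact: abs_cont_sub (mX i j).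
by apply: aeS aX => t H /andP[? ?]; apply: H; apply/andP; split; lra.
Qed.

Lemma convex_curve_mull F a b (X : R -> 'M[R]_n.+1) A : a <= b -> convex_curve F a b X ->
  convex_curve F a b (fun s => A *m X s).
Proof.
move=> ab [mX aX]; split; first by apply: mx_abs_cont_mul => //; exact: mx_abs_cont_cst.
apply: aeS aX => t H /H[kap kap0 d]; exists kap => //.
by rewrite -mulmxA; exact: is_mx_derive_mull.
Qed.

Lemma LU_curve a b (X : R -> 'M[R]_n.+1) : a <= b -> convex_curve skew_jacobi a b X ->
  (forall t, a <= t <= b -> forall k, (k <= n.+1)%N -> 0 < \det (lblock k (X t))) ->
  convex_curve subdiag_mx a b (fun s => lu_left (X s)).
Proof.
move=> ab [mX aX] pX.
have nX t : a <= t <= b -> lu_regular (X t).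
  by move=> tab k kn; rewrite gt_eqF // pX.
split; first by apply: mx_abs_cont_mul => //; exact: lu_right_mx_abs_cont.
apply: aeS aX => t H atb; have [kap kap0 d] := H atb.
have /andP[at_ tb] := atb.
apply: (@LU_der X t (Num.min (t - a) (b - t)) kap) => //.
- by rewrite lt_min !subr_gt0 at_.
- move=> s; rewrite lt_min => /andP[]; rewrite !ltr_norml => /andP[? ?] /andP[? ?].
  by apply: nX; apply/andP; split; lra.
- by apply: pX; rewrite !ltW.
Qed.

End LU.

(** * Minors of solutions of M' = M N with N positive on the subdiagonal *)

Section TotalPositivity.
Context {R : realType} {n : nat}.

Definition incr k (f : 'I_k -> 'I_n.+1) := forall i j : 'I_k, (i < j)%N -> (f i < f j)%N.

Lemma incr_inj k (f : 'I_k -> 'I_n.+1) : incr f -> injective f.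
Proof.
move=> If i j fij; case: (ltngtP i j) => [ij|ji|/val_inj //].
  by have := If i j ij; rewrite fij ltnn.
by have := If j i ji; rewrite fij ltnn.
Qed.

(** A strictly increasing self-map satisfies i <= h i; the same inequality for its conjugate by
    order reversal is the converse bound. *)
Lemma incr_ord_id k (h : 'I_k -> 'I_k) :
  (forall i j : 'I_k, (i < j)%N -> (h i < h j)%N) -> h =1 id.
Proof.
move=> Ih.
have ge (g : 'I_k -> 'I_k) : (forall i j : 'I_k, (i < j)%N -> (g i < g j)%N) ->
    forall i : 'I_k, (i <= g i)%N.
  move=> Ig [i ik]; elim: i ik => [//|i IH] ik.
  by apply: leq_ltn_trans (IH (ltnW ik)) _; apply: Ig.
move=> i; apply/val_inj/eqP; rewrite eqn_leq (ge h Ih) andbT.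
have := ge (fun i => rev_ord (h (rev_ord i))).
have rlt (x y : 'I_k) : (x < y)%N -> (rev_ord y < rev_ord x)%N.
  by move=> xy /=; have := ltn_ord y; lia.
move=> /(_ _ (rev_ord i)); rewrite rev_ordK /=.
move=> H; have := H (fun x y xy => rlt _ _ (Ih _ _ (rlt _ _ xy))).
by have := ltn_ord i; have := ltn_ord (h i); lia.
Qed.

Lemma det_row0 k (A : 'M[R]_k) i : (forall j, A i j = 0) -> \det A = 0.
Proof. by move=> H; rewrite (expand_det_row _ i) big1 // => j _; rewrite H mul0r. Qed.

Lemma minor1 k (f : 'I_k -> 'I_n.+1) : incr f -> mxsub f f (1%:M : 'M[R]_n.+1) = 1%:M.
Proof. by move=> /incr_inj If; apply/matrixP => i j; rewrite !mxE (inj_eq If). Qed.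

(** If every row index is a column index, the two increasing families coincide and the minor is 1;
    otherwise some row is zero. *)
Lemma minor1_ge0 k (f g : 'I_k -> 'I_n.+1) : incr f -> incr g ->
  0 <= \det (mxsub f g (1%:M : 'M[R]_n.+1)).
Proof.
move=> If Ig.
have [/forallP H|] := boolP [forall i, [exists j, f i == g j]].
  have [p Hp] : exists p : 'I_k -> 'I_k, forall i, f i = g (p i).
    exists (fun i => xchoose (existsP (H i))) => i.
    by apply/eqP; exact: (xchooseP (existsP (H i))).
  have pid : p =1 id.
    apply: incr_ord_id => i j ij; rewrite ltnNge; apply/negP => pji.
    have := If _ _ ij; rewrite !Hp ltnNge; move: pji; rewrite leq_eqVlt.
    by case/orP => [/eqP/val_inj ->|/(Ig _ _)/ltnW ->]; rewrite ?leqnn.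
  have -> : mxsub f g (1%:M : 'M[R]_n.+1) = mxsub g g 1%:M.
    by apply/matrixP => i j; rewrite !mxE Hp pid.
  by rewrite minor1 // det1 ler01.
rewrite negb_forall => /existsP[i]; rewrite negb_exists => /forallP H.
rewrite (@det_row0 _ _ i) // => j; rewrite !mxE.
by rewrite (negbTE (H j)).
Qed.

(** The columns that appear when column c of a minor is differentiated. For g c = n the default
    value of [inord] intervenes, but the corresponding weight in [mul_subdiag_mx] is zero. *)
Definition bump_at k (g : 'I_k -> 'I_n.+1) (c : 'I_k) : 'I_k -> 'I_n.+1 :=
  fun j => if j == c then inord (g c).+1 else g j.

Lemma mul_subdiag_mx (be : 'I_n -> R) : (forall j, 0 < be j) ->
  exists2 w : 'I_n.+1 -> R, (forall j : 'I_n.+1, if (j < n)%N then 0 < w j else w j == 0) &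
  forall m (A : 'M[R]_(m, n.+1)) i (j : 'I_n.+1), (A *m subdiag_mx be) i j = w j * A i (inord j.+1).
Proof.
move=> be0; exists (fun j : 'I_n.+1 => if (j < n)%N then subdiag_mx be (inord j.+1) j else 0).
  move=> j; case: ifP => jn; rewrite jn ?eqxx //.
  have [l jl1 jl2] : exists2 l : 'I_n, inord j.+1 = lift ord0 l & j = widen_ord (leqnSn n) l.
    by exists (Ordinal jn); apply/val_inj; rewrite //= inordK.
  by rewrite jl1 jl2 subdiag_mx_sub.
move=> m A i j; rewrite mxE; case: ifP => jn; last first.
  rewrite mul0r big1 // => l _; rewrite subdiag_mx_off ?mulr0 //.
  by apply/eqP => lj; have := ltn_ord l; rewrite [nat_of_ord l]lj ltnS jn.
rewrite (bigD1 (inord j.+1)) //= big1 ?addr0 1?mulrC // => l lj.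
rewrite subdiag_mx_off ?mulr0 //; apply: contraNneq lj => lj.
by apply/eqP/val_inj; rewrite /= inordK.
Qed.

Lemma minor_der k (f g : 'I_k -> 'I_n.+1) (M : R -> 'M[R]_n.+1) t be
    (w : 'I_n.+1 -> R) :
  (forall m (A : 'M[R]_(m, n.+1)) i (j : 'I_n.+1), (A *m subdiag_mx be) i j = w j * A i (inord j.+1)) ->
  is_mx_derive M t (M t *m subdiag_mx be) ->
  is_derive t 1 (fun s => \det (mxsub f g (M s)))
    (\sum_c w (g c) * \det (mxsub f (bump_at g c) (M t))).
Proof.
move=> wE dM.
have dA : is_mx_derive (fun s => mxsub f g (M s)) t (mxsub f g (M t *m subdiag_mx be)).
  move=> i j; rewrite mxE (_ : (fun _ => _) = fun s => M s (f i) (g j)) //.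
  by apply/funext => s; rewrite mxE.
apply: (der_eq (der_det dA)); apply: eq_bigr => c _.
rewrite !(expand_det_col _ c) mulr_sumr; apply: eq_bigr => i _.
rewrite [X in X * _]mxE eqxx [X in X * _]mxE wE.
rewrite [RHS]mulrA; congr (_ * _); first by rewrite [in RHS]mxE /bump_at eqxx.
rewrite /cofactor; congr (_ * \det _); apply/matrixP => i' j'; rewrite !mxE.
by rewrite /bump_at [lift c j' == c]eq_sym (negbTE (neq_lift _ _)).
Qed.

Lemma abs_cont_minor k (f g : 'I_k -> 'I_n.+1) a b (M : R -> 'M[R]_n.+1) : a <= b ->
  mx_abs_cont a b M -> abs_cont a b (fun s => \det (mxsub f g (M s))).
Proof.
move=> ab mM; apply: abs_cont_det => // i j.
by apply: abs_cont_eq (mM (f i) (g j)) => s _; rewrite mxE.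
Qed.

Lemma bump_at_incr k (g : 'I_k -> 'I_n.+1) c : incr g -> (g c < n)%N ->
  (forall j, g j != (g c).+1 :> nat) -> incr (bump_at g c).
Proof.
move=> Ig gc H i j ij; rewrite /bump_at; case: eqP => [ic|_]; case: eqP => [jc|_].
- by move: ij; rewrite ic jc ltnn.
- by rewrite inordK ?ltnS // ltn_neqAle eq_sym H -ic; exact: Ig.
- by rewrite inordK ?ltnS // ltnW // -jc; exact: Ig.
- exact: Ig.
Qed.

(** Induction on the total distance of the columns g to the last column. Each bumped family in the
    derivative either repeats a column, giving a zero minor, or is increasing and closer to the end,
    giving a nonnegative minor; at a the minor is one of the identity. *)
Lemma minor_nondecreasing k (f g : 'I_k -> 'I_n.+1) a b (M : R -> 'M[R]_n.+1) :
  a <= b -> convex_curve subdiag_mx a b M -> M a = 1%:M -> incr f -> incr g ->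
  (forall x y, a <= x -> x <= y -> y <= b ->
    \det (mxsub f g (M x)) <= \det (mxsub f g (M y))) /\
  (forall x, a <= x <= b -> 0 <= \det (mxsub f g (M x))).
Proof.
move=> ab [mM aM] Ma If.
move: {2}(\sum_c (n - g c))%N (leqnn (\sum_c (n - g c))%N) => p.
elim/ltn_ind: p g => p IH g gp Ig.
suff mono x y : a <= x -> x <= y -> y <= b ->
    \det (mxsub f g (M x)) <= \det (mxsub f g (M y)).
  split=> // x /andP[ax xb]; apply: le_trans (mono _ _ (lexx a) ax xb).
  by rewrite Ma minor1_ge0.
move=> ax xy yb; apply: (abs_cont_nondecreasing (f := fun s => \det (mxsub f g (M s)))) => //.
  by apply: (abs_cont_sub ax yb); exact: abs_cont_minor.
apply: aeS aM => t H /andP[xt ty].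
have atb : a < t < b by apply/andP; split; lra.
have [be be0 dM] := H atb; have [w w0 wE] := mul_subdiag_mx be0.
exists (\sum_c w (g c) * \det (mxsub f (bump_at g c) (M t))); last exact: minor_der.
apply: sumr_ge0 => c _; have := w0 (g c); case: ifP => [gc wc|_ /eqP ->]; last by rewrite mul0r.
apply: mulr_ge0; first exact: ltW.
have [/existsP[j /eqP gj]|] := boolP [exists j, g j == (g c).+1 :> nat].
  have jc : j != c by apply/eqP => jc; move: gj; rewrite jc => /n_Sn.
  rewrite -det_tr (determinant_alternate jc) // => i; rewrite !mxE /bump_at eqxx (negbTE jc).
  by congr (M t _ _); apply/val_inj; rewrite /= inordK // ltnS.
rewrite negb_exists => /forallP Hg.
have lt : (\sum_j (n - bump_at g c j) < \sum_j (n - g j))%N.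
  rewrite [X in (X < _)%N](bigD1 c) //= [X in (_ < X)%N](bigD1 c) //=.
  rewrite (eq_bigr (fun j => n - g j)%N) => [|j jc]; last by rewrite /bump_at (negbTE jc).
  by rewrite ltn_add2r /bump_at eqxx inordK // ltn_sub2l.
have [] := IH _ (leq_trans lt gp) (bump_at g c) (leqnn _) (bump_at_incr Ig gc Hg).
by move=> _; apply; apply/andP; split; lra.
Qed.

(** Induction on the total gap between g and f. With no gap the minor starts at 1 and does not
    decrease; otherwise one bumped family is still below f, and its positive minor makes the
    derivative positive. *)
Lemma minor_gt0 k (f g : 'I_k -> 'I_n.+1) a b (M : R -> 'M[R]_n.+1) :
  a <= b -> convex_curve subdiag_mx a b M -> M a = 1%:M -> incr f -> incr g ->
  (forall c, g c <= f c)%N ->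
  forall x, a < x <= b -> 0 < \det (mxsub f g (M x)).
Proof.
move=> ab cM Ma If.
move: {2}(\sum_c (f c - g c))%N (leqnn (\sum_c (f c - g c))%N) => p.
elim/ltn_ind: p g => p IH g gp Ig gf x /andP[ax xb].
have [mono pos] := minor_nondecreasing ab cM Ma If Ig.
have [/forallP fg|] := boolP [forall c, g c == f c].
  apply: lt_le_trans (mono a x (lexx a) (ltW ax) xb).
  have -> : mxsub f g (M a) = mxsub f f 1%:M.
    by apply/matrixP => i j; rewrite !mxE Ma mxE (eqP (fg j)).
  by rewrite minor1 // det1 ltr01.
rewrite negb_forall => /existsP[c0 c0P].
(* The last gap is the one to bump: later columns agree with f, so g c + 1 <= f c < f j = g j and no
   column is repeated. *)
case: (@arg_maxnP _ c0 (fun c => g c != f c) val c0P) => c cP cmax.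
have gcfc : (g c < f c)%N by rewrite ltn_neqAle cP gf.
have gcn : (g c < n)%N by apply: leq_trans gcfc _; rewrite -ltnS.
have Hg j : g j != (g c).+1 :> nat.
  have [jc|cj|/val_inj ->] := ltngtP j c.
  - by rewrite ltn_eqF // ltnW // ltnS; exact: Ig.
  - rewrite gtn_eqF //; have -> : g j = f j.
      by apply/eqP; apply: contraLR cj => gj; rewrite -leqNgt; exact: cmax.
    exact: leq_ltn_trans (If _ _ cj).
  - by rewrite ltn_eqF.
have Ib := bump_at_incr Ig gcn Hg.
have lt : (\sum_j (f j - bump_at g c j) < \sum_j (f j - g j))%N.
  rewrite [X in (X < _)%N](bigD1 c) //= [X in (_ < X)%N](bigD1 c) //=.
  rewrite (eq_bigr (fun j => f j - g j)%N) => [|j jc]; last by rewrite /bump_at (negbTE jc).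
  by rewrite ltn_add2r /bump_at eqxx inordK // ltn_sub2l.
have bf j : (bump_at g c j <= f j)%N.
  by rewrite /bump_at; case: eqP => [->|//]; rewrite inordK.
have pb := IH _ (leq_trans lt gp) (bump_at g c) (leqnn _) Ib bf.
have a0 : 0 <= \det (mxsub f g (M a)) by apply: pos; rewrite lexx.
apply: le_lt_trans a0 _; apply: (abs_cont_increasing (f := fun s => \det (mxsub f g (M s)))) => //.
  by apply: (abs_cont_sub (lexx a) xb); apply: abs_cont_minor => //; case: cM.
have [mM aM] := cM; apply: aeS aM => t H /andP[xt ty].
have atb : a < t < b by apply/andP; split; lra.
have [be be0 dM] := H atb; have [w w0 wE] := mul_subdiag_mx be0.
exists (\sum_j w (g j) * \det (mxsub f (bump_at g j) (M t))); last exact: minor_der.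
rewrite (bigD1 c) //= ltr_pwDl //.
  rewrite mulr_gt0 //; first by have := w0 (g c); rewrite gcn.
  by apply: pb; apply/andP; split; lra.
apply: sumr_ge0 => l _; have := w0 (g l); case: ifP => [gl wl|_ /eqP ->]; last by rewrite mul0r.
apply: mulr_ge0; first exact: ltW.
have [/existsP[j /eqP gj]|] := boolP [exists j, g j == (g l).+1 :> nat].
  have jl : j != l by apply/eqP => jl; move: gj; rewrite jl => /n_Sn.
  rewrite -det_tr (determinant_alternate jl) // => i; rewrite !mxE /bump_at eqxx (negbTE jl).
  by congr (M t _ _); apply/val_inj; rewrite /= inordK // ltnS.
rewrite negb_exists => /forallP Hl.
have [_ ->] // := minor_nondecreasing ab cM Ma If (bump_at_incr Ig gl Hl).
by apply/andP; split; lra.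
Qed.

End TotalPositivity.

(** * Entrywise bounds for products, determinants and adjugates *)

Section Bounds.
Context {R : realType}.

Definition entries_le m p (C : R) (A : 'M[R]_(m, p)) := forall i j, `|A i j| <= C.

Lemma entries_le_mul m p q (A : 'M[R]_(m, p)) (B : 'M[R]_(p, q)) C D :
  entries_le C A -> entries_le D B -> entries_le (p%:R * (C * D)) (A *m B).
Proof.
move=> HA HB i j; rewrite mxE; apply: le_trans (ler_norm_sum _ _ _) _.
have -> : p%:R * (C * D) = \sum_(k < p) (C * D) :> R.
  by rewrite sumr_const card_ord mulr_natl.
by apply: ler_sum => k _; rewrite normrM ler_pM // ?HA ?HB.
Qed.

Lemma entries_le_det k (A : 'M[R]_k) C : entries_le C A -> `|\det A| <= k`!%:R * C ^+ k.
Proof.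
move=> HA; apply: le_trans (ler_norm_sum _ _ _) _.
have -> : k`!%:R * C ^+ k = \sum_(s : 'S_k) C ^+ k :> R.
  rewrite sumr_const mulr_natl; congr (_ *+ _).
  by have := card_Sn k; rewrite cardE -cardE => <-; apply: eq_card.
apply: ler_sum => s _; rewrite normrM normrX normrN1 expr1n mul1r normr_prod.
have -> : C ^+ k = \prod_(i < k) C by rewrite prodr_const card_ord.
by apply: ler_prod => i _; rewrite normr_ge0 HA.
Qed.

Lemma entries_le_adj k (A : 'M[R]_k.+1) C : entries_le C A -> entries_le (k`!%:R * C ^+ k) (\adj A).
Proof.
move=> HA i j; rewrite mxE /cofactor normrM normrX normrN1 expr1n mul1r.
by apply: entries_le_det => i' j'; rewrite !mxE.
Qed.

Lemma prod_lip k (u v : 'I_k -> R) C : 1 <= C ->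
  (forall i, `|u i| <= C) -> (forall i, `|v i| <= C) ->
  `|\prod_i u i - \prod_i v i| <= C ^+ k * \sum_i `|u i - v i|.
Proof.
move=> C1; elim: k u v => [|k IH] u v uC vC.
  by rewrite !big_ord0 subrr normr0 mulr0.
rewrite !big_ord_recl.
set U := \prod_(i < k) u _; set V := \prod_(i < k) v _.
have -> : u ord0 * U - v ord0 * V = (u ord0 - v ord0) * U + v ord0 * (U - V) by ring.
apply: le_trans (ler_normD _ _) _; rewrite !normrM mulrDr.
have C0 : 0 <= C by apply: le_trans C1.
apply: lerD.
  rewrite mulrC ler_wpM2r // normr_prod.
  apply: (@le_trans _ _ (C ^+ k)); last by rewrite exprS ler_peMl ?exprn_ge0.
  have -> : C ^+ k = \prod_(i < k) C by rewrite prodr_const card_ord.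
  by apply: ler_prod => i _; rewrite normr_ge0 uC.
by rewrite exprS -mulrA ler_pM // IH.
Qed.

Lemma det_lip k (A B : 'M[R]_k) C d : 1 <= C -> entries_le C A -> entries_le C B -> entries_le d (A - B) ->
  `|\det A - \det B| <= k`!%:R * (C ^+ k * (k%:R * d)).
Proof.
move=> C1 HA HB AB; rewrite -sumrB.
apply: le_trans (ler_norm_sum _ _ _) _.
have -> : k`!%:R * (C ^+ k * (k%:R * d)) = \sum_(s : 'S_k) (C ^+ k * (k%:R * d)) :> R.
  rewrite sumr_const mulr_natl; congr (_ *+ _).
  by have := card_Sn k; rewrite cardE -cardE => <-; apply: eq_card.
apply: ler_sum => s _; rewrite -mulrBr normrM normrX normrN1 expr1n mul1r.
apply: le_trans (prod_lip C1 _ _) _ => //.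
apply: ler_wpM2l; first by rewrite exprn_ge0 // (le_trans ler01).
have -> : k%:R * d = \sum_(i < k) d by rewrite sumr_const card_ord mulr_natl.
by apply: ler_sum => i _; have := AB i (s i); rewrite !mxE.
Qed.

Definition orthogonal_mx k (A : 'M[R]_k) := A *m A^T = 1%:M.

Lemma orthogonal_mxT k (A : 'M[R]_k) : orthogonal_mx A -> A^T *m A = 1%:M.
Proof. exact: mulmx1C. Qed.

Lemma orthogonal_entries_le k (A : 'M[R]_k) : orthogonal_mx A -> entries_le 1 A.
Proof.
move=> oA i j; have /matrixP /(_ i i) := oA; rewrite !mxE eqxx mulr1n => H.
rewrite -(@ler_pXn2r _ 2) ?nnegrE // expr1n -H -normrX ger0_norm ?sqr_ge0 //.
rewrite (bigD1 j) //= mxE expr2 lerDl sumr_ge0 // => l _.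
by rewrite mxE -expr2 sqr_ge0.
Qed.

End Bounds.

(** * Lower bounds for the leading minors between two regular times *)

Section Sandwich.
Context {R : realType} {n : nat}.
Implicit Types (X : 'M[R]_n.+1).

Lemma lblock_entries_le k X C : entries_le C X -> entries_le C (lblock k X).
Proof. by move=> H i j; rewrite mxE. Qed.

Lemma lu_right_entries_le X (c : R) : 0 < c -> entries_le 1 X ->
  (forall k, (k <= n.+1)%N -> c <= `|\det (lblock k X)|) ->
  entries_le ((n.+1)`!%:R / c) (lu_right X).
Proof.
move=> c0 bX cX j k; rewrite mxE; case: ifP => jk; last first.
  by rewrite normr0 divr_ge0 // ltW.
rewrite normrM normfV; apply: ler_pM; rewrite ?invr_ge0 //.
  have H := @entries_le_adj R k (lblock k.+1 X) 1 (lblock_entries_le bX).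
  apply: (le_trans (H _ _)).
  rewrite expr1n mulr1 ler_nat; apply: leq_fact; exact: ltnW.
rewrite lef_pV2 ?posrE ?cX // normr_gt0.
by apply: contraTneq (cX k.+1 (ltn_ord k)) => ->; rewrite normr0 -ltNge.
Qed.

(** The bound [c'] depends on n and c alone, so it serves all nearby curves at once. *)
Lemma sandwich_pos (c : R) : 0 < c -> exists2 c', 0 < c' &
  forall a b (X : R -> 'M[R]_n.+1), a <= b -> convex_curve skew_jacobi a b X ->
    (forall t, a <= t <= b -> orthogonal_mx (X t)) ->
    (forall t, a <= t <= b -> lu_regular (X t)) ->
    (forall k, (k <= n.+1)%N -> c <= \det (lblock k (X a))) ->
    (forall k, (k <= n.+1)%N -> c <= `|\det (lblock k (X b))|) ->
    forall t, a <= t <= b -> forall k, (k <= n.+1)%N -> c' <= `|\det (lblock k (X t))|.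
Proof.
move=> c0.
pose N : R := n.+1%:R.
(* [C2] bounds L(a) and L(b), [C3] the inverse of L(a) (an adjugate, the determinant being 1), [C5]
   bounds L(t) = L(a) M(t), and [C6] bounds V(t) = X(t)^T L(t). The maximum with 1 makes the powers
   of [C6] monotone. *)
pose C2 := N * (1 * ((n.+1)`!%:R / c)).
pose C3 := n`!%:R * C2 ^+ n.
pose C5 := N * (C2 * (N * (C3 * C2))).
pose C6 := Num.max 1 (N * (1 * C5)).
have C60 : 0 < C6 by rewrite lt_max ltr01.
exists ((C6 ^+ n.+1)^-1); first by rewrite invr_gt0 exprn_gt0.
move=> a b X ab cX oX nX ca cb t tab.
have pX s : a <= s <= b -> forall k, (k <= n.+1)%N -> 0 < \det (lblock k (X s)).
  move=> sab k kn; apply: (abs_cont_keeps_pos (lblock_abs_cont k ab cX.1) ab) => //.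
    exact: lt_le_trans (ca k kn).
  by move=> s' s'ab; apply: nX.
have cL := LU_curve ab cX pX.
pose iL := invmx (lu_left (X a)); pose M s := iL *m lu_left (X s).
have aab : a <= a <= b by rewrite lexx.
have bab : a <= b <= b by rewrite lexx ab.
have cM : convex_curve subdiag_mx a b M by exact: convex_curve_mull.
have uLa : lu_left (X a) \in unitmx by exact/lu_left_unit/nX.
have Ma : M a = 1%:M by rewrite /M mulVmx.
have bL s : a <= s <= b -> (forall k, (k <= n.+1)%N -> c <= `|\det (lblock k (X s))|) ->
    entries_le C2 (lu_left (X s)).
  move=> sab cs; apply: entries_le_mul; first exact/orthogonal_entries_le/oX.
  by apply: lu_right_entries_le => //; exact/orthogonal_entries_le/oX.
have bLa : entries_le C2 (lu_left (X a)).
  by apply: bL => // k kn; apply: le_trans (ca k kn) (ler_norm _).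
have bLb : entries_le C2 (lu_left (X b)) by exact: bL.
have biL : entries_le C3 iL.
  rewrite /iL /invmx uLa det_lu_left ?invr1 ?scale1r; last exact: nX.
  exact: entries_le_adj.
have bMb : entries_le (N * (C3 * C2)) (M b) by exact: entries_le_mul.
(* Entries are minors of size 1, so those of M(t) lie between 0 and those of M(b). *)
have bMt : entries_le (N * (C3 * C2)) (M t).
  move=> i j; have [f1 g1] : incr (fun _ : 'I_1 => i) /\ incr (fun _ : 'I_1 => j).
    by split=> x y; rewrite !ord1.
  have [mono pos] := minor_nondecreasing ab cM Ma f1 g1.
  have mE s : \det (mxsub (fun _ : 'I_1 => i) (fun _ : 'I_1 => j) (M s)) = M s i j.
    by rewrite det_mx11 mxE.
  have /andP[at_ tb] := tab.
  have := pos t tab; have := mono t b at_ tb (lexx b); rewrite !mE => h1 h2.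
  by rewrite ger0_norm //; apply: le_trans h1 (le_trans (ler_norm _) (bMb i j)).
have bLt : entries_le C5 (lu_left (X t)).
  have -> : lu_left (X t) = lu_left (X a) *m M t by rewrite /M mulKVmx.
  exact: entries_le_mul.
have bVt : entries_le C6 (lu_right (X t)).
  have -> : lu_right (X t) = (X t)^T *m lu_left (X t).
    by rewrite /lu_left mulmxA orthogonal_mxT ?mul1mx //; exact: oX.
  move=> i j; rewrite le_max; apply/orP; right; apply: entries_le_mul => // i' j'.
  by rewrite mxE; apply/orthogonal_entries_le/oX.
have step k : (k <= n)%N -> \det (lblock k (X t)) <= C6 * \det (lblock k.+1 (X t)).
  move=> kn; have := bVt (inord k) (inord k); rewrite lu_right_diag inordK // => H.
  have p := pX t tab k.+1 kn.
  by rewrite -ler_pdivrMr //; apply: le_trans (ler_norm _) H.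
move=> k kn; rewrite gtr0_norm ?pX //.
have H : (C6 ^+ k)^-1 <= \det (lblock k (X t)).
  elim: k kn => [_|i IH iN]; first by rewrite det_mx00 expr0 invr1.
  by rewrite exprS invfM ler_pdivrMl //; apply: le_trans (IH (ltnW iN)) (step i iN).
apply: le_trans H.
rewrite lef_pV2 ?posrE ?exprn_gt0 //; apply: ler_weXn2l => //.
by rewrite le_max lexx.
Qed.

(* Multiplying the rows of X by suitable signs makes all the leading principal
   minors positive at the left end point. *)
Lemma sandwich (c : R) : 0 < c -> exists2 c', 0 < c' &
  forall a b (X : R -> 'M[R]_n.+1), a <= b -> convex_curve skew_jacobi a b X ->
    (forall t, a <= t <= b -> orthogonal_mx (X t)) ->
    (forall t, a <= t <= b -> lu_regular (X t)) ->
    (forall k, (k <= n.+1)%N -> c <= `|\det (lblock k (X a))|) ->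
    (forall k, (k <= n.+1)%N -> c <= `|\det (lblock k (X b))|) ->
    forall t, a <= t <= b -> forall k, (k <= n.+1)%N -> c' <= `|\det (lblock k (X t))|.
Proof.
move=> c0; have [c' c'0 H] := sandwich_pos c0; exists c' => // a b X ab cX oX nX ca cb.
pose sg k := Num.sg (\det (lblock k (X a))).
pose d : 'rV[R]_n.+1 := \row_i (sg i.+1 * sg i).
have aab : a <= a <= b by rewrite lexx.
have sg2 k : (k <= n.+1)%N -> sg k * sg k = 1.
  by move=> kn; rewrite -expr2 sqr_sg nX.
have prD k Y : (k <= n.+1)%N -> \det (lblock k (diag_mx d *m Y)) = sg k * \det (lblock k Y).
  move=> kn; have -> : lblock k (diag_mx d *m Y) =
      diag_mx (\row_(i < k) (sg i.+1 * sg i)) *m lblock k Y.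
    apply/matrixP => i j; rewrite !mul_diag_mx !mxE inordK //.
    exact: leq_trans (ltn_ord i) kn.
  rewrite det_mulmx det_diag; congr (_ * _).
  under eq_bigr do rewrite mxE.
  elim: k kn => [_|k IH kn]; first by rewrite big_ord0 /sg det_mx00 sgr1.
  by rewrite big_ord_recr /= IH ?(ltnW kn) // mulrCA sg2 ?(ltnW kn) // mulr1.
have nD k Y : (k <= n.+1)%N -> `|\det (lblock k (diag_mx d *m Y))| = `|\det (lblock k Y)|.
  by move=> kn; rewrite prD // normrM normr_sg nX // mul1r.
have oD : orthogonal_mx (diag_mx d).
  rewrite /orthogonal_mx tr_diag_mx mulmx_diag; apply/matrixP => i j; rewrite !mxE.
  by rewrite mulrACA !sg2 ?mulr1 // ltnW.
have := H a b (fun s => diag_mx d *m X s) ab (convex_curve_mull _ ab cX).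
move=> K t tab k kn; rewrite -nD //; apply: K => //.
- move=> s sab; rewrite /orthogonal_mx trmx_mul mulmxA -[_ *m X s *m _]mulmxA.
  by rewrite (oX s sab) mulmx1.
- move=> s sab l ln; rewrite prD // mulf_neq0 //; last exact: nX.
  by rewrite sgr_eq0 nX.
- by move=> l ln; rewrite prD // -normrEsg ca.
- by move=> l ln; rewrite nD // cb.
Qed.

End Sandwich.

(** * Echelon form of a matrix with independent rows *)

Section Echelon.
Context {R : realType} {n : nat}.

Lemma colsub_mul k m p q (A : 'M[R]_(m, p)) (B : 'M[R]_(p, q)) (f : 'I_k -> 'I_q) :
  colsub f (A *m B) = A *m colsub f B.
Proof. by apply/matrixP => i j; rewrite !mxE; apply: eq_bigr => l _; rewrite mxE. Qed.

(* Weights decreasing with the position make the minimal family increasing. *)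
Definition weight k (f : 'I_k -> 'I_n.+1) : nat := (\sum_(s < k) f s * (k.+1 - s))%N.

(** The pivots f are a family of independent columns of least weight, and G consists of these
    columns. Minimality orders the pivots and clears the entries of G^-1 A to their left. *)
Lemma echelon k (A : 'M[R]_(k, n.+1)) : row_free A ->
  exists f : 'I_k -> 'I_n.+1, exists U : 'M[R]_n.+1, exists G : 'M[R]_k,
  [/\ incr f, G \in unitmx, is_trig_mx U^T, forall i, U i i = 1 & A = G *m rowsub f U].
Proof.
move=> fA.
have [f0 f0P] : exists f : {ffun 'I_k -> 'I_n.+1}, colsub f A \in unitmx.
  have fullA : row_full A^T by rewrite /row_full mxrank_tr.
  exists (fullrankfun fullA); rewrite -unitmx_tr -row_full_unit.
  by have := fullrowsub_full fullA; congr row_full; apply/matrixP => i j; rewrite !mxE.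
pose P (f : {ffun 'I_k -> 'I_n.+1}) := colsub f A \in unitmx.
have [f fP fmin] := @arg_minnP _ f0 P (fun f => weight f) f0P.
pose G := colsub f A; have uG : G \in unitmx by exact: fP.
pose B := invmx G *m A.
have BE : A = G *m B by rewrite mulKVmx.
have Bf r s : B r (f s) = (r == s)%:R.
  have : colsub f B = 1%:M by rewrite colsub_mul mulVmx.
  by move=> /matrixP /(_ r s); rewrite !mxE.
have fI : injective f.
  move=> i j fij; apply/eqP; apply: contraT => ij.
  have := Bf i i; rewrite fij Bf eqxx (negbTE ij) => /eqP.
  by rewrite eq_sym oner_eq0.
have fi : incr f.
  move=> i j ij; rewrite ltn_neqAle; apply/andP; split.
    by apply: contraTneq ij => /val_inj/fI ->; rewrite ltnn.
  rewrite leqNgt; apply/negP => fji.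
  (* Exchanging two pivots in the wrong order preserves independence and lowers the weight. *)
  pose g := [ffun s => f (tperm i j s)].
  have gP : P g.
    have -> : P g = (col_perm (tperm i j) G \in unitmx).
      by congr (_ \in unitmx); apply/matrixP => a b; rewrite !mxE ffunE.
    by rewrite col_permE unitmx_mul uG unitmx_perm.
  have := fmin g gP; rewrite leqNgt /weight.
  have ij' : j != i by rewrite -val_eqE gtn_eqF.
  rewrite (bigD1 i) //= (bigD1 j) //= [X in (_ < X)%N](bigD1 i) //= [X in (_ < _ + X)%N](bigD1 j) //=.
  rewrite !ffunE tpermL tpermR.
  rewrite (eq_bigr (fun s : 'I_k => f s * (k.+1 - s))%N); last first.
    by move=> s /andP[si sj]; rewrite ffunE tpermD // eq_sym.
  have := ltn_ord i; have := ltn_ord j => jk ik.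
  rewrite !addnA ltn_add2r; move: (nat_of_ord (f i)) (nat_of_ord (f j)) fji => x y yx.
  have -> : (k.+1 - i = (k.+1 - j) + (j - i))%N by lia.
  have : (0 < j - i)%N by lia.
  by move: (k.+1 - j)%N (j - i)%N => u v v0; nia.
have B0 r (c : 'I_n.+1) : (c < f r)%N -> B r c = 0.
  move=> cf; apply/eqP; apply: contraT => Brc.
  (* A nonzero entry left of pivot r would let column c replace that pivot, at a smaller weight. *)
  pose g := [ffun s => if s == r then c else f s].
  have gP : P g.
    rewrite /P {1}BE colsub_mul unitmx_mul uG /= -row_free_unit.
    apply/inj_row_free => v /matrixP v0.
    have vs s : s != r -> v 0 s = 0.
      move=> sr; have := v0 0 s; rewrite !mxE (bigD1 s) //= big1 ?addr0 => [|l ls].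
        by rewrite mxE ffunE (negbTE sr) Bf eqxx mulr1.
      by rewrite mxE ffunE (negbTE sr) Bf (negbTE ls) mulr0.
    have vr : v 0 r = 0.
      have := v0 0 r; rewrite !mxE (bigD1 r) //= big1 ?addr0 => [|l ls].
        by rewrite mxE ffunE eqxx => /eqP; rewrite mulf_eq0 (negbTE Brc) orbF => /eqP.
      by rewrite vs // mul0r.
    apply/rowP => s; rewrite [RHS]mxE.
    by have [->|/vs] := eqVneq s r.
  have := fmin g gP; rewrite leqNgt /weight (bigD1 r) //= [X in (_ < X)%N](bigD1 r) //=.
  rewrite ffunE eqxx (eq_bigr (fun s : 'I_k => f s * (k.+1 - s))%N); last first.
    by move=> s sr; rewrite ffunE (negbTE sr).
  have rk := ltn_ord r.
  by rewrite ltn_add2r ltn_pmul2r ?cf // subn_gt0 ltnW.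
(* Row r of the reduced matrix becomes row f r of U, and identity rows fill the rest; U is then
   upper unitriangular. *)
exists f, (\matrix_(i, j) if [pick r | f r == i] is Some r then B r j else (i == j)%:R), G.
split=> //.
- apply/is_trig_mxP => i j ij; rewrite !mxE; case: pickP => [r /eqP fr|_].
    by rewrite B0 // fr.
  by rewrite -val_eqE gtn_eqF.
- by move=> i; rewrite mxE; case: pickP => [r /eqP <-|_]; rewrite ?Bf eqxx.
- rewrite {1}BE; congr (_ *m _); apply/matrixP => r j; rewrite !mxE.
  by case: pickP => [r' /eqP /fI <-|/(_ r)]; rewrite ?eqxx // mxE.
Qed.

End Echelon.

(** * Regularity of short arcs after a given, possibly singular, matrix *)

Section EndPoint.
Context {R : realType} {n : nat}.
Implicit Types (X : 'M[R]_n.+1).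

Lemma entries_le_ex m p (A : 'M[R]_(m, p)) : exists2 C, 1 <= C & entries_le C A.
Proof.
exists (1 + \sum_i \sum_j `|A i j|).
  by rewrite lerDl sumr_ge0 // => i _; rewrite sumr_ge0.
move=> i j; apply: (@le_trans _ _ (\sum_j `|A i j|)).
  by rewrite (bigD1 j) //= lerDl sumr_ge0.
apply: (@le_trans _ _ (\sum_i \sum_j `|A i j|)); last by rewrite lerDr ler01.
by rewrite (bigD1 i) //= lerDl sumr_ge0 // => k _; rewrite sumr_ge0.
Qed.

Lemma uniform_ord K (P : 'I_K -> R -> Prop) :
  (forall i x y, 0 < x -> x <= y -> P i y -> P i x) ->
  (forall i, exists2 x, 0 < x & P i x) ->
  exists2 x, 0 < x & forall i, P i x.
Proof.
elim: K P => [|K IH] P mono H; first by exists 1 => // -[].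
have [x x0 Px] := H ord0.
have [|i|y y0 Py] := IH (fun i => P (lift ord0 i)); [|exact: H|].
  by move=> i; apply: mono.
have m0 : 0 < Num.min x y by rewrite lt_min x0.
exists (Num.min x y) => // i; have [j ->|->] := unliftP ord0 i.
  by apply: mono (Py j) => //; rewrite ge_min lexx orbT.
by apply: mono Px => //; rewrite ge_min lexx.
Qed.

(** The first k columns of A U involve only the first k columns of A, U being upper triangular. *)
Lemma lblock_upper_mul k (A U : 'M[R]_n.+1) p (f : 'I_p -> 'I_n.+1) : (k <= n.+1)%N ->
  is_trig_mx U^T ->
  mxsub f (fun j : 'I_k => inord j) (A *m U) =
  mxsub f (fun j : 'I_k => inord j) A *m lblock k U.
Proof.
move=> kn /is_trig_mxP tU; apply/matrixP => i j; rewrite !mxE.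
have jn : (j < n.+1)%N := leq_trans (ltn_ord j) kn.
transitivity (\sum_(l < n.+1 | (l < k)%N) A (f i) l * U l (inord j)).
  rewrite [RHS]big_mkcond; apply: eq_bigr => l _; case: ltnP => // kl.
  have := tU (inord j) l; rewrite mxE inordK // => -> //; rewrite ?mulr0 //.
  exact: leq_trans (ltn_ord j) kl.
rewrite (big_ord_narrow kn); apply: eq_bigr => l _; rewrite !mxE.
have -> : widen_ord kn l = inord l.
  by apply/val_inj; rewrite /= inordK // (leq_trans (ltn_ord l)).
by [].
Qed.

Lemma lblock_upper_unit k (U : 'M[R]_n.+1) : (k <= n.+1)%N -> is_trig_mx U^T ->
  (forall i, U i i != 0) -> lblock k U \in unitmx.
Proof.
move=> kn tU U0; rewrite -unitmx_tr unitmxE det_trig ?unitfE.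
  by apply/prodf_neq0 => i _; rewrite !mxE.
apply/is_trig_mxP => i j ij; move/is_trig_mxP: tU => /(_ (inord i) (inord j)).
have lt (l : 'I_k) : (l < n.+1)%N := leq_trans (ltn_ord l) kn.
by rewrite !mxE !inordK // => ->.
Qed.

Lemma lblock_upper_det k (U : 'M[R]_n.+1) : (k <= n.+1)%N -> is_trig_mx U^T ->
  \det (lblock k U) = \prod_(i < k) U (inord i) (inord i).
Proof.
move=> kn tU; rewrite -det_tr det_trig.
  by apply: eq_bigr => i _; rewrite !mxE.
apply/is_trig_mxP => i j ij; move/is_trig_mxP: tU => /(_ (inord i) (inord j)).
have lt (l : 'I_k) : (l < n.+1)%N := leq_trans (ltn_ord l) kn.
by rewrite !mxE !inordK // => ->.
Qed.

(* If the first k rows of X0 are G times the rows f of U, then the leading minor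
   of X t is, up to a unit, the minor of the lower factor of U X0^-1 X(t) with
   rows f and first k columns, which is positive by total positivity. *)
Lemma minor_neq0_after X0 (k : 'I_n.+2) : orthogonal_mx X0 -> exists2 r, 0 < r &
  forall a b (X : R -> 'M[R]_n.+1), a <= b -> convex_curve skew_jacobi a b X -> X a = X0 ->
    (forall t, a <= t <= b -> entries_le r (X t - X0)) ->
    forall t, a < t <= b -> \det (lblock k (X t)) != 0.
Proof.
move=> oX0; have kn : (k <= n.+1)%N := leq_ord k.
pose A : 'M[R]_(k, n.+1) := rowsub (fun i : 'I_k => inord i) X0.
have fA : row_free A.
  apply/row_freeP; exists (colsub (fun i : 'I_k => inord i) X0^T).
  rewrite -colsub_mul; apply/matrixP => i j.
  transitivity ((X0 *m X0^T) (inord i) (inord j)).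
    by rewrite !mxE; apply: eq_bigr => l _; rewrite !mxE.
  have lt (l : 'I_k) : (l < n.+1)%N := leq_trans (ltn_ord l) kn.
  by rewrite oX0 !mxE -!val_eqE /= !inordK.
have [f [U [G [fi uG tU U1 AE]]]] := echelon fA.
have [CU CU1 bU] := entries_le_ex U.
pose N : R := n.+1%:R.
(* [C] is the factor by which the distance of X to X0 may grow into that of Y to U. A radius at most
   [C^-1] keeps Y bounded by [C']; at most [K^-1], it keeps the leading minors of Y within less than
   1 of those of U, which equal 1. *)
pose C := N * ((N * (CU * 1)) * 1) + 1.
have C1 : 1 <= C.
  by rewrite lerDr !mulr_ge0 // ?ler0n // (le_trans ler01).
have C0 : 0 < C by apply: lt_le_trans C1.
pose C' := CU + 1.
have C'1 : 1 <= C' by rewrite lerDr (le_trans ler01).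
pose K := (n.+1)`!%:R * (C' ^+ n.+1 * (N * C)) + 1.
have K0 : 0 < K.
  rewrite ltr_wpDl // !mulr_ge0 ?ler0n ?exprn_ge0 //; last exact: ltW.
  by rewrite (le_trans ler01).
exists (Num.min C^-1 K^-1); first by rewrite lt_min !invr_gt0 C0.
move=> a b X ab cX Xa near t /andP[at_ tb].
(* Y solves the same equation but starts at the unitriangular U, so its lower factor starts at the
   identity, as total positivity requires. *)
pose Y s := (U *m X0^T) *m X s.
have cY : convex_curve skew_jacobi a b Y by exact: convex_curve_mull.
have Ya : Y a = U by rewrite /Y Xa -mulmxA orthogonal_mxT ?mulmx1.
have XE s : X s = X0 *m (X0^T *m X s) by rewrite mulmxA oX0 mul1mx.
set r := Num.min _ _ in near.
have r0 : 0 < r by rewrite lt_min !invr_gt0 C0.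
have dY s : a <= s <= b -> entries_le (C * r) (Y s - U).
  move=> sab; have -> : Y s - U = (U *m X0^T) *m (X s - X0).
    by rewrite mulmxBr -[X in _ = _ - X]mulmxA orthogonal_mxT ?mulmx1.
  have b1 : entries_le (N * (CU * 1)) (U *m X0^T).
    by apply: entries_le_mul => // i j; rewrite mxE; apply: orthogonal_entries_le.
  move=> i j; apply: le_trans (entries_le_mul b1 (near s sab) i j) _.
  have -> : N * (N * (CU * 1) * r) = (C - 1) * r by rewrite /C; ring.
  by apply: ler_wpM2r; [exact: ltW|lra].
have Cr : C * r <= 1.
  by rewrite mulrC -ler_pdivlMr // div1r ge_min lexx.
have bY s : a <= s <= b -> entries_le C' (Y s).
  move=> sab i j; have h2 : `|Y s i j - U i j| <= C * r.
    by have := dY s sab i j; rewrite [X in `|X|]mxE [X in _ + X]mxE.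
  rewrite -(subrK (U i j) (Y s i j)); apply: le_trans (ler_normD _ _) _.
  by rewrite addrC /C' lerD ?bU // (le_trans h2).
have pY s : a <= s <= b -> forall l, (l <= n.+1)%N -> 0 < \det (lblock l (Y s)).
  move=> sab l ln.
  have d1 : \det (lblock l U) = 1.
    by rewrite lblock_upper_det // big1 // => i _.
  have bU' : entries_le C' U by move=> i j; apply: le_trans (bU i j) _; rewrite lerDl.
  have bd : entries_le (C * r) (lblock l (Y s) - lblock l U).
    by move=> i j; have := dY s sab (inord i) (inord j); rewrite !mxE.
  have := det_lip C'1 (lblock_entries_le (k := l) (bY s sab)) (lblock_entries_le (k := l) bU') bd.
  rewrite d1 => H.
  have : l`!%:R * (C' ^+ l * (l%:R * (C * r))) < 1.
    apply: (@le_lt_trans _ _ ((n.+1)`!%:R * (C' ^+ n.+1 * (N * (C * r))))).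
      have Cr0 : 0 <= C * r by rewrite mulr_ge0 // ltW.
      have C'0 : 0 <= C' by apply: le_trans C'1; exact: ler01.
      apply: ler_pM; first exact: ler0n.
      - by apply: mulr_ge0; [exact: exprn_ge0|apply: mulr_ge0].
      - by rewrite ler_nat leq_fact.
      apply: ler_pM; first exact: exprn_ge0.
      - by apply: mulr_ge0.
      - exact: ler_weXn2l.
      by apply: ler_wpM2r => //; rewrite ler_nat.
    have -> : (n.+1)`!%:R * (C' ^+ n.+1 * (N * (C * r))) = (K - 1) * r.
      by rewrite /K; ring.
    have : r <= K^-1 by rewrite ge_min lexx orbT.
    rewrite -(ler_pM2l K0) mulfV ?gt_eqF // => Kr.
    by rewrite mulrBl mul1r; lra.
  by move=> /(le_lt_trans H); rewrite ltr_norml => /andP[]; lra.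
have nY s : a <= s <= b -> lu_regular (Y s).
  by move=> sab l ln; rewrite gt_eqF // pY.
have tab : a <= t <= b by rewrite ltW.
have aab : a <= a <= b by rewrite lexx.
have cL := LU_curve ab cY pY.
have La : lu_left (Y a) = 1%:M by apply: lu_left_id; [exact: nY|rewrite Ya].
pose g := fun i : 'I_k => inord i : 'I_n.+1.
have gE i : g i = i :> nat by rewrite inordK // (leq_trans (ltn_ord i)).
have gi : incr g by move=> i j ij; rewrite !gE.
have gf c : (g c <= f c)%N.
  rewrite gE; case: c => c; elim: c => [//|c IH] ck.
  by apply: leq_ltn_trans (IH (ltnW ck)) _; apply: fi.
have pos := minor_gt0 ab cL La fi gi gf (x := t); rewrite at_ tb in pos.
have {}pos := pos isT.
have tV : is_trig_mx (invmx (lu_right (Y t)))^T.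
  by rewrite trmx_inv trig_inv ?lu_right_trig // unitmx_tr lu_right_unit //; exact: nY.
have YE : Y t = lu_left (Y t) *m invmx (lu_right (Y t)).
  by rewrite /lu_left mulmxK // lu_right_unit //; exact: nY.
(* The first k rows of X(t) are G times the rows f of Y(t) = L V^-1, and the upper triangular V^-1
   contributes only its leading block to the first k columns. *)
have prE : lblock k (X t) = G *m (mxsub f g (lu_left (Y t)) *m lblock k (invmx (lu_right (Y t)))).
  rewrite -lblock_upper_mul // -YE.
  have -> : lblock k (X t) = colsub g (A *m (X0^T *m X t)).
    rewrite colsub_mul; apply/matrixP => i j; rewrite mxE {1}XE !mxE.
    by apply: eq_bigr => l _; rewrite !mxE.
  rewrite AE -mulmxA colsub_mul; congr (_ *m _).
  rewrite /Y -mulmxA; apply/matrixP => i j; rewrite !mxE.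
  by apply: eq_bigr => l _; rewrite !mxE.
rewrite -unitfE -unitmxE prE !unitmx_mul uG /=; apply/andP; split.
  by rewrite unitmxE unitfE gt_eqF.
apply: lblock_upper_unit => // i; have := trig_unit_diag i tV.
rewrite mxE; apply; rewrite unitmx_tr unitmx_inv lu_right_unit //; exact: nY.
Qed.

Lemma lu_regular_after X0 : orthogonal_mx X0 -> exists2 r, 0 < r &
  forall a b (X : R -> 'M[R]_n.+1), a <= b -> convex_curve skew_jacobi a b X -> X a = X0 ->
    (forall t, a <= t <= b -> entries_le r (X t - X0)) ->
    forall t, a < t <= b -> lu_regular (X t).
Proof.
move=> oX0.
have [||r r0 H] := @uniform_ord n.+2 (fun k r => forall a b (X : R -> 'M[R]_n.+1),
    a <= b -> convex_curve skew_jacobi a b X -> X a = X0 ->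
    (forall t, a <= t <= b -> entries_le r (X t - X0)) ->
    forall t, a < t <= b -> \det (lblock k (X t)) != 0).
- move=> k x y _ xy H a b X ab cX Xa near; apply: H => // t tab i j.
  exact: le_trans (near t tab i j) xy.
- by move=> k; exact: minor_neq0_after.
exists r => // a b X ab cX Xa near t tab k kn.
by have := H (Ordinal (kn : (k < n.+2)%N)) a b X ab cX Xa near t tab.
Qed.

End EndPoint.

(** * Time reversal, giving regularity before a given matrix *)

Section Reversal.
Context {R : realType}.
Local Notation mu := (@lebesgue_measure R).

Lemma aeN (P : R -> Prop) : {ae mu, forall t, P t} -> {ae mu, forall t, P (- t)}.
Proof.
move=> [A [mA A0 PA]]; exists ((-%R : R -> measurableTypeR R) @^-1` A); split.
- rewrite -[X in measurable X]setTI; exact: (measurable_funN (@measurable_id _ R setT)).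
- by rewrite -A0 -(lebesgue_measureN mA).
- by move=> t /= nP; apply: PA.
Qed.

Lemma abs_contN a b (f : R -> R) : abs_cont a b f -> abs_cont (- b) (- a) (fun s => f (- s)).
Proof.
move=> acf e /acf[d d0 H]; exists d => // k u v uv tr sd.
have := H k (fun i => - v i) (fun i => - u i).
under eq_bigr do rewrite opprK addrC.
under [X in X < e]eq_bigr do rewrite distrC.
apply=> //.
  by move=> i; have [? [? ?]] := uv i; split; [|split]; lra.
move=> i j _ _ [x [/=]]; rewrite !in_itv /= => xi xj.
apply: tr => //; exists (- x); split=> /=; rewrite in_itv /=; lra.
Qed.

Lemma derN (f : R -> R) (t l : R) : is_derive (- t) 1 f l ->
  is_derive t 1 (fun s => f (- s)) (- l).
Proof.
move=> /is_derive_eps df; apply/is_derive_eps => e /df[r r0 H].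
exists r => // s st; have := H (- s).
have -> : - s - - t = - (s - t) by ring.
by rewrite normrN mulrN mulNr => /(_ st).
Qed.

Context {n : nat}.
Implicit Types (X : R -> 'M[R]_n.+1).

(** Conjugation by these alternating signs negates every tridiagonal matrix with zero diagonal. *)
Definition alt_sign : 'M[R]_n.+1 := diag_mx (\row_i (-1) ^+ i).

Lemma alt_sign_sqr : alt_sign *m alt_sign = 1%:M.
Proof.
rewrite /alt_sign mulmx_diag; apply/matrixP => i j; rewrite !mxE.
by rewrite -expr2 sqrr_sign.
Qed.

Lemma alt_sign_tr : alt_sign^T = alt_sign. Proof. exact: tr_diag_mx. Qed.

Lemma alt_sign_skew_jacobi kap : alt_sign *m skew_jacobi kap *m alt_sign = - skew_jacobi kap.
Proof.
rewrite /skew_jacobi mulmx_sumr mulmx_suml -sumrN; apply: eq_bigr => j _.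
apply/matrixP => i l; rewrite mul_mx_diag mul_diag_mx !mxE -!val_eqE /=.
rewrite /bump /= add1n; set x := (_ && _); set y := (_ && _).
have sgnS (p : nat) : (-1) ^+ p.+1 * (-1) ^+ p = -1 :> R.
  by rewrite exprS mulN1r mulNr -expr2 sqrr_sign.
have E (z : R) : (-1) ^+ i * (-1) ^+ l = -1 :> R -> (-1) ^+ i * z * (-1) ^+ l = - z.
  by move=> il; rewrite mulrAC il mulN1r.
have [/andP[/eqP ij /eqP lj]|x0] := boolP x; first by apply: E; rewrite ij lj sgnS.
have [/andP[/eqP ij /eqP lj]|y0] := boolP y; last first.
  by rewrite subrr !(mulr0, mul0r) oppr0.
by apply: E; rewrite ij lj mulrC sgnS.
Qed.

Lemma lu_regular_alt_sign (A : 'M[R]_n.+1) : lu_regular (A *m alt_sign) -> lu_regular A.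
Proof.
move=> H k kn; have := H k kn.
have -> : lblock k (A *m alt_sign) = lblock k A *m lblock k alt_sign.
  have := @lblock_upper_mul R n k A alt_sign k (fun i => inord i) kn.
  rewrite alt_sign_tr diag_mx_is_trig => /(_ isT) E.
  by rewrite lblock_mxsub E -lblock_mxsub.
by rewrite det_mulmx mulf_eq0 negb_or => /andP[].
Qed.

(** Reversing time replaces Lambda by -Lambda; the right factor [alt_sign] restores the sign, and it
    changes leading minors only by signs. *)
Lemma convex_curve_rev a b X : a <= b -> convex_curve skew_jacobi a b X ->
  convex_curve skew_jacobi (- b) (- a) (fun s => X (- s) *m alt_sign).
Proof.
move=> ab [mX aX]; split.
  apply: (mx_abs_cont_mul (X := fun s => X (- s)) (Y := fun=> alt_sign)); [lra| |exact: mx_abs_cont_cst].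
  by move=> i j; exact: abs_contN (mX i j).
apply: aeS (aeN aX) => t H /andP[bt ta].
have [|kap kap0 dX] := H; first by apply/andP; split; lra.
exists kap => //.
have -> : X (- t) *m alt_sign *m skew_jacobi kap = (- (X (- t) *m skew_jacobi kap)) *m alt_sign.
  have -> : - (X (- t) *m skew_jacobi kap) = X (- t) *m (alt_sign *m skew_jacobi kap *m alt_sign).
    by rewrite alt_sign_skew_jacobi mulmxN.
  by rewrite -!mulmxA alt_sign_sqr mulmx1.
apply: (@is_mx_derive_mulr R n.+1 n.+1 n.+1 alt_sign (fun s => X (- s))) => i j; rewrite mxE.
exact: derN (dX i j).
Qed.

Lemma lu_regular_before (X0 : 'M[R]_n.+1) : orthogonal_mx X0 -> exists2 r, 0 < r &
  forall a b X, a <= b -> convex_curve skew_jacobi a b X -> X b = X0 ->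
    (forall t, a <= t <= b -> entries_le r (X t - X0)) ->
    forall t, a <= t < b -> lu_regular (X t).
Proof.
move=> oX0; have oXa : orthogonal_mx (X0 *m alt_sign).
  by rewrite /orthogonal_mx trmx_mul alt_sign_tr mulmxA -[X0 *m alt_sign *m alt_sign]mulmxA alt_sign_sqr mulmx1.
have [r r0 H] := lu_regular_after oXa; exists r => // a b X ab cX Xb near t /andP[at_ tb].
apply: lu_regular_alt_sign; rewrite -[t]opprK.
apply: (H (- b) (- a) (fun s => X (- s) *m alt_sign)); first by lra.
- exact: convex_curve_rev.
- by rewrite opprK Xb.
- move=> s /andP[sa sb] i j; rewrite -mulmxBl mul_mx_diag mxE.
  have := near (- s) _ i j; rewrite normrM [X in _ * `|X|]mxE normrX normrN1 expr1n mulr1.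
  by apply; apply/andP; split; lra.
- by apply/andP; split; lra.
Qed.

End Reversal.

(** * Stability of the singular times under uniform perturbation *)

Section SingularTimes.
Context {R : realType} {n : nat}.
Implicit Types (X Y : R -> 'M[R]_n.+1) (c d e r s t : R).

Definition so_curve X :=
  convex_curve skew_jacobi 0 1 X /\ forall t, 0 <= t <= 1 -> orthogonal_mx (X t).

Definition singular_times X : set R := [set t | 0 < t < 1 /\ ~ lu_regular (X t)].

Definition uclose d X Y := forall t, 0 <= t <= 1 -> entries_le d (Y t - X t).

Lemma uclose0 d X : 0 <= d -> uclose d X X.
Proof. by move=> d0 t _ i j; rewrite subrr mxE normr0. Qed.

Lemma ucloseW d d' X Y : d <= d' -> uclose d X Y -> uclose d' X Y.
Proof. by move=> dd H t tab i j; apply: le_trans (H t tab i j) dd. Qed.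

Lemma entries_leD m p (A B : 'M[R]_(m, p)) C D : entries_le C A -> entries_le D B -> entries_le (C + D) (A + B).
Proof. by move=> HA HB i j; rewrite mxE (le_trans (ler_normD _ _)) // lerD. Qed.

Lemma mx_abs_cont_continuous a b X c e : mx_abs_cont a b X -> a <= c <= b -> 0 < e ->
  exists2 r, 0 < r & forall s, a <= s <= b -> `|s - c| < r -> entries_le e (X s - X c).
Proof.
move=> mX cab e0.
have [||r r0 H] := @uniform_ord R n.+1 (fun i r => forall j s, a <= s <= b ->
    `|s - c| < r -> `|(X s - X c) i j| <= e).
- by move=> i x y x0 xy H j s sab sx; apply: H => //; apply: lt_le_trans xy.
- move=> i.
  have [||r r0 H] := @uniform_ord R n.+1 (fun j r => forall s, a <= s <= b ->
    `|s - c| < r -> `|(X s - X c) i j| <= e).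
  + by move=> j x y x0 xy H s sab sx; apply: H => //; apply: lt_le_trans xy.
  + move=> j; have [r r0 H] := abs_cont_continuous (mX i j) cab e0; exists r => // s sab sr.
    by rewrite !mxE; exact/ltW/H.
  by exists r => // j; exact: H.
by exists r => // s sab sr i j; exact: H.
Qed.

Lemma lu_regular_lower_bound (A : 'M[R]_n.+1) : lu_regular A ->
  exists2 c, 0 < c & forall k, (k <= n.+1)%N -> c <= `|\det (lblock k A)|.
Proof.
move=> nA.
have [||c c0 H] := @uniform_ord R n.+2 (fun k c => c <= `|\det (lblock k A)|).
- by move=> k x y _; exact: le_trans.
- move=> k; exists `|\det (lblock k A)| => //; rewrite normr_gt0; apply: nA.
  by rewrite -ltnS.
by exists c => // k kn; exact: (H (Ordinal (kn : (k < n.+2)%N))).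
Qed.

Lemma minor_lip : exists2 K : R, 0 < K & forall (A B : 'M[R]_n.+1) d k,
  0 <= d -> (k <= n.+1)%N -> orthogonal_mx A -> orthogonal_mx B -> entries_le d (A - B) ->
  `|\det (lblock k A) - \det (lblock k B)| <= K * d.
Proof.
exists ((n.+1)`!%:R * n.+1%:R); first by rewrite mulr_gt0 ?ltr0n ?fact_gt0.
move=> A B d k d0 kn oA oB AB.
have AB' : entries_le d (lblock k A - lblock k B) by move=> i j; have := AB (inord i) (inord j); rewrite !mxE.
have := det_lip (lexx 1) (lblock_entries_le (k := k) (orthogonal_entries_le oA)) (lblock_entries_le (k := k) (orthogonal_entries_le oB)) AB'.
move=> /le_trans; apply; rewrite expr1n mul1r -mulrA.
apply: ler_pM; rewrite ?ler0n ?ler_nat ?leq_fact ?mulr_ge0 //.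
by rewrite ler_wpM2r // ler_nat.
Qed.

(** With Y = X it isolates the singular times; with c an end point it keeps the singular times of
    all nearby curves with the same end points away from 0 and 1. *)
Lemma punctured X c : so_curve X -> 0 <= c <= 1 -> exists2 r, 0 < r &
  forall Y, so_curve Y -> Y c = X c -> uclose r X Y ->
  forall s, 0 <= s <= 1 -> 0 < `|s - c| < r -> lu_regular (Y s).
Proof.
move=> [cX oX] c01.
have [r1 r10 H1] := lu_regular_after (oX c c01).
have [r2 r20 H2] := lu_regular_before (oX c c01).
pose p := Num.min r1 r2; have p0 : 0 < p by rewrite lt_min r10.
have p20 : 0 < p / 2 by rewrite divr_gt0.
have [r r0 Hr] := mx_abs_cont_continuous cX.1 c01 p20.
(* One number limits both the time and the uniform distance: half of p is allotted to the motion of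
   X away from X(c), half to the gap between Y and X. *)
exists (Num.min r (p / 2)); first by rewrite lt_min r0.
move=> Y [cY oY] Yc XY s s01 /andP[s0]; rewrite lt_min => /andP[sr _].
have near t : 0 <= t <= 1 -> `|t - c| < r -> entries_le p (Y t - X c).
  move=> t01 tr; have -> : Y t - X c = (Y t - X t) + (X t - X c) by rewrite addrA subrK.
  have -> : p = p / 2 + p / 2 by lra.
  apply: entries_leD; last exact: Hr.
  by move=> i j; apply: le_trans (XY t t01 i j) _; rewrite ge_min lexx orbT.
have /andP[c0 c1] := c01; have /andP[s0' s1] := s01.
have [sc|cs|sc] := ltgtP s c.
- apply: (H2 s c Y) => //; first exact: ltW.
  + by apply: convex_curve_sub cY.
  + move=> t /andP[st tc] i j; apply: (@le_trans _ _ p); last by rewrite ge_min lexx orbT.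
    apply: near; first by apply/andP; split; lra.
    by move: sr; rewrite !ler0_norm; lra.
  + by rewrite lexx.
- apply: (H1 c s Y) => //; first exact: ltW.
  + by apply: convex_curve_sub cY.
  + move=> t /andP[ct ts] i j; apply: (@le_trans _ _ p); last by rewrite ge_min lexx.
    apply: near; first by apply/andP; split; lra.
    by move: sr; rewrite !ger0_norm; lra.
  + by rewrite lexx cs.
- by move: s0; rewrite sc subrr normr0 ltxx.
Qed.

(** Both halves of Hausdorff closeness, restricted to singular times located at t. This pointwise
    form is local in t and can be glued by [cousin]. *)
Definition shadow e X Y t :=
  (singular_times X t -> exists2 s, singular_times Y s & `|s - t| < e) /\
  (singular_times Y t -> exists2 s, singular_times X s & `|s - t| < e).

(** Vacuous near an end point: neither curve has a singular time there, by [punctured]. *)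
Lemma shadow_near_end X c e : so_curve X -> c = 0 \/ c = 1 -> exists2 r, 0 < r &
  forall Y, so_curve Y -> Y 0 = X 0 -> Y 1 = X 1 -> uclose r X Y ->
  forall t, 0 <= t <= 1 -> `|t - c| < r -> shadow e X Y t.
Proof.
move=> sX cE; have c01 : 0 <= c <= 1 by case: cE => ->; rewrite lexx ler01.
have [r r0 H] := punctured sX c01; exists r => // Y sY Y0 Y1 XY t t01 tr.
have [tc|tc] := eqVneq t c.
  by split=> -[/andP[]]; rewrite tc; case: cE => ->; rewrite ltxx.
have tcr : 0 < `|t - c| < r by rewrite normr_gt0 subr_eq0 tc.
split=> -[_ []]; first by apply: (H X) => //; exact/uclose0/ltW.
by apply: (H Y) => //; case: cE => ->.
Qed.

Lemma shadow_near_regular X c e : so_curve X -> 0 <= c <= 1 -> lu_regular (X c) ->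
  exists2 r, 0 < r & forall Y, so_curve Y -> uclose r X Y ->
  forall t, 0 <= t <= 1 -> `|t - c| < r -> shadow e X Y t.
Proof.
move=> [cX oX] c01 nX; have [m m0 Hm] := lu_regular_lower_bound nX.
have [K K0 HK] := minor_lip.
(* A nearby Z(t) is within 2d of X(c), so its leading minors differ by at most 2m/3 from ones of
   absolute value at least m. *)
pose d := m / (3 * K); have d0 : 0 < d by rewrite divr_gt0 // mulr_gt0.
have [r r0 Hr] := mx_abs_cont_continuous cX.1 c01 d0.
exists (Num.min r d); first by rewrite lt_min r0.
move=> Y [cY oY] XY t t01; rewrite lt_min => /andP[tr _].
have nsg Z : so_curve Z -> uclose d X Z -> lu_regular (Z t).
  move=> [cZ oZ] XZ k kn; apply: contraTneq (Hm k kn) => Zk.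
  have ZX : entries_le (2 * d) (Z t - X c).
    have -> : Z t - X c = (Z t - X t) + (X t - X c) by rewrite addrA subrK.
    have -> : 2 * d = d + d by lra.
    by apply: entries_leD; [exact: XZ|exact: Hr].
  have d20 : 0 <= 2 * d by lra.
  have := HK _ _ _ _ d20 kn (oZ t t01) (oX c c01) ZX.
  rewrite Zk sub0r normrN -ltNge => /le_lt_trans; apply.
  have -> : K * (2 * d) = 2 / 3 * m by rewrite /d; field; rewrite gt_eqF.
  lra.
split=> -[_ []]; first by apply: nsg => //; exact/uclose0/ltW.
by apply: nsg => //; apply: ucloseW XY; rewrite ge_min lexx orbT.
Qed.

(* The end points of a short interval around c are regular for X, hence for Y;
   were Y regular throughout, [sandwich] would keep the minors of Y, hence those
   of X, away from 0 at c. *)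
Lemma shadow_near_singular X c e : so_curve X -> 0 < c < 1 -> ~ lu_regular (X c) -> 0 < e ->
  exists2 r, 0 < r & forall Y, so_curve Y -> uclose r X Y ->
  forall t, 0 <= t <= 1 -> `|t - c| < r -> shadow e X Y t.
Proof.
move=> sX /andP[c0 c1] nX e0; have [cX oX] := sX.
have c01 : 0 <= c <= 1 by rewrite !ltW.
have [r1 r10 H1] := punctured sX c01.
(* Half the minimum puts c - h and c + h strictly inside [0, 1], within the punctured regular
   neighbourhood of c, and within e/2 of c. *)
pose h := Num.min (Num.min r1 e) (Num.min c (1 - c)) / 2.
have h0 : 0 < h by rewrite divr_gt0 // !lt_min r10 e0 c0 subr_gt0 c1.
have [hr1 he hc hc1] : [/\ h < r1, h <= e / 2, h < c & h < 1 - c].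
  have m1 : Num.min (Num.min r1 e) (Num.min c (1 - c)) <= r1 by rewrite !ge_min lexx.
  have m2 : Num.min (Num.min r1 e) (Num.min c (1 - c)) <= e by rewrite !ge_min lexx !orbT.
  have m3 : Num.min (Num.min r1 e) (Num.min c (1 - c)) <= c by rewrite !ge_min lexx !orbT.
  have m4 : Num.min (Num.min r1 e) (Num.min c (1 - c)) <= 1 - c by rewrite !ge_min lexx !orbT.
  by split; rewrite /h; lra.
pose a := c - h; pose b := c + h.
have a01 : 0 <= a <= 1 by rewrite /a; apply/andP; split; lra.
have b01 : 0 <= b <= 1 by rewrite /b; apply/andP; split; lra.
have ab : a <= b by rewrite /a /b; lra.
have XX : uclose r1 X X by exact/uclose0/ltW.
have nXa : lu_regular (X a).
  by apply: (H1 X) => //; rewrite /a addrAC subrr sub0r normrN gtr0_norm // h0.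
have nXb : lu_regular (X b).
  by apply: (H1 X) => //; rewrite /b addrAC subrr add0r gtr0_norm // h0.
have [ma ma0 Ha] := lu_regular_lower_bound nXa; have [mb mb0 Hb] := lu_regular_lower_bound nXb.
pose m := Num.min ma mb / 2.
have m0 : 0 < m by rewrite divr_gt0 // lt_min ma0.
have [m' m'0 Hm'] := @sandwich R n m m0.
have [K K0 HK] := minor_lip.
(* The minors of X at a and b are at least 2m in absolute value, so those of Y are at least m. At c
   those of Y would be at least m', leaving at least m'/2 for the singular X(c). *)
pose d := Num.min m (m' / 2) / K.
have d0 : 0 < d by rewrite divr_gt0 // lt_min m0 divr_gt0.
have Kd : K * d = Num.min m (m' / 2) by rewrite /d mulrC divfK // gt_eqF.
exists (Num.min d (e / 2)); first by rewrite lt_min d0 divr_gt0.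
move=> Y sY XY t t01; rewrite lt_min => /andP[_ te]; have [cY oY] := sY.
have {}XY : uclose d X Y by apply: ucloseW XY; rewrite ge_min lexx.
have lip s k : 0 <= s <= 1 -> (k <= n.+1)%N ->
    `|\det (lblock k (X s))| <= `|\det (lblock k (Y s))| + K * d.
  move=> s01 kn; have := HK _ _ _ _ (ltW d0) kn (oY s s01) (oX s s01) (XY s s01).
  have := ler_normD (\det (lblock k (Y s))) (\det (lblock k (X s)) - \det (lblock k (Y s))).
  by rewrite addrC subrK (distrC (\det (lblock k (X s)))); lra.
have [Kdm Kdm'] : K * d <= m /\ K * d <= m' / 2.
  by rewrite Kd !ge_min !lexx orbT.
have [ma2 mb2] : m * 2 <= ma /\ m * 2 <= mb.
  by rewrite /m divfK // !ge_min !lexx orbT.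
have [s sab sY'] : exists2 s, a <= s <= b & ~ lu_regular (Y s).
  apply: contrapT => H; apply: nX => k kn.
  have nY s : a <= s <= b -> lu_regular (Y s).
    by move=> sab; apply: contrapT => nY; apply: H; exists s.
  have cab : a <= c <= b by rewrite /a /b; apply/andP; split; lra.
  have := Hm' a b Y ab _ _ nY _ _ c cab k kn => Hc.
  have {Hc} : m' <= `|\det (lblock k (Y c))|.
    apply: Hc.
    - by apply: convex_curve_sub cY; [case/andP: a01|case/andP: b01].
    - move=> s /andP[as_ sb]; apply: oY; move: a01 b01 => /andP[? ?] /andP[? ?].
      by apply/andP; split; lra.
    - by move=> l ln; have := lip a l a01 ln; have := Ha l ln; lra.
    - by move=> l ln; have := lip b l b01 ln; have := Hb l ln; lra.
  have := HK _ _ _ _ (ltW d0) kn (oY c c01) (oX c c01) (XY c c01).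
  move=> h1 h2; rewrite -normr_gt0.
  have := ler_normD (\det (lblock k (X c))) (\det (lblock k (Y c)) - \det (lblock k (X c))).
  by rewrite addrC subrK; lra.
have scX : singular_times X c by split; first by rewrite c0.
split=> _; last first.
  by exists c => //; rewrite distrC; lra.
exists s.
  split=> //; move: sab; rewrite /a /b => /andP[? ?]; apply/andP; split; lra.
have sc : `|s - c| <= h.
  by move: sab; rewrite /a /b ler_norml => /andP[? ?]; apply/andP; split; lra.
have -> : s - t = (s - c) - (t - c) by ring.
apply: le_lt_trans (ler_normB _ _) _; lra.
Qed.

(** Each time has a neighbourhood with its own admissible distance, according to whether it is an
    end point, regular or singular; [cousin] selects a common one. *)
Theorem shadow_uniform X e : so_curve X -> 0 < e -> exists2 d, 0 < d &
  forall Y, so_curve Y -> Y 0 = X 0 -> Y 1 = X 1 -> uclose d X Y ->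
  forall t, 0 <= t <= 1 -> shadow e X Y t.
Proof.
move=> sX e0.
apply: (@cousin R (fun x y => exists2 d, 0 < d &
  forall Y, so_curve Y -> Y 0 = X 0 -> Y 1 = X 1 -> uclose d X Y ->
  forall t, x <= t <= y -> shadow e X Y t)); first exact: ler01.
  move=> x y z _ xy yz _ [d1 d10 H1] [d2 d20 H2].
  exists (Num.min d1 d2); first by rewrite lt_min d10.
  move=> Y sY Y0 Y1 XY t /andP[xt tz]; have [ty|yt] := leP t y.
    by apply: H1; rewrite ?xt //; apply: ucloseW XY; rewrite ge_min lexx.
  by apply: H2; rewrite ?tz ?(ltW yt) //; apply: ucloseW XY; rewrite ge_min lexx orbT.
move=> c c01.
have [r r0 H] : exists2 r, 0 < r &
    forall Y, so_curve Y -> Y 0 = X 0 -> Y 1 = X 1 -> uclose r X Y ->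
    forall t, 0 <= t <= 1 -> `|t - c| < r -> shadow e X Y t.
  have [c0|cn0] := eqVneq c 0; first by apply: shadow_near_end => //; left.
  have [c1|cn1] := eqVneq c 1; first by apply: shadow_near_end => //; right.
  have [nX|nX] := pselect (lu_regular (X c)).
    have [r r0 H] := shadow_near_regular e sX c01 nX; exists r => // Y sY _ _; exact: H.
  have c01' : 0 < c < 1 by rewrite !lt_neqAle eq_sym cn0 cn1.
  by have [r r0 H] := shadow_near_singular sX c01' nX e0; exists r => // Y sY _ _; exact: H.
exists r => // x y x0 xc cy y1 xr yr; exists r => // Y sY Y0 Y1 XY t /andP[xt ty].
apply: H => //; first by apply/andP; split; lra.
by rewrite ltr_norml; apply/andP; split; lra.
Qed.

Lemma singular_times_closed X : so_curve X -> closed (singular_times X).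
Proof.
move=> sX; rewrite -[singular_times X]setCK; apply: open_closedC.
rewrite openE => c nc; rewrite /interior nbhs_ballP.
have [c01|c01] := boolP (0 <= c <= 1).
  have [r r0 H] := punctured sX c01; exists r => // s /= cs [/andP[s0 s1] sX'].
  have [sc|sc] := eqVneq s c; first by apply: nc; rewrite -sc; split; first by rewrite s0.
  apply: sX'; apply: (H X) => //; first exact/uclose0/ltW.
    by rewrite !ltW.
  by rewrite normr_gt0 subr_eq0 sc distrC.
pose r := if c < 0 then - c else c - 1.
exists r => /=.
  by move: c01; rewrite negb_and -!ltNge /r; case: ltP => c0; lra.
move=> s; rewrite /ball /= /r => cs [/andP[s0 s1] _].
move: c01 cs; rewrite negb_and -!ltNge; case: ltP => c0 /=; rewrite ltr_norml; lra.
Qed.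

Lemma singular_times_compact X : so_curve X -> compact (singular_times X).
Proof.
move=> sX; apply: (subclosed_compact (singular_times_closed sX) (@segment_compact R 0 1)).
by move=> t [/andP[t0 t1] _] /=; rewrite in_itv /= !ltW.
Qed.

End SingularTimes.

(** * The spin group as orthogonal matrices, and calculus of the covering map *)

Section Clifford.
Context {R : realType}.

(** Hence a unit vector v has v v^T = - v v = 1: elements of the spin group are orthogonal matrices,
    and Pi(z) is polynomial in z. *)
Lemma tr_cl_gen m (i : 'I_m) : (cl_gen R i)^T = - cl_gen R i.
Proof.
elim: m i => [|m IH] i; first by case: i.
rewrite /=; case: unliftP => [j _|_]; rewrite tr_block_mx !linear0.
  by rewrite linearN /= IH opp_block_mx !oppr0.
by rewrite linearN /= tr_scalar_mx opp_block_mx !oppr0 opprK.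
Qed.

Lemma tr_cl_vec m (v : 'cV[R]_m) : (cl_vec v)^T = - cl_vec v.
Proof.
rewrite /cl_vec linear_sum -sumrN; apply: eq_bigr => i _.
by rewrite linearZ /= tr_cl_gen scalerN.
Qed.

Lemma spin_orth m (z : 'M[R]_(cl_dim m)) : Spin R m z -> orthogonal_mx z.
Proof.
move=> [s [_ us ->]]; elim: s us => [|u s IH] us; first by rewrite /orthogonal_mx /= trmx1 mulmx1.
have {}IH : orthogonal_mx (foldr (fun v w => cl_vec v *m w) 1%:M s).
  by apply: IH => v vs; apply: us; rewrite inE vs orbT.
rewrite /orthogonal_mx /= trmx_mul mulmxA -[cl_vec u *m _ *m _]mulmxA IH mulmx1 tr_cl_vec mulmxN.
by rewrite cl_vec_sqr ?us ?mem_head // raddfN /= opprK.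
Qed.

Lemma orthogonal_inv k (z : 'M[R]_k) : orthogonal_mx z -> invmx z = z^T.
Proof.
move=> oz; have [uz _] := mulmx1_unit oz.
by rewrite -[RHS](mulKmx uz) oz mulmx1.
Qed.

Lemma orthogonal_cl_gen m (i : 'I_m) : orthogonal_mx (cl_gen R i).
Proof.
rewrite /orthogonal_mx tr_cl_gen mulmxN.
rewrite -cl_vec_delta cl_vec_sqr ?raddfN /= ?opprK //.
rewrite (bigD1 i) //= big1 ?mxE ?eqxx ?expr1n ?addr0 // => l li.
by rewrite mxE (negbTE li) expr0n.
Qed.

(** Conjugation preserves anticommutators, which encode the inner product of vectors. *)
Lemma orthogonal_spin_cover m (z : 'M[R]_(cl_dim m)) : Spin R m z -> orthogonal_mx (spin_cover z).
Proof.
move=> Sz; have uz := spin_unitmx Sz; set Q := spin_cover z.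
have dotQ (u v : 'cV[R]_m) :
    \sum_i (Q *m u) i 0 * (Q *m v) i 0 = \sum_i u i 0 * v i 0.
  have := cl_vecM (Q *m u) (Q *m v); rewrite -!(spin_coverP _ Sz).
  have E (x y : 'cV[R]_m) : z *m cl_vec x *m invmx z *m (z *m cl_vec y *m invmx z) =
      z *m (cl_vec x *m cl_vec y) *m invmx z.
    by rewrite !mulmxA mulmxKV.
  rewrite !E -mulmxDl -mulmxDr cl_vecM mul_mx_scalar -scalemxAl mulmxV // scalemx1.
  move=> /(congr1 (fun A : 'M[R]_(cl_dim m) => A (Ordinal (cl_dim_gt0 m)) (Ordinal (cl_dim_gt0 m)))).
  by rewrite !mxE eqxx !mulr1n => /eqP; rewrite eqr_pMn2r // eqr_opp => /eqP.
apply: mulmx1C; apply/matrixP => i j.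
have := dotQ (delta_mx i 0) (delta_mx j 0).
rewrite -!colE !mxE => H.
transitivity (\sum_k Q k i * Q k j); first by apply: eq_bigr => k _; rewrite mxE.
have -> : \sum_k Q k i * Q k j = \sum_k col i Q k 0 * col j Q k 0.
  by apply: eq_bigr => k _; rewrite !mxE.
rewrite H (bigD1 i) //= big1 ?addr0 => [|k ki].
  by rewrite !mxE !eqxx mul1r andbT.
by rewrite !mxE (negbTE ki) mul0r.
Qed.

Lemma spin_coverE m (z : 'M[R]_(cl_dim m)) i j : Spin R m z ->
  spin_cover z i j = cl_coord (z *m cl_gen R j *m z^T) i.
Proof. by move=> Sz; rewrite mxE orthogonal_inv //; exact: spin_orth. Qed.

(** Here y is any matrix, not just a vector: the trace form moves the conjugation onto the generator
    e_i, where it acts by the transpose of Pi(z). *)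
Lemma cl_coord_conj m (z y : 'M[R]_(cl_dim m)) i : Spin R m z ->
  cl_coord (z *m y *m z^T) i = \sum_l spin_cover z i l * cl_coord y l.
Proof.
move=> Sz; have oz := spin_orth Sz; have oQ := orthogonal_spin_cover Sz.
have H : z^T *m cl_gen R i *m z = \sum_l spin_cover z i l *: cl_gen R l.
  have := spin_coverP ((spin_cover z)^T *m delta_mx i 0) Sz.
  rewrite mulmxA oQ mul1mx cl_vec_delta orthogonal_inv // => <-.
  rewrite !mulmxA orthogonal_mxT // mul1mx -mulmxA orthogonal_mxT // mulmx1.
  by rewrite /cl_vec; apply: eq_bigr => l _; rewrite -colE !mxE.
rewrite /cl_coord !mulmxA mxtrace_mulC !mulmxA H mulmx_suml [\tr _]raddf_sum /=.
rewrite -sumrN mulr_suml; apply: eq_bigr => l _.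
by rewrite -scalemxAl mxtraceZ -mulrN mulrA.
Qed.

Lemma cl_coord_bound m : exists2 K : R, 0 < K & forall (y : 'M[R]_(cl_dim m)) d i,
  entries_le d y -> `|cl_coord y i| <= K * d.
Proof.
pose N : R := (cl_dim m)%:R; have N0 : 0 < N by rewrite ltr0n cl_dim_gt0.
exists N => // y d i by_; rewrite /cl_coord normrM normrN normfV (gtr0_norm N0).
rewrite ler_pdivrMr //; apply: le_trans (ler_norm_sum _ _ _) _.
have -> : N * d * N = \sum_(k < cl_dim m) (N * d) by rewrite sumr_const card_ord mulr_natr.
apply: ler_sum => k _; have := entries_le_mul (orthogonal_entries_le (orthogonal_cl_gen i)) by_ k k.
by rewrite mul1r.
Qed.

Lemma spin_cover_lip m : exists2 K : R, 0 < K & forall (z w : 'M[R]_(cl_dim m)) d,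
  Spin R m z -> Spin R m w -> entries_le d (z - w) -> entries_le (K * d) (spin_cover z - spin_cover w).
Proof.
have [K K0 HK] := cl_coord_bound m.
pose N : R := (cl_dim m)%:R; have N0 : 0 < N by rewrite ltr0n cl_dim_gt0.
exists (K * (2 * N ^+ 2)); first by rewrite !mulr_gt0 // exprn_gt0.
move=> z w d Sz Sw zw i j; have bz := orthogonal_entries_le (spin_orth Sz); have bw := orthogonal_entries_le (spin_orth Sw).
rewrite [X in `|X|]mxE [X in _ + X]mxE !spin_coverE //.
have -> : cl_coord (z *m cl_gen R j *m z^T) i - cl_coord (w *m cl_gen R j *m w^T) i =
   cl_coord (z *m cl_gen R j *m z^T - w *m cl_gen R j *m w^T) i.
  by rewrite /cl_coord mulmxBr linearB /= -mulrBl opprD.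
have -> : z *m cl_gen R j *m z^T - w *m cl_gen R j *m w^T =
   (z - w) *m cl_gen R j *m z^T + w *m cl_gen R j *m (z - w)^T.
  by rewrite linearB /= !mulmxBl mulmxBr addrA subrK.
have be := orthogonal_entries_le (orthogonal_cl_gen j).
rewrite -mulrA; apply: HK.
have -> : 2 * N ^+ 2 * d = N * (N * (d * 1) * 1) + N * (N * (1 * 1) * d) by ring.
apply: entries_leD; apply: entries_le_mul; rewrite -/N.
- exact: entries_le_mul.
- by move=> k l; rewrite mxE; exact: bz.
- exact: entries_le_mul.
- by move=> k l; rewrite mxE; exact: zw.
Qed.

Lemma is_mx_derive_tr m p (X : R -> 'M[R]_(m, p)) t X' : is_mx_derive X t X' ->
  is_mx_derive (fun s => (X s)^T) t X'^T.
Proof.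
move=> dX i j; rewrite mxE.
by rewrite (_ : (fun _ => _) = fun s => X s j i) //; apply/funext => s; rewrite mxE.
Qed.

Lemma is_mx_derive_near_eq m p (X Y : R -> 'M[R]_(m, p)) (t r : R) D : 0 < r ->
  (forall s, `|s - t| < r -> X s = Y s) -> is_mx_derive Y t D -> is_mx_derive X t D.
Proof.
move=> r0 XY dY i j; apply: (der_near_eq r0 _ (dY i j)) => s sr.
by rewrite XY.
Qed.

Lemma der_cl_coord m (Z : R -> 'M[R]_(cl_dim m)) t Z' i : is_mx_derive Z t Z' ->
  is_derive t 1 (fun s => cl_coord (Z s) i) (cl_coord Z' i).
Proof.
move=> dZ; have dA := is_mx_derive_mull (cl_gen R i) dZ.
have D := derM (der_sum (index_enum 'I_(cl_dim m)) (P := xpredT) (fun k _ => dA k k))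
  (der_cst (- (cl_dim m)%:R^-1) t).
rewrite (_ : (fun s => cl_coord _ _) =
   fun s => (\sum_k (cl_gen R i *m Z s) k k) * - (cl_dim m)%:R^-1); last first.
  by apply/funext => s; rewrite /cl_coord /mxtrace mulrN mulNr.
by apply: (der_eq D); rewrite mulr0 addr0 /cl_coord /mxtrace mulrN mulNr.
Qed.

Lemma spin_cover_der m (G : R -> 'M[R]_(cl_dim m)) (t r : R) G' : 0 < r ->
  (forall s, `|s - t| < r -> Spin R m (G s)) -> is_mx_derive G t G' ->
  is_mx_derive (fun s => spin_cover (G s)) t
    (spin_cover (G t) *m spin_lie (invmx (G t) *m G')).
Proof.
move=> r0 SG dG.
have St : Spin R m (G t) by apply: SG; rewrite subrr normr0.
have oG := spin_orth St; rewrite orthogonal_inv //.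
set x := (G t)^T *m G'.
have G'E : G' = G t *m x by rewrite /x mulmxA oG mul1mx.
(* Differentiating G G^T = 1 shows that the transpose of G' produces the second term of the
   commutator in [spin_lie]. *)
have G'T : G'^T = - (x *m (G t)^T).
  have d1 := is_mx_derive_mul dG (is_mx_derive_tr dG).
  have d0 : is_mx_derive (fun s => G s *m (G s)^T) t 0.
    apply: (is_mx_derive_near_eq r0 _ (is_mx_derive_cst 1%:M t)) => s sr.
    by apply: spin_orth; exact: SG.
  have := is_mx_derive_uniq d1 d0 => /(congr1 (mulmx (G t)^T)).
  rewrite mulmx0 mulmxDr !mulmxA orthogonal_mxT // mul1mx -/x => /eqP.
  by rewrite addrC addr_eq0 => /eqP.
move=> i j.
have dZ := is_mx_derive_mul (is_mx_derive_mulr (cl_gen R j) dG) (is_mx_derive_tr dG).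
have D := der_cl_coord i dZ.
apply: (der_near_eq r0 (g := fun s => cl_coord (G s *m cl_gen R j *m (G s)^T) i)).
  by move=> s sr; rewrite spin_coverE //; exact: SG.
apply: (der_eq D).
have -> : G' *m cl_gen R j *m (G t)^T + G t *m cl_gen R j *m G'^T =
    G t *m (x *m cl_gen R j - cl_gen R j *m x) *m (G t)^T.
  by rewrite G'T {1}G'E mulmxN mulmxBr mulmxBl !mulmxA.
by rewrite cl_coord_conj // [RHS]mxE; apply: eq_bigr => l _; rewrite [spin_lie _ _ _]mxE.
Qed.

Lemma mx_abs_cont_spin_cover m (G : R -> 'M[R]_(cl_dim m)) a b : a <= b ->
  (forall t, a <= t <= b -> Spin R m (G t)) -> mx_abs_cont a b G ->
  mx_abs_cont a b (fun t => spin_cover (G t)).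
Proof.
move=> ab SG mG i j.
have mT : mx_abs_cont a b (fun s => (G s)^T).
  by move=> k l; apply: abs_cont_eq (mG l k) => s _; rewrite mxE.
have mZ := mx_abs_cont_mul ab (mx_abs_cont_cst a b (cl_gen R i))
   (mx_abs_cont_mul ab (mx_abs_cont_mul ab mG (mx_abs_cont_cst a b (cl_gen R j))) mT).
have H : abs_cont a b (fun s => \sum_k
    (cl_gen R i *m (G s *m cl_gen R j *m (G s)^T)) k k * - (cl_dim m)%:R^-1).
  by apply: abs_cont_sum => k _; apply: abs_contM => //; exact: abs_cont_cst.
apply: abs_cont_eq H => s sab; rewrite spin_coverE; last exact: SG.
by rewrite -mulr_suml /cl_coord /mxtrace mulrN mulNr.
Qed.

End Clifford.

(** * A criterion for small Hausdorff distance *)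

Section Hausdorff.
Context {R : realType}.
Implicit Types (X Y : set R).

Lemma one_sided_lt X Y (e : R) : X !=set0 ->
  (forall x, X x -> exists2 y, Y y & `|x - y| < e) ->
  sup [set inf [set `|x - y| | y in Y] | x in X] <= e.
Proof.
move=> [x0 Xx0] H; apply: ge_sup; first by exists (inf [set `|x0 - y| | y in Y]); exists x0.
move=> _ [x Xx <-]; have [y Yy xy] := H x Xx; apply: le_trans (ltW xy).
apply: ge_inf; last by exists y.
by exists 0 => _ [y' _ <-].
Qed.

(** The hypotheses force both sets to be empty together, which avoids the value 1. Halving e
    restores a strict inequality, as suprema give only a weak one. *)
Lemma dist_H_lt X Y (e : R) : 0 < e ->
  (forall x, X x -> exists2 y, Y y & `|y - x| < e / 2) ->
  (forall y, Y y -> exists2 x, X x & `|x - y| < e / 2) ->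
  dist_H X Y < e.
Proof.
move=> e0 XY YX; rewrite /dist_H.
case: asboolP => [X0|/eqP/set0P nX].
  case: asboolP => // /eqP/set0P[y /YX[x]]; by rewrite X0.
case: asboolP => [Y0|/eqP/set0P nY].
  by have [x /XY[y]] := nX; rewrite Y0.
apply: (@le_lt_trans _ _ (e / 2)); last by lra.
rewrite ge_max; apply/andP; split.
  by apply: one_sided_lt => // x /XY[y Yy xy]; exists y => //; rewrite distrC.
have -> : [set inf [set `|x - y| | x in X] | y in Y] =
    [set inf [set `|y - x| | x in X] | y in Y].
  congr image; apply/funext => y; congr inf.
  by congr image; apply/funext => x; rewrite distrC.
by apply: one_sided_lt => // y /YX[x Xx xy]; exists x => //; rewrite distrC.
Qed.

End Hausdorff.

(** * The open Bruhat cell in terms of leading principal minors *)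

Section Bruhat.
Context {R : realType} {n : nat}.
Implicit Types (A Q U : 'M[R]_n.+1).
Local Notation P := (perm_mx (@eta n) : 'M[R]_n.+1).

Lemma eta_mulmx A i j : (P *m A) i j = A (rev_ord i) j.
Proof. by rewrite -row_permE mxE permE. Qed.

Lemma mulmx_eta A i j : (A *m P) i j = A i (rev_ord j).
Proof.
have -> : (P : 'M[R]_n.+1) = perm_mx (@eta n)^-1.
  congr perm_mx; apply/permP => k; apply: (@perm_inj _ (@eta n)).
  by rewrite permKV !permE rev_ordK.
by rewrite -col_permE mxE permE.
Qed.

Lemma eta_sqr : P *m P = 1%:M.
Proof. by apply/matrixP => i j; rewrite eta_mulmx -[P]mul1mx mulmx_eta mxE [RHS]mxE (inj_eq rev_ord_inj). Qed.

Lemma eta_tr : P^T = P.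
Proof.
rewrite tr_perm_mx; congr perm_mx; apply/permP => k; apply: (@perm_inj _ (@eta n)).
by rewrite permKV !permE rev_ordK.
Qed.

Lemma eta_conj_trig A : is_trig_mx A^T -> is_trig_mx (P *m A *m P).
Proof.
move=> /is_trig_mxP tA; apply/is_trig_mxP => i j ij; rewrite mulmx_eta eta_mulmx.
have := tA (rev_ord j) (rev_ord i); rewrite mxE; apply => /=.
by have := ltn_ord j; lia.
Qed.

Lemma eta_conj_trigT A : is_trig_mx A -> is_trig_mx (P *m A *m P)^T.
Proof.
by move=> tA; rewrite !trmx_mul eta_tr mulmxA; apply: eta_conj_trig; rewrite trmxK.
Qed.

Lemma eta_unit : P \in unitmx. Proof. exact: unitmx_perm. Qed.

Lemma lu_regular_LU A U : is_trig_mx A -> A \in unitmx -> is_trig_mx U^T -> U \in unitmx ->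
  lu_regular (A *m U).
Proof.
move=> tA uA tU uU k kn; rewrite -unitfE -unitmxE.
rewrite lblock_mxsub lblock_upper_mul // -lblock_mxsub unitmx_mul; apply/andP; split.
  rewrite -unitmx_tr; have -> : (lblock k A)^T = lblock k A^T by apply/matrixP => i j; rewrite !mxE.
  apply: lblock_upper_unit => //; first by rewrite trmxK.
  by move=> i; rewrite mxE trig_unit_diag.
apply: lblock_upper_unit => // i; have := trig_unit_diag i tU.
by rewrite mxE unitmx_tr; exact.
Qed.

(** Q = U0 P U1 amounts to P Q = (P U0 P) U1, and conjugation by the reversal P exchanges upper and
    lower triangular matrices. *)
Lemma Bru_lu_regular (z : 'M[R]_(cl_dim n.+1)) : Spin R n.+1 z ->
  Bru_eta z <-> lu_regular (P *m spin_cover z).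
Proof.
move=> Sz; split=> [[_ [U0 [U1 [[u0 t0] [u1 t1] ->]]]]|nX].
  rewrite !mulmxA; apply: lu_regular_LU => //; first exact: eta_conj_trig.
  by rewrite !unitmx_mul eta_unit u0.
split=> //; set X := P *m _ in nX.
exists (P *m lu_left X *m P), (invmx (lu_right X)); split.
- rewrite unitmx_mul eta_unit andbT unitmx_mul eta_unit (lu_left_unit nX); split=> //.
  exact/eta_conj_trigT/lu_left_trig.
- by rewrite unitmx_inv lu_right_unit // trmx_inv trig_inv ?lu_right_trig // unitmx_tr lu_right_unit.
- have C A B : P *m A *m P *m P *m B = P *m (A *m B).
    by rewrite -[P *m A *m P *m P]mulmxA eta_sqr mulmx1 mulmxA.
  rewrite C /lu_left mulmxK; last exact: lu_right_unit.
  by rewrite /X mulmxA eta_sqr mul1mx.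
Qed.

End Bruhat.

(** * From locally convex curves in the spin group to orthogonal matrix curves *)

Section Curves.
Context {R : realType} {n : nat}.
Local Notation mu := (@lebesgue_measure R).
Implicit Types (G : R -> 'M[R]_(cl_dim n.+1)).

Lemma mx_entry_le m p (A : 'M[R]_(m, p)) i j : `|A i j| <= `|A|.
Proof.
rewrite [leRHS]mx_normrE.
exact: (le_bigmax _ (fun ij : 'I_m * 'I_p => `|A ij.1 ij.2|) (i, j)).
Qed.

Lemma abs_continuous01_mx m p (F : R -> 'M[R]_(m, p)) :
  abs_continuous01 F -> mx_abs_cont 0 1 F.
Proof.
move=> aF i j e /aF[d d0 H]; exists d => // k u v uv tr sd.
apply: le_lt_trans (H k u v uv tr sd); apply: ler_sum => l _.
by have := mx_entry_le (F (v l) - F (u l)) i j; rewrite !mxE.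
Qed.

Lemma derivable01_is_mx_derive m p (F : R -> 'M[R]_(m, p)) (t : R) : 0 < t < 1 ->
  derivable01 F t -> is_mx_derive F t (deriv01 F t).
Proof.
move=> /andP[t0 t1] dF i j; apply/is_derive_eps => e e0.
have /cvgrPdist_lt /(_ _ e0) : quot01 F t @ within `[0, 1] t^' --> deriv01 F t by [].
move=> Hw; have {Hw} [r /= r0 Hr] : nbhs t (fun s => s != t -> `[0, 1]%classic s -> `|deriv01 F t - quot01 F t s| < e) by exact: Hw.
pose r' := Num.min r (Num.min t (1 - t)).
exists r'; first by rewrite !lt_min r0 t0 subr_gt0.
move=> s; rewrite !lt_min => /andP[sr /andP[st st1]].
have [->|sNt] := eqVneq s t; first by rewrite !subrr mulr0 subrr normr0 mulr0.
have d0 : s - t != 0 by rewrite subr_eq0.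
have s01 : `[0, 1]%classic s.
  rewrite /= in_itv /=; move: st st1; rewrite !ltr_norml => /andP[? ?] /andP[? ?].
  by apply/andP; split; lra.
have := Hr s; rewrite /ball /= distrC => /(_ sr sNt s01) H.
have := mx_entry_le (deriv01 F t - quot01 F t s) i j.
rewrite !mxE => H2.
have -> : F s i j - F t i j - deriv01 F t i j * (s - t) =
   - (deriv01 F t i j - (s - t)^-1 * (F s i j - F t i j)) * (s - t) by field.
rewrite normrM normrN ler_wpM2r //; apply: le_trans H2 (ltW H).
Qed.

Definition flipped_curve G (t : R) : 'M[R]_n.+1 := perm_mx (@eta n) *m spin_cover (G t).

Lemma spin_cover_convex G : locally_convex_curve G ->
  {ae mu, forall t, 0 < t < 1 -> convex_at G t /\
    is_mx_derive (fun s => spin_cover (G s)) t (spin_cover (G t) *m log_deriv G t)}.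
Proof.
move=> [SG acG aeG]; apply: aeS aeG => t H /andP[t0 t1].
have [|dG cG] := H; first by rewrite !ltW.
split=> //.
apply: (@spin_cover_der R n.+1 G t (Num.min t (1 - t))).
- by rewrite lt_min t0 subr_gt0.
- move=> s; rewrite lt_min => /andP[]; rewrite !ltr_norml => /andP[? ?] /andP[? ?].
  by apply: SG; apply/andP; split; lra.
- by apply: derivable01_is_mx_derive => //; rewrite t0.
Qed.

Lemma spin_cover_mx_abs_cont G : locally_convex_curve G -> mx_abs_cont 0 1 (fun s => spin_cover (G s)).
Proof.
move=> [SG acG _]; apply: mx_abs_cont_spin_cover => //.
exact: abs_continuous01_mx.
Qed.

(** Reversing the rows is a constant left multiplication by an orthogonal matrix. *)
Lemma so_curve_flipped G : locally_convex_curve G -> so_curve (flipped_curve G).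
Proof.
move=> cG; have [SG _ _] := cG; split.
  apply: convex_curve_mull => //; split; first exact: spin_cover_mx_abs_cont.
  apply: aeS (spin_cover_convex cG) => t H /H[[_ [kap kap0 kapE]] D].
  by exists kap => //; rewrite /skew_jacobi -kapE.
move=> t t01; rewrite /orthogonal_mx /flipped_curve trmx_mul mulmxA -[perm_mx _ *m _ *m (spin_cover _)^T]mulmxA.
by rewrite (orthogonal_spin_cover (SG t t01)) mulmx1 eta_tr eta_sqr.
Qed.

Lemma singE G : locally_convex_curve G -> sing G = singular_times (flipped_curve G).
Proof.
move=> [SG _ _]; apply/seteqP; split=> t.
  move=> [[t01 [St nB]] /not_orP[t0 t1]]; split.
    have /andP[h0 h1] := t01; rewrite !lt_neqAle h0 h1 !andbT.
    by apply/andP; split; apply/eqP => tE; [apply: t0|apply: t1].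
  by move=> nX; apply: nB; apply/Bru_lu_regular.
move=> [/andP[t0 t1] nX]; have t01 : 0 <= t <= 1 by rewrite !ltW.
split.
  by split=> //; split; [exact: SG|move=> /(Bru_lu_regular (SG t t01))].
by case=> tE; move: t0 t1; rewrite tE ltxx.
Qed.

Lemma sing_H01 G : locally_convex_curve G -> H01 (sing G).
Proof.
move=> cG; rewrite singE //; split; last exact/singular_times_compact/so_curve_flipped.
by move=> t [/andP[t0 t1] _]; rewrite /= in_itv /= !ltW.
Qed.

(* All three topologies are finer than uniform convergence of the projected
   curves, for which continuity holds. *)
Lemma continuous_sing z0 z1 (L : set (R -> 'M[R]_(cl_dim n.+1))) dL :
  L `<=` convex_curves z0 z1 ->
  (forall G, L G -> forall e, 0 < e -> exists2 d, 0 < d & forall H, L H ->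
     (dL G H < d%:E)%E -> forall t, 0 <= t <= 1 ->
     entries_le e (spin_cover (H t) - spin_cover (G t))) ->
  continuous_map L dL H01 dist_H sing.
Proof.
move=> LC unif; split=> [G /LC[cG _ _]|G LG e e0]; first exact: sing_H01.
have [cG G0 G1] := LC G LG.
have e20 : 0 < e / 2 by rewrite divr_gt0.
have [d' d'0 sh] := shadow_uniform (so_curve_flipped cG) e20.
have [d d0 Hd] := unif G LG d' d'0.
exists d => // H LH GH; have [cH H0 H1] := LC H LH.
have cl : uclose d' (flipped_curve G) (flipped_curve H).
  move=> t t01 i j; have := Hd H LH GH t t01 (rev_ord i) j.
  by rewrite /flipped_curve -mulmxBr eta_mulmx.
have {}sh := sh _ (so_curve_flipped cH) _ _ cl.
have {}sh t := sh (congr1 (fun z => perm_mx (@eta n) *m spin_cover z) (etrans H0 (esym G0)))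
  (congr1 (fun z => perm_mx (@eta n) *m spin_cover z) (etrans H1 (esym G1))) t.
apply: dist_H_lt => //; rewrite !singE // => t St;
  have t01 : 0 <= t <= 1 by case: St => /andP[? ?] _; rewrite !ltW.
- by have [/(_ St)] := sh t t01.
- by have [_ /(_ St)] := sh t t01.
Qed.

End Curves.

(** * Each topology controls uniform convergence of the projected curves *)

Section Topologies.
Context {R : realType} {n : nat}.
Local Notation mu := (@lebesgue_measure R).
Implicit Types (G H : R -> 'M[R]_(cl_dim n.+1)).

Lemma spin_cover_unif : exists2 K : R, 0 < K & forall G H (d t : R),
  locally_convex_curve G -> locally_convex_curve H -> 0 <= t <= 1 ->
  entries_le d (G t - H t) -> entries_le (K * d) (spin_cover (H t) - spin_cover (G t)).
Proof.
have [K K0 HK] := @spin_cover_lip R n.+1; exists K => // G H d t [SG _ _] [SH _ _] t01 GH.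
apply: HK; [exact: SH|exact: SG|] => i j.
by have := GH i j; rewrite !mxE distrC.
Qed.

Lemma dist_Cr_ge r G H (t : R) : 0 <= t <= 1 -> (`|G t - H t|%:E <= dist_Cr r G H)%E.
Proof.
move=> t01; rewrite /dist_Cr (bigD1 ord0) //=.
have ge0 k : (0 <= ereal_sup [set `|deriv01n k G t - deriv01n k H t|%:E | t in `[0%R, 1%R]])%E.
  apply: (@le_trans _ _ `|deriv01n k G t - deriv01n k H t|%:E); first by rewrite lee_fin.
  by apply: ereal_sup_ubound; exists t => //=; rewrite in_itv.
apply: (@le_trans _ _ (ereal_sup [set `|deriv01n 0 G t - deriv01n 0 H t|%:E | t in `[0%R, 1%R]])).
  by apply: ereal_sup_ubound; exists t => //=; rewrite in_itv.
by rewrite leeDl // sume_ge0 // => k _; exact: (ge0 k).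
Qed.

(** The term of order 1 is the one kept: together with the common initial point it bounds the
    uniform distance. *)
Lemma dist_Hr_ge r G H : (1 <= r)%N ->
  (L2norm01 (fun t => `|deriv01 G t - deriv01 H t|%R) <= dist_Hr r G H)%E.
Proof.
case: r => // r _; rewrite /dist_Hr (bigD1 (lift ord0 ord0)) //=.
by rewrite leeDl // sume_ge0 // => k _; exact: L2norm01_ge0.
Qed.

Lemma measurable_norm_deriv r G H : (2 <= r)%N -> Hr01 r G -> Hr01 r H ->
  measurable_fun (`[0, 1] : set R) (fun t => `|deriv01 G t - deriv01 H t|).
Proof.
case: r => [//|[//|r]] _ [[_ cG] _ _] [[_ cH] _ _].
have {}cG := cG 1%N isT; have {}cH := cH 1%N isT.
apply: subspace_continuous_measurable_fun; first exact: measurable_itv.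
move=> t; apply: cvg_norm; apply: cvgB; [exact: cG|exact: cH].
Qed.

Lemma Hr_dist0 r z0 z1 G H (t : R) i j : (2 <= r)%N -> LHr r z0 z1 G -> LHr r z0 z1 H ->
  0 <= t <= 1 -> (`|(G t - H t) i j|%:E <= dist_Hr r G H)%E.
Proof.
move=> r2 [[cG G0 _] hG vG] [[cH H0 _] hH vH] t01.
apply: le_trans (dist_Hr_ge _ _ (ltnW r2)).
have mG : mx_abs_cont 0 1 G by apply: abs_continuous01_mx; case: cG.
have mH : mx_abs_cont 0 1 H by apply: abs_continuous01_mx; case: cH.
pose f s := G s i j - H s i j.
have acf : abs_cont 0 1 f.
  apply: (abs_cont_dom (C := 1) (mG i j) (mH i j)) => x y _ _ _.
  rewrite mul1r /f.
  have -> : G y i j - H y i j - (G x i j - H x i j) =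
    (G y i j - G x i j) - (H y i j - H x i j) by ring.
  exact: ler_normB.
have aef : {ae mu, forall s : R, 0 < s < 1 ->
     exists2 l, is_derive s 1 f l & `|l| <= \sum_(k < 1) `| `|deriv01 G s - deriv01 H s| |}.
  apply: aeW => s s01.
  have s01' : 0 <= s <= 1 by case/andP: s01 => ? ?; rewrite !ltW.
  have dG := derivable01_is_mx_derive s01 (vG s s01').1.
  have dH := derivable01_is_mx_derive s01 (vH s s01').1.
  exists (deriv01 G s i j - deriv01 H s i j).
    have -> : f = (fun s => G s i j) - (fun s => H s i j) by [].
    exact: is_deriveB (dG i j) (dH i j).
  rewrite big_ord1 normr_id; have := mx_entry_le (deriv01 G s - deriv01 H s) i j.
  by rewrite !mxE.
have := L2_majorant acf (fun _ => measurable_norm_deriv r2 hG hH) aef t01.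
rewrite big_ord1; apply: le_trans.
by rewrite /f G0 H0 subrr subr0 !mxE.
Qed.

Lemma skew_jacobi_tr kap : (skew_jacobi kap : 'M[R]_n.+1)^T = - skew_jacobi kap.
Proof.
rewrite /skew_jacobi linear_sum -sumrN; apply: eq_bigr => j _.
by rewrite linearZ /= -scalerN /frak_a linearB /= !trmx_delta opprB.
Qed.

Lemma skew_jacobi_entries_le (kap kap' : 'I_n -> R) :
  entries_le (\sum_j `|kap j - kap' j|) (skew_jacobi kap - skew_jacobi kap').
Proof.
move=> i l; rewrite /skew_jacobi -sumrB summxE; apply: le_trans (ler_norm_sum _ _ _) _.
apply: ler_sum => j _; rewrite -scalerBl mxE normrM ler_piMr // !mxE.
by case: (_ && _); case: (_ && _); rewrite ?subrr ?subr0 ?sub0r ?normrN ?normr0 ?normr1.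
Qed.

(** The map x - 1/x expands distances on the positive half-line, so L^2 closeness of the xi_j gives
    that of the kappa_j. *)
Lemma xi_lip (x y : R) : 0 < x -> 0 < y ->
  `|x - y| <= `|(x - x^-1) - (y - y^-1)|.
Proof.
move=> x0 y0; have -> : (x - x^-1) - (y - y^-1) = (x - y) * (1 + (x * y)^-1).
  by field; rewrite !gt_eqF.
have p : 0 <= (x * y)^-1 by rewrite invr_ge0 mulr_ge0 ?ltW.
by rewrite normrM ler_peMr // ger0_norm ?addr_ge0 // lerDl.
Qed.

Lemma kappaE G (t : R) kap j : log_deriv G t = \sum_(j < n) kap j *: frak_a R j ->
  kappa G j t = kap j.
Proof.
rewrite /kappa => ->; rewrite -/(skew_jacobi kap) skew_jacobi_lower ?subdiag_mx_sub //.
Qed.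

Lemma H1_dist0 z0 z1 G H (t : R) i j : LH1 z0 z1 G -> LH1 z0 z1 H -> 0 <= t <= 1 ->
  (`|(spin_cover (H t) *m (spin_cover (G t))^T - 1%:M) i j / n.+1%:R ^+ 2|%:E
     <= dist_H1 G H)%E.
Proof.
move=> [[cG G0 _] hG] [[cH H0 _] hH] t01.
pose N : R := n.+1%:R; have N0 : 0 < N by rewrite ltr0n.
have mG := spin_cover_mx_abs_cont cG; have mH := spin_cover_mx_abs_cont cH.
have [SG _ _] := cG; have [SH _ _] := cH.
(* The factor N^2 absorbs the two multiplications by orthogonal matrices in the derivative, so that
   the sum of the differences of the xi_j bounds it with constant 1. *)
pose f s := (spin_cover (H s) *m (spin_cover (G s))^T) i j / N ^+ 2.
have acf : abs_cont 0 1 f.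
  have mGT : mx_abs_cont 0 1 (fun s => (spin_cover (G s))^T).
    by move=> k l; apply: abs_cont_eq (mG l k) => s _; rewrite [RHS]mxE.
  exact: (abs_contM ler01 (mx_abs_cont_mul ler01 mH mGT i j) (abs_cont_cst 0 1 (N ^+ 2)^-1)).
have aef : {ae mu, forall s : R, 0 < s < 1 ->
     exists2 l, is_derive s 1 f l & `|l| <= \sum_j `|xi G j s - xi H j s|}.
  apply: aeS (aeI (spin_cover_convex cG) (spin_cover_convex cH)) => s [HG HH] s01.
  have s01' : 0 <= s <= 1 by case/andP: s01 => ? ?; rewrite !ltW.
  have [[_ [kG kG0 kGE]] dG] := HG s01; have [[_ [kH kH0 kHE]] dH] := HH s01.
  rewrite kGE -/(skew_jacobi kG) in dG; rewrite kHE -/(skew_jacobi kH) in dH.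
  have D := derM (is_mx_derive_mul dH (is_mx_derive_tr dG) i j) (der_cst (N ^+ 2)^-1 s).
  set Q := spin_cover (G s) in D; set Q' := spin_cover (H s) in D.
  exists ((Q' *m (skew_jacobi kH - skew_jacobi kG) *m Q^T) i j / N ^+ 2).
    apply: (der_eq D); rewrite mulr0 addr0; congr (_ i j * _).
    by rewrite trmx_mul skew_jacobi_tr mulNmx mulmxN mulmxBr mulmxBl !mulmxA.
  have bQ := orthogonal_entries_le (orthogonal_spin_cover (SG s s01')).
  have bQ' := orthogonal_entries_le (orthogonal_spin_cover (SH s s01')).
  have bQT : entries_le 1 Q^T by move=> k l; rewrite mxE; exact: bQ.
  have := entries_le_mul (entries_le_mul bQ' (skew_jacobi_entries_le kH kG)) bQT i j => B.
  rewrite normrM [X in _ * X]ger0_norm ?invr_ge0 ?exprn_ge0 ?(ltW N0) //.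
  rewrite ler_pdivrMr ?exprn_gt0 //; apply: le_trans B _.
  rewrite -/N mul1r mulr1 mulrA -expr2 mulrC ler_wpM2r ?exprn_ge0 ?(ltW N0) //.
  apply: ler_sum => k _; rewrite /xi (kappaE _ kGE) (kappaE _ kHE) distrC.
  exact: xi_lip.
have mxi k : measurable_fun (`[0, 1] : set R) (fun s => xi G k s - xi H k s).
  by apply: measurable_funB; [case: (hG k)|case: (hH k)].
have := L2_majorant acf mxi aef t01; apply: le_trans; rewrite lee_fin.
have -> : f 0 = (1%:M : 'M[R]_n.+1) i j / N ^+ 2.
  rewrite /f H0 -G0 (orthogonal_spin_cover (SG 0 _)) //.
  by rewrite lexx ler01.
by rewrite /f -mulrBl -/N [X in `|X / _|]mxE [X in _ + X]mxE.
Qed.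

End Topologies.

Theorem theorem1 (R : realType) (n : nat) (hn : (2 <= n)%N)
    (z0 z1 : 'M[R]_(cl_dim n.+1))
    (hz0 : Spin R n.+1 z0) (hz1 : Spin R n.+1 z1) :
  [/\ forall r : nat, (1 <= r)%N ->
        continuous_map (LCr r z0 z1) (dist_Cr r) H01 dist_H sing,
      forall r : nat, (2 <= r)%N ->
        continuous_map (LHr r z0 z1) (dist_Hr r) H01 dist_H sing
    & continuous_map (LH1 z0 z1) dist_H1 H01 dist_H sing].
Proof.
have [K K0 HK] := @spin_cover_unif R n.
have d0 (e : R) : 0 < e -> 0 < e / K by move=> e0; rewrite divr_gt0.
have dK (e : R) : K * (e / K) = e by rewrite mulrC divfK // gt_eqF.
split.
- move=> r _; apply: (@continuous_sing R n z0 z1) => [G [] //|G [[cG _ _] _ _] e e0].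
  exists (e / K); first exact: d0.
  move=> H [[cH _ _] _ _] GH t t01; rewrite -[e]dK; apply: HK => // i j.
  apply: le_trans (mx_entry_le _ i j) _.
  by rewrite -lee_fin (le_trans (dist_Cr_ge r G H t01)) // ltW.
- move=> r r2; apply: (@continuous_sing R n z0 z1) => [G [] //|G LG e e0].
  exists (e / K); first exact: d0.
  move=> H LH GH t t01; rewrite -[e]dK; apply: HK => //.
    by case: LG => -[].
    by case: LH => -[].
  by move=> i j; rewrite -lee_fin (le_trans (Hr_dist0 i j r2 LG LH t01)) // ltW.
- apply: (@continuous_sing R n z0 z1) => [G [] //|G LG e e0].
  pose N : R := n.+1%:R; have N0 : 0 < N by rewrite ltr0n.
  (* Two factors N come from [H1_dist0] and the third from multiplying back by the projected curve
     of G. *)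
  exists (e / N ^+ 3); first by rewrite divr_gt0 // exprn_gt0.
  move=> H LH GH t t01; have [[[SG _ _] _ _] _] := LG.
  have oG := orthogonal_spin_cover (SG t t01).
  have -> : spin_cover (H t) - spin_cover (G t) =
      (spin_cover (H t) *m (spin_cover (G t))^T - 1%:M) *m spin_cover (G t).
    by rewrite mulmxBl mul1mx -mulmxA orthogonal_mxT // mulmx1.
  have -> : e = N * (e / N * 1) by field; rewrite gt_eqF.
  apply: entries_le_mul; last exact: orthogonal_entries_le.
  move=> i j; have := le_lt_trans (H1_dist0 i j LG LH t01) GH.
  rewrite lte_fin normrM normfV -/N (ger0_norm (exprn_ge0 2 (ltW N0))) => /ltW.
  rewrite ler_pdivrMr ?exprn_gt0 //.
  by have -> : e / N ^+ 3 * N ^+ 2 = e / N by field; rewrite gt_eqF.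
Qed.
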